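(* Let $\Omega=[-1,1]$. Let $m\ge1$ be an integer, let $f:\Omega\to\mathbb{R}$ with $f\in W^{\sigma,2}(\Omega)$, $\sigma\ge 2m+4$, and suppose $|f'|\ge\kappa_f>0$ on $\Omega$ for some constant $\kappa_f$. Let $g_n$ be the polynomial interpolant of $f$ at the Gauss-Lobatto quadrature points of order $n$. Let $\varrho$ be a probability measure on $\Omega$ of the form $d\varrho(\alpha)=r(\alpha)\,d\alpha$ with $r\in W^{m,1}(\Omega)$. Let $p_\mu$ and $p_{\nu_n}$ be the probability density functions of $\mu=f_\sharp\varrho$ and $\nu_n=(g_n)_\sharp\varrho$, and let $A=\mathrm{image}(f)$. Then there are $n_0\in\mathbb{N}$ and a constant $C$ independent of $n$ such that for all $n\ge n_0$, $$\|p_\mu-p_{\nu_n}\|_{L^1(\mathbb{R})}\le C\,\|p_\mu\|_{W^{m,1}(A)}^{\frac1{m+1}}\,\|f\|_{W^{\sigma,2}(\Omega)}^{\frac1{m+1}}\,n^{-\frac{m}{m+1}\left(\sigma-\frac56\right)}.$$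
   Context: Pushforward: for a Borel measure $\varrho$ on $\Omega$ and measurable $h:\Omega\to\mathbb{R}$, $h_\sharp\varrho(B)=\varrho(h^{-1}(B))$ for Borel $B\subseteq\mathbb{R}$. The probability density function (PDF) of a measure on $\mathbb{R}$ is its density with respect to Lebesgue measure. $W^{k,p}$ denotes the Sobolev space of functions whose weak derivatives up to order $k$ are in $L^p$ (with respect to Lebesgue measure). The Gauss-Lobatto quadrature points of order $n$ are the $n-1$ roots of $p_n'$, where $p_n$ is the Legendre polynomial of degree $n$ on $[-1,1]$, together with the endpoints $-1$ and $1$; thus $g_n$ is the polynomial of degree at most $n$ agreeing with $f$ at these $n+1$ points. *)

(* Defs.v *)
From HB Require Import structures.
From mathcomp Require Import all_boot all_order all_algebra.
From mathcomp Require Import all_classical all_reals all_analysis.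

Set Implicit Arguments.
Unset Strict Implicit.
Unset Printing Implicit Defensive.

Import Order.TTheory GRing.Theory Num.Theory.
Import numFieldNormedType.Exports.

Local Open Scope classical_set_scope.
Local Open Scope ring_scope.

Definition Omega {R : realType} : set R := `[-1, 1].

Section Sobolev.
Context {R : realType}.
Implicit Types (U : set R) (u v phi : R -> R) (k : nat) (p : R).

Definition test_function U phi : Prop :=
  (forall k x, derivable (derive1n k phi) x 1) /\
  exists K : set R, [/\ compact K, K `<=` U & forall x, ~ K x -> phi x = 0].

(* [locally_integrable] includes the openness of [U]. *)
Definition is_weak_deriv U k u v : Prop :=
  [/\ locally_integrable U u, locally_integrable U v &
    forall phi, test_function U phi ->
      \int[lebesgue_measure]_(x in U) (u x * derive1n k phi x) =
      (-1) ^+ k * \int[lebesgue_measure]_(x in U) (v x * phi x)].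

(* A representative of the k-th weak derivative, unique up to a null set;
   a junk value if there is none. *)
Definition weak_deriv U k u : R -> R :=
  xget (cst 0) [set v | is_weak_deriv U k u v].

Definition Lp_norm U p u : \bar R :=
  Lnorm (@lebesgue_measure R) p%:E (EFin \o (u \_ U)).

Definition in_sobolev U k p u : Prop :=
  forall j, (j <= k)%N ->
    exists v, is_weak_deriv U j u v /\ (Lp_norm U p v < +oo)%E.

(* Only meaningful when [in_sobolev U k p u]. *)
Definition sobolev_norm U k p u : \bar R :=
  ((\sum_(j < k.+1) Lp_norm U p (weak_deriv U j u) `^ p) `^ p^-1)%E.

End Sobolev.

Section Densities.
Context {R : realType}.

Definition has_density (mu : set R -> \bar R) (D : set R) (r : R -> R) : Prop :=
  measurable_fun D r /\
  forall B, measurable B ->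
    mu B = (\int[lebesgue_measure]_(x in D `&` B) (r x)%:E)%E.

(* For [rho] carried by [D] and [h] a function on [D], extended arbitrarily
   to the line: only the preimage within [D] is meaningful. *)
Definition pushforward_on (D : set R) (rho : set R -> \bar R) (h : R -> R) :
    set R -> \bar R :=
  fun B => rho (D `&` h @^-1` B).

(* A representative of the density, unique up to a null set; a junk value if
   [mu] has no density. *)
Definition pdf (mu : set R -> \bar R) : R -> R :=
  xget (cst 0) [set p | has_density mu setT p].

End Densities.

Section Interpolation.
Context {R : realType}.

(* Rodrigues' formula. *)
Definition legendre (n : nat) : {poly R} :=
  (2 ^+ n * n`!%:R)^-1 *: derivn n (('X ^+ 2 - 1) ^+ n).

Definition gauss_lobatto (n : nat) : set R :=
  [set x | [\/ x = -1, x = 1 | root (deriv (legendre n)) x]].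

Definition is_interpolant (n : nat) (f : R -> R) (g : {poly R}) : Prop :=
  (size g <= n.+1)%N /\ forall x, gauss_lobatto n x -> g.[x] = f x.

(* For [n = 0] the derivative of the Legendre polynomial vanishes identically,
   and the value is junk. *)
Definition interpolant (n : nat) (f : R -> R) : {poly R} :=
  xget 0 [set g | is_interpolant n f g].

(* The derivative relative to [D], one-sided at the endpoints of an interval. *)
Definition deriv_on (D : set R) (f : R -> R) (x : R) : R :=
  lim ((fun y => (f y - f x) / (y - x)) @ within D (dnbhs x)).

End Interpolation.

(* Main.v *)
(* Since the constant may depend on everything but [n], the Sobolev norms on
   the right only have to be nonzero, and the content of the theorem is the rate.

   By du Bois-Reymond's lemma a function of W^{k,p} on an interval is almost
   everywhere a k-fold primitive; so f' has sigma - 2 continuous derivatives, and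
   Jackson's theorem approximates it by polynomials at the rate n^(2 - sigma).
   The primitive of the error is Lipschitz; it is approximated once more, by a
   polynomial of degree about n^(3/4), and the rest is interpolated at the cost
   of a factor sqrt(n + 1), because the squares of the Lagrange polynomials at
   the Gauss-Lobatto points add up to at most 1 (Fejer).  A polynomial of degree
   d bounded by M on [-1, 1] has variation at most 2 d M there, whence
   |f' - g_n'|_1 = O(n^(11/4 - sigma)), which suffices as sigma >= 2 m + 4.
   Uniformly, Markov's inequality gives g_n' -> f', so that g_n is eventually a
   diffeomorphism onto f([-1, 1]), like f.

   The change of variables y = g_n(x) turns the distance of the densities into the
   integral of |r(tau x) |g_n'(x)| / |f'(tau x)| - r(x)| with tau = f^-1 o g_n,
   and |tau x - x| = O(|f' - g_n'|_1); translating the primitive r by at most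
   delta costs at most 2 delta |r'|_1 in L^1. *)

Require Import Defs.
From HB Require Import structures.
From mathcomp Require Import all_boot all_order all_algebra.
From mathcomp Require Import all_classical all_reals all_analysis.
From mathcomp Require Import ring lra zify measurable_realfun.

Set Implicit Arguments.
Unset Strict Implicit.
Unset Printing Implicit Defensive.

Import Order.TTheory GRing.Theory Num.Theory.
Import numFieldNormedType.Exports.

Local Open Scope classical_set_scope.
Local Open Scope ring_scope.

(** * Products of primitives *)

(** The nodes include -1 and 1, so g_n agrees with f there; once both are monotone they have the
    same image, and f^-1 o g_n maps [-1, 1] onto itself.

    The distance of the densities is controlled by the L^1 norm of f' - g_n', and this norm is the
    cheap one: through the variation it costs one factor of the degree, where a uniform bound costs
    a power from Markov's inequality. Markov is left with the qualitative task of making g_n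
    monotone. The estimate is of first order in |f' - g_n'|_1, with constants from |r'|_1, a bound
    of r and a bound of f''.

    The conclusion also asserts that the density of f is in W^{m,1} on the interior of the image. In
    the weak formulation, the substitution y = f(x) and an integration by parts on [-1, 1] show that
    the derivative of U o f^-1 is (U' / f') o f^-1, and this is repeated m times.

    Both f and g_n are extended to diffeomorphisms of the whole line, so that changes of variables
    and inverse maps need no care at the endpoints. *)

Section Triangle.
Context {R : realType}.
Local Notation mu := (@lebesgue_measure R).
Implicit Types (u v : R -> R) (a b : R).

Lemma integrable_itvS u a b c d : a <= c -> d <= b ->
  mu.-integrable `[a, b] (EFin \o u) -> mu.-integrable `[c, d] (EFin \o u).
Proof.
move=> ac db; apply: integrableS => // x; rewrite /= !in_itv /= => /andP[cx xd].
by rewrite (le_trans ac cx) (le_trans xd db).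
Qed.

Lemma integrable_patchT u (D : set R) : measurable D ->
  mu.-integrable D (EFin \o u) ->
  mu.-integrable setT (fun x => ((u \_ D) x)%:E).
Proof.
move=> mD iu; rewrite (_ : (fun x => _) = EFin \o (u \_ D))//.
by rewrite -restrict_EFin; apply/integrable_restrict => //; rewrite setTI.
Qed.

Lemma Rintegral_itv_split u a b c : a <= c -> c <= b ->
  mu.-integrable `[a, b] (EFin \o u) ->
  \int[mu]_(x in `[a, b]) u x =
  \int[mu]_(x in `[a, c]) u x + \int[mu]_(x in `[c, b]) u x.
Proof.
move=> ac cb iu.
have := @Rintegral_itvB R u (BLeft a) (BRight b) c iu.
rewrite !bnd_simp => /(_ ac cb) /eqP; rewrite subr_eq => /eqP ->.
rewrite addrC; congr (_ + _).
rewrite Rintegral_itv_obnd_cbnd //.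
apply: (integrableS _ _ _ iu) => //.
by apply: subset_itvr; rewrite bnd_simp.
Qed.

(** Fubini on the triangle s <= t, which [chi] cuts out of the square. It is the source of
    integration by parts for primitives that need not be differentiable everywhere. *)
Lemma Rintegral_triangle u v a b : a <= b ->
  mu.-integrable `[a, b] (EFin \o u) -> mu.-integrable `[a, b] (EFin \o v) ->
  \int[mu]_(t in `[a, b]) (v t * \int[mu]_(s in `[a, t]) u s) =
  \int[mu]_(s in `[a, b]) (u s * \int[mu]_(t in `[s, b]) v t).
Proof.
move=> ab iu iv.
pose u1 := u \_ `[a, b]; pose v1 := v \_ `[a, b].
have iu1 : mu.-integrable setT (EFin \o u1).
  exact: integrable_patchT.
have iv1 : mu.-integrable setT (EFin \o v1).
  exact: integrable_patchT.
pose chi (x y : R) : R := (((x <= y)%R : bool) : nat)%:R.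
pose f (z : measurableTypeR R * measurableTypeR R) : \bar R :=
  (u1 z.1 * v1 z.2 * chi z.1 z.2)%:E.
have mu1 : measurable_fun setT u1 by apply/measurable_EFinP; exact: measurable_int iu1.
have mv1 : measurable_fun setT v1 by apply/measurable_EFinP; exact: measurable_int iv1.
have chi01 x y : 0 <= chi x y <= 1 by rewrite /chi; case: (x <= y); rewrite /= ?lexx ler01.
have mf : measurable_fun setT f.
  apply/measurable_EFinP; apply: measurable_funM.
    apply: measurable_funM.
      by apply: measurableT_comp => //; exact: measurable_fst.
    by apply: measurableT_comp => //; exact: measurable_snd.
  apply: (@measurableT_comp _ _ _ _ _ _ (fun b : bool => (b : nat)%:R : R)) => //.
  by apply: measurable_fun_ler; [exact: measurable_fst|exact: measurable_snd].
have fi : (mu \x mu)%E.-integrable setT f.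
  apply/(@integrable12ltyP _ _ _ _ _ mu mu f mf).
  apply: (@le_lt_trans _ _ (\int[mu]_x (`|(u1 x)%:E| * \int[mu]_y `|(v1 y)%:E|))%E).
    apply: ge0_le_integral => //.
    - by move=> x _; apply: integral_ge0.
    - apply: (measurable_fun_fubini_tonelli_F (abse \o f)) => //.
        exact: measurableT_comp.
      by move=> z; exact: abse_ge0.
    - apply: emeasurable_funM => //.
      by apply: measurableT_comp => //; exact/measurable_EFinP.
    move=> x _.
    rewrite -ge0_integralZl//; last by apply/measurable_EFinP; exact: measurableT_comp.
    apply: ge0_le_integral => //.
    - apply: (@measurableT_comp _ _ _ _ _ _ (abse \o f) _ (pair x)) => //.
      exact: measurableT_comp.
    - apply: emeasurable_funM => //.
      by apply: measurableT_comp => //; exact/measurable_EFinP.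
    move=> y _; rewrite /f/= lee_fin !normrM.
    have /andP[c0 c1] := chi01 x y.
    by rewrite (ger0_norm c0) ler_piMr // mulr_ge0.
  rewrite (_ : (fun x : R => (`|(u1 x)%:E| * \int[mu]_y `|(v1 y)%:E|)%E) =
     (fun x : R => (\int[mu]_y `|(v1 y)%:E|) * `|(u1 x)%:E|)%E); last first.
    by apply/funext => x; rewrite muleC.
  rewrite ge0_integralZl//.
  - by apply: lte_mul_pinfty => //; [exact: integral_ge0| |];
      [rewrite ge0_fin_numE ?integral_ge0//; case/integrableP : iv1|case/integrableP : iu1].
  - by apply: measurableT_comp => //; exact/measurable_EFinP.
  - exact: integral_ge0.
(* The two iterated integrals of [f] agree; [E1] and [E2] carry out the inner integrations. *)
have := etrans (integral12_prod_meas1 fi) (esym (integral21_prod_meas1 fi)).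

rewrite /fubini_F /fubini_G /f /=.
have E1 x : (\int[mu]_y (u1 x * v1 y * chi x y)%:E)%E =
   (((fun x => u x * \int[mu]_(t in `[x, b]) v t) \_ `[a, b]) x)%:E.
  rewrite /u1 !patchE; case: ifPn => [|_]; last first.
    by apply: integral0_eq => y _; rewrite !mul0r.
  rewrite inE /= in_itv /= => /andP[ax xb].
  have ivx : mu.-integrable `[x, b] (EFin \o v).
    by apply: integrable_itvS iv.
  transitivity (\int[mu]_y ((u x)%:E * ((v \_ `[x, b]) y)%:E))%E.
    apply: eq_integral => y _; rewrite -EFinM -mulrA; congr (_ * _)%:E.
    rewrite /v1 /chi !patchE !mem_setE !in_itv /=.
    case: (leP x y) => xy /=; last by rewrite mulr0.
    by rewrite (le_trans ax xy) mulr1.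
  rewrite integralZl//; last exact: integrable_patchT.
  rewrite EFinM; congr (_ * _)%E.
  rewrite /Rintegral fineK; last exact: integrable_fin_num.
  by rewrite [in RHS]integral_mkcond restrict_EFin.
have E2 y : (\int[mu]_x (u1 x * v1 y * chi x y)%:E)%E =
   (((fun t => v t * \int[mu]_(s in `[a, t]) u s) \_ `[a, b]) y)%:E.
  rewrite /v1 !patchE; case: ifPn => [|_]; last first.
    by apply: integral0_eq => x _; rewrite mulr0 mul0r.
  rewrite inE /= in_itv /= => /andP[ay yb].
  have iuy : mu.-integrable `[a, y] (EFin \o u).
    by apply: integrable_itvS iu.
  transitivity (\int[mu]_x ((v y)%:E * ((u \_ `[a, y]) x)%:E))%E.
    apply: eq_integral => x _; rewrite -EFinM mulrAC mulrC; congr (_ * _)%:E.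
    rewrite /u1 /chi !patchE !mem_setE !in_itv /=.
    case: (leP x y) => xy /=; last by rewrite mulr0 andbF.
    by rewrite (le_trans xy yb) mulr1.
  rewrite integralZl//; last exact: integrable_patchT.
  rewrite EFinM; congr (_ * _)%E.
  rewrite /Rintegral fineK; last exact: integrable_fin_num.
  by rewrite [in RHS]integral_mkcond restrict_EFin.
under eq_integral do rewrite E1.
under [RHS]eq_integral do rewrite E2.
by move=> E; rewrite [RHS]Rintegral_mkcond [LHS]Rintegral_mkcond /Rintegral E.
Qed.

Lemma integrable_itv_bound u a b c : c \in `[a, b] ->
  mu.-integrable `[a, b] (EFin \o u) ->
  `| \int[mu]_(x in `[a, c]) u x | <= \int[mu]_(x in `[a, b]) `|u x|.
Proof.
rewrite in_itv /= => /andP[ac cb] iu.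
have iuc : mu.-integrable `[a, c] (EFin \o u).
  by apply: integrable_itvS iu.
apply: (le_trans (le_normr_Rintegral _ iuc)) => //.
rewrite (@Rintegral_itv_split (fun x => `|u x|) a b c) //; last exact: integrable_norm.
by rewrite lerDl; apply: Rintegral_ge0.
Qed.

Lemma measurable_primitive u a b : a <= b ->
  mu.-integrable `[a, b] (EFin \o u) ->
  measurable_fun `[a, b] (fun x => \int[mu]_(t in `[a, x]) u t).
Proof.
move=> ab iu; apply: subspace_continuous_measurable_fun => //.
exact: (parameterized_integral_continuous ab iu).
Qed.

Lemma integrable_bounded_mul u (w : R -> R) a b (M : R) :
  mu.-integrable `[a, b] (EFin \o u) -> measurable_fun `[a, b] w ->
  (forall x, x \in `[a, b] -> `|w x : R| <= M) ->
  mu.-integrable `[a, b] (EFin \o (fun x => u x * w x)).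
Proof.
move=> iu mw wM.
have [ab|ba] := leP a b; last first.
  rewrite set_itv_ge; last by rewrite bnd_simp -ltNge.
  exact: integrable_set0.
have M0 : 0 <= M by apply: le_trans (wM a _); rewrite // in_itv /= lexx.
apply: (@le_integrable _ _ _ mu _ _ _ (fun x => M%:E * (u x)%:E)%E) => //.
- by apply/measurable_EFinP; apply: measurable_funM => //; apply/measurable_EFinP; exact: measurable_int iu.
- move=> x /= xab; rewrite lee_fin !normrM mulrC ler_wpM2r//.
  by rewrite (ger0_norm M0); apply: wM.
- exact: integrableZl.
Qed.

(** Integration by parts for primitives of integrable functions. With U and V expanded around their
    values at a, what remains is the integral of u V0 + v U0, which the triangle turns into U0 b *
    V0 b. *)
Lemma Rintegral_mul_primitive u v a b (U V : R -> R) : a <= b ->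
  mu.-integrable `[a, b] (EFin \o u) -> mu.-integrable `[a, b] (EFin \o v) ->
  (forall x, x \in `[a, b] -> U x = U a + \int[mu]_(t in `[a, x]) u t) ->
  (forall x, x \in `[a, b] -> V x = V a + \int[mu]_(t in `[a, x]) v t) ->
  U b * V b = U a * V a + \int[mu]_(t in `[a, b]) (u t * V t + U t * v t).
Proof.
move=> ab iu iv UE VE.
have bab : b \in `[a, b] by rewrite in_itv /= ab lexx.
pose U0 x := \int[mu]_(t in `[a, x]) u t.
pose V0 x := \int[mu]_(t in `[a, x]) v t.
have iuV : mu.-integrable `[a, b] (EFin \o (fun t => u t * V0 t)).
  apply: (integrable_bounded_mul iu (measurable_primitive ab iv)) => x xab.
  exact: (integrable_itv_bound xab).
have ivU : mu.-integrable `[a, b] (EFin \o (fun t => v t * U0 t)).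
  apply: (integrable_bounded_mul iv (measurable_primitive ab iu)) => x xab.
  exact: (integrable_itv_bound xab).
have iuc (w : R -> R) (c : R) : mu.-integrable `[a, b] (EFin \o w) ->
    mu.-integrable `[a, b] (EFin \o (fun t => c * w t)).
  by move=> iw; apply: (integrableZl _ c iw).
have T := Rintegral_triangle ab iu iv.
have -> : \int[mu]_(t in `[a, b]) (u t * V t + U t * v t) =
  \int[mu]_(t in `[a, b]) ((V a * u t + U a * v t) + (u t * V0 t + v t * U0 t)).
  apply: eq_Rintegral => x; rewrite inE => xab; rewrite (UE x xab) (VE x xab).
  by rewrite /U0 /V0; ring.
have i1 : mu.-integrable `[a, b] (EFin \o (fun t => V a * u t + U a * v t)).
  apply: (integrableD _ (iuc _ (V a) iu) (iuc _ (U a) iv)) => //.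
have i2 : mu.-integrable `[a, b] (EFin \o (fun t => u t * V0 t + v t * U0 t)).
  exact: (integrableD _ iuV ivU).
rewrite RintegralD // RintegralD //; [|exact: iuc|exact: iuc].
rewrite RintegralD // !RintegralZl//.
rewrite [X in _ + X]addrC.
have -> : \int[mu]_(t in `[a, b]) (v t * U0 t) =
   \int[mu]_(t in `[a, b]) (V0 b * u t - u t * V0 t).
  rewrite {}T; apply: eq_Rintegral => s; rewrite inE => /= sab.
  have /andP[as_ sb] : a <= s <= b by move: sab; rewrite in_itv.
  rewrite /V0 (Rintegral_itv_split as_ sb iv); ring.
rewrite RintegralB //; last exact: iuc.
rewrite RintegralZl// (UE b bab) (VE b bab) -/(U0 b) -/(V0 b); ring.
Qed.

End Triangle.

(** * Iterated primitives and their algebra *)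

Section Chains.
Context {R : realType}.
Local Notation mu := (@lebesgue_measure R).
Local Notation I11 := (`[(-1 : R), 1]).
Implicit Types (u v w : R -> R) (B : (R -> R) -> Prop) (k : nat).

(* [u] is a [k]-fold primitive on [-1, 1] of a function in the class [B]: for [L1]
   this is W^{k,1}, for [C0] the functions with [k] continuous derivatives. *)
Fixpoint chain B k u : Prop :=
  if k is k'.+1 then
    exists2 v, chain B k' v &
      forall x, x \in I11 -> u x = u (-1) + \int[mu]_(t in `[-1, x]) v t
  else B u.

Definition L1 u : Prop := mu.-integrable [set` I11] (EFin \o u).
Definition C0 u : Prop := {within [set` I11], continuous u}.

Lemma C0_L1 u : C0 u -> L1 u.
Proof.
move=> cu; apply: continuous_compact_integrable => //; exact: segment_compact.
Qed.

Lemma prim_C0 u v : L1 v ->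
  (forall x, x \in I11 -> u x = u (-1) + \int[mu]_(t in `[-1, x]) v t) -> C0 u.
Proof.
move=> iv uE.
have h := @parameterized_integral_continuous R (-1) 1 v _ iv.
apply/subspace_continuousP => x xI.
rewrite /from_subspace (uE x xI); have /subspace_continuousP/(_ x xI) h' := h ltac:(lra).
have h2 : (fun y => u (-1) + \int[mu]_(t in `[-1, y]) v t) y
    @[y --> within `[-1, 1] (nbhs x)] --> u (-1) + \int[mu]_(t in `[-1, x]) v t.
  by apply: cvgD; [exact: cvg_cst|exact: h'].
apply: cvg_trans h2; apply: near_eq_cvg; near=> y; rewrite [RHS]uE//; near: y; exact: withinT.
Unshelve. all: by end_near.
Qed.

Lemma chain_L1 B k u : (forall w, B w -> L1 w) -> chain B k u -> L1 u.
Proof.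
elim: k u => [|k IH] u BL; first exact: BL.
by case=> v /(IH _ BL) iv /(prim_C0 iv)/C0_L1.
Qed.

Lemma chain_C0 k u : chain L1 k.+1 u -> chain C0 k u.
Proof.
elim: k u => [|k IH] u; first by case=> v /= iv /(prim_C0 iv).
by case=> v /IH cv uE; exists v.
Qed.

Lemma chain_down B k u : (forall w, C0 w -> B w) -> (forall w, B w -> L1 w) ->
  chain B k.+1 u -> chain B k u.
Proof.
move=> CB BL; elim: k u => [|k IH] u.
  by case=> v /= /BL iv /(prim_C0 iv); exact: CB.
by case=> v /IH cv uE; exists v.
Qed.

Lemma chain_le B k l u : (forall w, C0 w -> B w) -> (forall w, B w -> L1 w) ->
  (l <= k)%N -> chain B k u -> chain B l u.
Proof.
move=> CB BL lk; rewrite -(subnK lk); elim: (k - l)%N => // n IH.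
by rewrite addSn => /(chain_down CB BL).
Qed.

Lemma chain_add B k u v : (forall w, B w -> L1 w) ->
  (forall w1 w2, B w1 -> B w2 -> B (fun x => w1 x + w2 x)) ->
  chain B k u -> chain B k v -> chain B k (fun x => u x + v x).
Proof.
move=> BL BD; elim: k u v => [|k IH] u v /=; first exact: BD.
move=> [u' cu uE] [v' cv vE]; exists (fun x => u' x + v' x); first exact: IH.
move=> x xI; rewrite uE// vE// RintegralD //; first by ring.
  by apply: integrable_itvS (chain_L1 BL cu) => //; case/andP: xI.
by apply: integrable_itvS (chain_L1 BL cv) => //; case/andP: xI.
Qed.

(** Leibniz' rule u' v + u v' and induction on k: in each product one factor has lost an order by
    differentiation, and the other is demoted by [chain_down]. Three classes allow L1 times C0 as
    well as C0 times C0. *)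
Lemma chain_mul B1 B2 B3 k u v :
  (forall w, C0 w -> B1 w) -> (forall w, B1 w -> L1 w) ->
  (forall w, C0 w -> B2 w) -> (forall w, B2 w -> L1 w) ->
  (forall w, B3 w -> L1 w) ->
  (forall w1 w2, B3 w1 -> B3 w2 -> B3 (fun x => w1 x + w2 x)) ->
  (forall w1 w2, B1 w1 -> B2 w2 -> B3 (fun x => w1 x * w2 x)) ->
  chain B1 k u -> chain B2 k v -> chain B3 k (fun x => u x * v x).
Proof.
move=> C1 L1' C2 L2 L3 BD BM; elim: k u v => [|k IH] u v; first exact: BM.
move=> cu cv; have cu0 := chain_down C1 L1' cu; have cv0 := chain_down C2 L2 cv.
case: cu cv => u' cu uE [v' cv vE].
exists (fun x => u' x * v x + u x * v' x).
  by apply: chain_add => //; apply: IH.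
move=> x xI; have [x1 x2] : -1 <= x /\ x <= 1 by move: xI; rewrite in_itv => /andP.
apply: Rintegral_mul_primitive => //.
- exact: integrable_itvS (chain_L1 L1' cu).
- exact: integrable_itvS (chain_L1 L2 cv).
- by move=> y yI; apply: uE; move: yI; rewrite !in_itv /= => /andP[-> /le_trans->].
- by move=> y yI; apply: vE; move: yI; rewrite !in_itv /= => /andP[-> /le_trans->].
Qed.

Lemma L1D w1 w2 : L1 w1 -> L1 w2 -> L1 (fun x => w1 x + w2 x).
Proof. by move=> i1 i2; exact: (integrableD _ i1 i2). Qed.

Lemma C0D w1 w2 : C0 w1 -> C0 w2 -> C0 (fun x => w1 x + w2 x).
Proof. by move=> c1 c2 x; apply: cvgD; [exact: c1|exact: c2]. Qed.

Lemma C0M w1 w2 : C0 w1 -> C0 w2 -> C0 (fun x => w1 x * w2 x).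
Proof. by move=> c1 c2 x; apply: cvgM; [exact: c1|exact: c2]. Qed.

Lemma C0_bounded w : C0 w -> exists M : R, 0 < M /\ forall x, x \in I11 -> `|w x| <= M.
Proof.
move=> cw; have : compact (w @` [set` I11]).
  by apply: continuous_compact => //; exact: segment_compact.
move=> /compact_bounded [M [Mr MB]].
exists (`|M| + 1); split; first by rewrite ltr_wpDl.
move=> x xI; apply: MB; last by exists x.
by rewrite (le_lt_trans (ler_norm M))// ltrDl.
Qed.

Lemma L1M w1 w2 : L1 w1 -> C0 w2 -> L1 (fun x => w1 x * w2 x).
Proof.
move=> i1 c2; have [M [_ MB]] := C0_bounded c2.
apply: (integrable_bounded_mul i1 _ MB).
by apply: subspace_continuous_measurable_fun.
Qed.

Lemma chainC_mul k u v : chain C0 k u -> chain C0 k v -> chain C0 k (fun x => u x * v x).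
Proof.
by apply: chain_mul => //; [exact: C0_L1|exact: C0_L1|exact: C0_L1|exact: C0D|exact: C0M].
Qed.

Lemma chainLC_mul k u v : chain L1 k u -> chain C0 k v -> chain L1 k (fun x => u x * v x).
Proof.
by apply: chain_mul => //; [exact: C0_L1|exact: C0_L1|exact: L1D|exact: L1M].
Qed.

Lemma prim_derive u v x : C0 v -> x \in `](-1 : R), 1[ ->
  (forall x, x \in I11 -> u x = u (-1) + \int[mu]_(t in `[-1, x]) v t) ->
  is_derive x 1 u (v x).
Proof.
move=> cv xI uE; have [x1 x2] : -1 < x /\ x < 1 by move: xI; rewrite in_itv => /andP.
have cvx : {for x, continuous v}.
  apply: (within_continuous_continuous _ cv) => //.
have [d1 d2] := continuous_FTC1_closed x2 (C0_L1 cv) x1 cvx.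
have d3 : is_derive x 1 (fun x => u (-1) + \int[mu]_(t in `[-1, x]) v t) (v x).
  rewrite -[v x]add0r; apply: is_deriveD.
  have d0 : is_derive x 1 (fun x => \int[mu]_(t in `[-1, x]) v t) (v x).
    by apply: DeriveDef; [exact: d1|rewrite -derive1E].
  exact: d0.
apply: (near_eq_is_derive _ d3).
near=> y; rewrite [RHS]uE//.
have : y \in `]-1, 1[ by near: y; exact: near_in_itvoo.
by rewrite !in_itv /= => /andP[/ltW -> /ltW ->].
Unshelve. all: by end_near.
Qed.

Lemma FTC2_C0 u v x : C0 u -> C0 v ->
  (forall x, x \in `](-1 : R), 1[ -> is_derive x 1 u (v x)) ->
  x \in I11 -> u x = u (-1) + \int[mu]_(t in `[-1, x]) v t.
Proof.
move=> cu cv du; rewrite in_itv /= => /andP[]; rewrite le_eqVlt => /predU1P[<- _|x1 x2].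
  by rewrite set_itv1 Rintegral_set1 addr0.
have sub : `[-1, x] `<=` [set` I11].
  by move=> y /=; rewrite !in_itv /= => /andP[-> /le_trans ->].
have cu' := continuous_subspaceW sub cu; have cv' := continuous_subspaceW sub cv.
have duoo : forall y, y \in `]-1, x[ -> is_derive y 1 u (v y).
  by move=> y yI; apply: du; move: yI; rewrite !in_itv /= => /andP[-> /lt_le_trans ->].
have := @continuous_FTC2 R v u (-1) x x1 cv'.
rewrite /Rintegral => ->; first by rewrite /=; ring.
- have /(continuous_within_itvP _ x1) [_ c2 c3] := cu'.
  by split => // y /duoo[].
- by move=> y /duoo d; rewrite derive1E; apply: derive_val.
Qed.

Lemma C0V w : (forall x, x \in I11 -> w x != 0) -> C0 w -> C0 (fun x => (w x)^-1).
Proof.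
move=> w0 /subspace_continuousP cw; apply/subspace_continuousP => x xI.
by apply: cvgV; [exact: w0|exact: cw].
Qed.

Lemma C0N w : C0 w -> C0 (fun x => - w x).
Proof. by move=> cw x; apply: cvgN; exact: cw. Qed.

Lemma C0_cst (c : R) : C0 (fun=> c).
Proof. by move=> x; exact: cvg_cst. Qed.

Lemma chainC0 k w : chain C0 k w -> C0 w.
Proof. by move/(@chain_le _ _ 0%N w (fun _ h => h) C0_L1); apply. Qed.

Lemma chainC_cst (c : R) k : chain C0 k (fun=> c).
Proof.
elim: k c => [|k IH] c; first exact: C0_cst.
exists (fun=> 0); first exact: IH.
by move=> x _; rewrite /Rintegral integral0 addr0.
Qed.

Lemma chainC_scale (c : R) k w : chain C0 k w -> chain C0 k (fun x => c * w x).
Proof. exact: (chainC_mul (chainC_cst c k)). Qed.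

(** The derivative - v / w^2 has k orders, because 1 / w has k orders by the induction hypothesis
    for the same w, demoted once. *)
Lemma chainC_inv k w : (forall x, x \in I11 -> w x != 0) ->
  chain C0 k w -> chain C0 k (fun x => (w x)^-1).
Proof.
elim: k w => [|k IH] w w0; first exact: C0V.
move=> cw; have iw : chain C0 k (fun x => (w x)^-1).
  by apply: IH => //; exact: (chain_down (fun _ h => h) C0_L1 cw).
have [v cv wE] := cw.
have c1 : chain C0 k (fun x => (-1) * v x * ((w x)^-1 * (w x)^-1)).
  by apply: chainC_mul; [exact: chainC_scale|exact: chainC_mul].
exists (fun x => (-1) * v x * ((w x)^-1 * (w x)^-1)) => // x xI.
apply: (FTC2_C0 (u := fun x => (w x)^-1)) xI => //.
- exact: C0V (chainC0 cw).
- exact: chainC0 c1.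
move=> y yI; have wy0 : w y != 0 by apply: w0; move: yI; rewrite !in_itv /= => /andP[/ltW -> /ltW ->].
have := is_deriveV wy0 (prim_derive (chainC0 cv) yI wE).
rewrite (_ : _ * (_ / _) = - w y ^- 2 *: v y)//.
by rewrite -exprVn expr2 /GRing.scale /=; ring.
Qed.

End Chains.

(** * Test functions and weak derivatives *)

Section Smooth.
Context {R : realType}.
Implicit Types (p q : {poly R}) (f g : R -> R) (x : R).

(* The functions p(1/x) exp(-1/x), a class closed under differentiation. *)
Definition flat p x : R := if 0 < x then p.[x^-1] * expR (- x^-1) else 0.

(** The free exponent [k] carries the induction: the factor X of p X + c is absorbed into the power
    of s. With k = 1 and s = 1/x the bound reads |flat p x| <= C |x|. *)
Lemma poly_expRN_bound p k : exists C : R, forall s, 0 < s ->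
  `|p.[s]| * s ^+ k * expR (- s) <= C.
Proof.
elim/poly_ind: p k => [k|p c IH k].
  by exists 0 => s _; rewrite horner0 normr0 !mul0r.
have [C HC] := IH k.+1.
exists (C + `|c| * (k.+1`!%:R + 1)) => s s0.
rewrite !hornerE.
have e0 : 0 < expR (- s) by exact: expR_gt0.
have skn : s ^+ k * expR (- s) <= k.+1`!%:R + 1.
  have h := @expR_ge1Dxn R s k (ltW s0).
  have h1 : s ^+ k.+1 * expR (- s) <= k.+1`!%:R.
    rewrite expRN ler_pdivrMr ?expR_gt0//.
    rewrite mulrC -ler_pdivrMr ?ltr0n ?fact_gt0//.
    by apply: le_trans h; rewrite lerDr.
  have [s1|s1] := leP 1 s.
    rewrite (le_trans _ (_ : s ^+ k.+1 * expR (- s) <= _)) ?(le_trans h1) ?lerDl//.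
    by rewrite ler_pM2r// exprS ler_peMl// exprn_ge0 ?ltW.
  have : s ^+ k * expR (- s) <= 1.
    apply: mulr_ile1; [exact: exprn_ge0 (ltW s0)|exact: expR_ge0| |].
      exact: exprn_ile1 (ltW s0) (ltW s1).
    by rewrite expR_le1 oppr_le0 ltW.
  move=> /le_trans; apply; rewrite lerDr ler0n//.
have := HC s s0; have := ler_normD (p.[s] * s) c; rewrite normrM (gtr0_norm s0).
move=> h1 h2.
apply: (@le_trans _ _ ((`|p.[s]| * s + `|c|) * s ^+ k * expR (- s))).
  by rewrite ler_pM2r// ler_wpM2r// exprn_ge0 ?ltW.
rewrite mulrDl mulrDl; apply: lerD.
  by rewrite -(mulrA `|_|) -exprS.
by rewrite -mulrA ler_wpM2l.
Qed.

Lemma flat_continuous0 p : {for 0, continuous (flat p)}.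
Proof.
have [C HC] := poly_expRN_bound p 1.
have E0 : flat p 0 = 0 by rewrite /flat ltxx.
have C0 : 0 <= C by apply: le_trans (HC 1 ltr01); rewrite !mulr_ge0 ?expR_ge0.
have bnd z : `|flat p z| <= C * `|z|.
  rewrite /flat; case: ifPn => z0; last by rewrite normr0 mulr_ge0.
  have iz : 0 < z^-1 by rewrite invr_gt0.
  have := HC _ iz; rewrite expr1 normrM (gtr0_norm (expR_gt0 _)) (gtr0_norm z0).
  by rewrite mulrAC ler_pdivrMr.
rewrite /prop_for /continuous_at E0.
apply/cvgr0Pnorm_le => e e0.
near=> z; apply: (le_trans (bnd z)).
apply: (@le_trans _ _ ((C + 1) * `|z|)).
  by rewrite ler_wpM2r// lerDl.
rewrite mulrC -ler_pdivlMr ?ltr_wpDl//.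
near: z; apply: cvgr0_norm_le; [exact: cvg_id|by rewrite divr_gt0// ltr_wpDl].
Unshelve. all: by end_near. Qed.

Lemma flat_is_derive p x : is_derive x 1 (flat p) (flat ('X ^+ 2 * (p - p^`())) x).
Proof.
have [x0|x0|->] := ltgtP x 0.
- rewrite {2}/flat ltNge (ltW x0) /=.
  have d0 : is_derive x 1 (cst 0 : R -> R) 0 by exact: is_derive_cst.
  apply: (near_eq_is_derive _ d0).
  near=> y; rewrite /flat ltNge (_ : y <= 0)//.
  by apply/ltW; near: y; exact: lt_nbhsl.
- rewrite {2}/flat x0.
  have dV : is_derive x 1 (fun y : R => y^-1) (- x ^- 2 *: 1).
    by apply: is_deriveV; rewrite ?gt_eqF.
  have dp : is_derive x^-1 1 (horner p) (p^`().[x^-1]).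
    by apply: DeriveDef; [exact: derivable_horner|rewrite derivE derive1E].
  have d1 : is_derive x 1 (horner p \o (fun y => y^-1)) (p^`().[x^-1] * (- x ^- 2 *: 1)).
    exact: is_derive1_comp.
  have d2 : is_derive x 1 (expR \o (fun y => - y^-1)) (expR (- x^-1) * - (- x ^- 2 *: 1)).
    by apply: is_derive1_comp.
  have d3 := is_deriveM d1 d2.
  apply: (@near_eq_is_derive _ _ _ ((horner p \o (fun y => y^-1)) * (expR \o (fun y => - y^-1)))).
    near=> y; rewrite /flat (_ : 0 < y)//; near: y; exact: lt_nbhsr.
  move: d3 => /=; set D1 := (X in is_derive _ _ _ X -> _).
  rewrite (_ : D1 = ('X^2 * (p - p^`())).[x^-1] * expR (- x^-1))//.
  rewrite /D1 !hornerE /GRing.scale /= -exprVn; ring.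
(* Caratheodory's criterion at 0: flat p z = z flat (p X) z, and the cofactor belongs to the same
   class, so it is continuous at 0 with value 0. *)
- apply/is_derive1_caratheodory; exists (flat (p * 'X)); split.
  + move=> z; rewrite /flat ltxx subr0 subr0.
    case: ifPn => [z0|_]; last by rewrite mul0r.
    by rewrite hornerMX; field; rewrite gt_eqF.
  + exact: flat_continuous0.
  + by rewrite /flat ltxx.
Unshelve. all: by end_near. Qed.

(* Closed under differentiation, so that its members have all derivatives. *)
Inductive smooth_expr : (R -> R) -> Prop :=
| SmoothFlat p : smooth_expr (flat p)
| SmoothAff f (c a : R) : smooth_expr f -> smooth_expr (fun x => f (c * x + a))
| SmoothCst (c : R) : smooth_expr (fun=> c)
| SmoothAdd f g : smooth_expr f -> smooth_expr g -> smooth_expr (fun x => f x + g x)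
| SmoothMul f g : smooth_expr f -> smooth_expr g -> smooth_expr (fun x => f x * g x)
| SmoothInv f : (forall x, f x != 0) -> smooth_expr f -> smooth_expr (fun x => (f x)^-1).

Lemma is_derive_aff f (c a x d : R) : is_derive (c * x + a) 1 f d ->
  is_derive x 1 (fun x => f (c * x + a)) (c * d).
Proof.
move=> df.
have da : is_derive x 1 (fun x => c * x + a) (c *: 1 + 0).
  by apply: is_deriveD.
have := @is_derive1_comp _ f (fun x => c * x + a) x _ _ df da.
by rewrite addr0 /GRing.scale /= mulr1 mulrC.
Qed.

Lemma smooth_expr_derive f : smooth_expr f ->
  exists2 g, smooth_expr g & forall x, is_derive x 1 f (g x).
Proof.
elim => {f} [p|f c a _ [f' sf' df]|c|f g sf [f' sf' df] sg [g' sg' dg]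
  |f g sf [f' sf' df] sg [g' sg' dg]|f f0 sf [f' sf' df]].
- by eexists; [exact: (SmoothFlat ('X ^+ 2 * (p - p^`())))|exact: flat_is_derive].
- exists (fun x => c * f' (c * x + a)).
    by apply: SmoothMul; [exact: SmoothCst|exact: SmoothAff].
  by move=> x; apply: is_derive_aff; exact: df.
- by exists (fun=> 0); [exact: SmoothCst|move=> x; exact: is_derive_cst].
- exists (fun x => f' x + g' x); first exact: SmoothAdd.
  by move=> x; apply: is_deriveD.
- exists (fun x => f x * g' x + g x * f' x).
    by apply: SmoothAdd; apply: SmoothMul.
  by move=> x; apply: is_deriveM.
- exists (fun x => - 1 * (f x)^-1 * (f x)^-1 * f' x).
    apply: SmoothMul sf'; apply: SmoothMul; last exact: SmoothInv.
    by apply: SmoothMul; [exact: SmoothCst|exact: SmoothInv].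
  move=> x; rewrite (_ : _ * f' x = - f x ^- 2 *: f' x); first exact: is_deriveV.
  by rewrite /GRing.scale /= -exprVn; ring.
Qed.

Lemma smooth_derivable f : smooth_expr f -> forall k x, derivable (derive1n k f) x 1.
Proof.
move=> sf k; suff [g sg ->] : exists2 g, smooth_expr g & derive1n k f = g.
  by move=> x; have [h _ /(_ x)[]] := smooth_expr_derive sg.
elim: k => [|k [g sg IH]]; first by exists f.
have [h sh dh] := smooth_expr_derive sg; exists h => //.
rewrite derive1nS IH; apply/funext => x; rewrite derive1E.
by have [_ ->] := dh x.
Qed.

(** This is e(x) / (e(x) + e(1 - x)) with e = [flat 1], rising from 0 to 1 on [0, 1]. Its derivative
    is a bump of integral 1 that needs no normalising constant. *)
Definition smooth_step x : R := flat 1 x / (flat 1 x + flat 1 (-1 * x + 1)).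

Lemma flat1_ge0 x : 0 <= flat 1 x.
Proof. by rewrite /flat; case: ifP => // _; rewrite hornerE mul1r expR_ge0. Qed.

Lemma flat1_gt0 x : 0 < x -> 0 < flat 1 x.
Proof. by move=> x0; rewrite /flat x0 hornerE mul1r expR_gt0. Qed.

Lemma smooth_step_den x : 0 < flat 1 x + flat 1 (-1 * x + 1).
Proof.
have [x0|x0] := ltP 0 x; first by rewrite ltr_pwDl ?flat1_gt0 ?flat1_ge0.
by rewrite ltr_wpDl ?flat1_gt0 ?flat1_ge0//; lra.
Qed.

Lemma smooth_step_smooth : smooth_expr smooth_step.
Proof.
apply: SmoothMul; first exact: SmoothFlat.
apply: SmoothInv => [x|]; first by rewrite gt_eqF// smooth_step_den.
by apply: SmoothAdd; [exact: SmoothFlat|apply: SmoothAff; exact: SmoothFlat].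
Qed.

Lemma smooth_step0 x : x <= 0 -> smooth_step x = 0.
Proof. by move=> x0; rewrite /smooth_step {1}/flat ltNge x0 mul0r. Qed.

Lemma smooth_step1 x : 1 <= x -> smooth_step x = 1.
Proof.
move=> x1; rewrite /smooth_step [X in _ + X](_ : _ = 0); last first.
  by rewrite /flat ltNge (_ : -1 * x + 1 <= 0)//; lra.
by rewrite addr0 divff// gt_eqF// flat1_gt0//; lra.
Qed.

Lemma smooth_expr_continuous f : smooth_expr f -> continuous f.
Proof.
move=> sf x; have [g _ dg] := smooth_expr_derive sf.
by apply: differentiable_continuous; apply/derivable1_diffP; have [] := dg x.
Qed.

Lemma smooth_step_deriv : exists g, [/\ smooth_expr g, (forall x, is_derive x 1 smooth_step (g x)),
  (forall x, x \notin `[(0:R), 1] -> g x = 0) & exists2 M : R, 0 < M & forall x, `|g x| <= M].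
Proof.
have [g sg dg] := smooth_expr_derive smooth_step_smooth; exists g.
have g0 x : x \notin `[(0:R), 1] -> g x = 0.
  rewrite in_itv /= negb_and -!ltNge => /orP[x0|x1].
    have [_ <-] := dg x.
    have d0 : is_derive x 1 (cst 0 : R -> R) 0 by exact: is_derive_cst.
    suff [_ ->] : is_derive x 1 smooth_step 0 by [].
    apply: (near_eq_is_derive _ d0); near=> y; rewrite smooth_step0//.
    by apply/ltW; near: y; exact: lt_nbhsl.
  have [_ <-] := dg x.
  have d0 : is_derive x 1 (cst 1 : R -> R) 0 by exact: is_derive_cst.
  suff [_ ->] : is_derive x 1 smooth_step 0 by [].
  apply: (near_eq_is_derive _ d0); near=> y; rewrite smooth_step1//.
  by apply/ltW; near: y; exact: lt_nbhsr.
split => //.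
have : compact (g @` `[0, 1]).
  apply: continuous_compact; last exact: segment_compact.
  by apply: continuous_subspaceT; exact: smooth_expr_continuous.
move=> /compact_bounded [M [Mr MB]].
exists (`|M| + 1); first by rewrite ltr_wpDl.
move=> x; have [xI|/g0 ->] := boolP (x \in `[(0:R), 1]); last by rewrite normr0 addr_ge0.
by apply: MB; [rewrite (le_lt_trans (ler_norm M))// ltrDl|exists x].
Unshelve. all: by end_near. Qed.

End Smooth.

Section AlmostEverywhere.
Context {R : realType}.
Local Notation mu := (@lebesgue_measure R).

Lemma leb_aeS (P Q : R -> Prop) : (forall x, P x -> Q x) ->
  {ae mu, forall x, P x} -> {ae mu, forall x, Q x}.
Proof. by move=> PQ; apply: (@filterS _ _ (ae_filter_ringOfSetsType mu)). Qed.

Lemma leb_aeI (P Q : R -> Prop) : {ae mu, forall x, P x} ->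
  {ae mu, forall x, Q x} -> {ae mu, forall x, P x /\ Q x}.
Proof. exact: (@filterI _ _ (ae_filter_ringOfSetsType mu)). Qed.

Lemma at_right_ex (A B C : set R) : nbhs (0 : R)^'+ A -> nbhs (0 : R)^'+ B ->
  nbhs (0 : R)^'+ C -> exists e, [/\ A e, B e, C e & 0 < e].
Proof.
move=> nA nB nC; near (0:R)^'+ => e.
by exists e; split => //; near: e.
Unshelve. all: by end_near. Qed.

End AlmostEverywhere.

(** * Du Bois-Reymond's lemma, by bumps at Lebesgue points *)

Section DuBoisReymond.
Context {R : realType}.
Local Notation mu := (@lebesgue_measure R).
Variables (lo hi : R).
Hypothesis lohi : lo < hi.
Local Notation U := (`]lo, hi[%classic : set R).
Implicit Types (u v : R -> R).

Variable g : R -> R.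
Hypothesis gs : smooth_expr g.
Hypothesis dg : forall x : R, is_derive x 1 (smooth_step : R -> R) (g x).
Hypothesis g0 : forall x, x \notin `[(0:R), 1] -> g x = 0.
Variable M : R.
Hypothesis M0 : 0 < M.
Hypothesis gM : forall x, `|g x| <= M.

(** An approximate identity to the right of [a]: the derivative of [step a e], hence carried by
    [a, a + e] and of integral 1. *)
Definition bump a e x : R := e^-1 * g (e^-1 * x + - (e^-1 * a)).
Definition step a e x : R := smooth_step (e^-1 * x + - (e^-1 * a)).

Lemma bump_smooth a e : smooth_expr (bump a e).
Proof. by apply: SmoothMul; [exact: SmoothCst|exact: SmoothAff]. Qed.

Lemma step_derive (a e x : R) : is_derive x 1 (step a e : R -> R) (bump a e x).
Proof. exact: is_derive_aff. Qed.

Lemma bump0 a e x : 0 < e -> x \notin `[a, a + e] -> bump a e x = 0.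
Proof.
move=> e0 xI; rewrite /bump g0 ?mulr0//; apply: contra xI.
rewrite -mulrBr !in_itv /= mulrC pmulr_lge0 ?invr_gt0// subr_ge0 => /andP[-> /=].
by rewrite ler_pdivrMr// mul1r lerBlDl.
Qed.

Lemma bump_le a e x : 0 < e -> `|bump a e x| <= M / e.
Proof.
move=> e0; rewrite /bump normrM gtr0_norm ?invr_gt0// mulrC.
by rewrite ler_pM2r ?invr_gt0.
Qed.

Lemma step0 a e x : 0 < e -> x <= a -> step a e x = 0.
Proof.
by move=> e0 xa; rewrite /step smooth_step0// -mulrBr pmulr_rle0 ?invr_gt0// subr_le0.
Qed.

Lemma step1 a e x : 0 < e -> a + e <= x -> step a e x = 1.
Proof.
by move=> e0 xa; rewrite /step smooth_step1// -mulrBr mulrC ler_pdivlMr// mul1r lerBrDl.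
Qed.

Lemma bump_test a e : 0 < e -> lo < a -> a + e < hi -> test_function U (bump a e).
Proof.
move=> e0 la eh; split; first exact: smooth_derivable (bump_smooth a e).
exists [set` `[a, a + e]]; split; first exact: segment_compact.
  move=> x /=; rewrite !in_itv /= => /andP[ax xe].
  by rewrite (lt_le_trans la ax) (le_lt_trans xe eh).
by move=> x /negP xI; apply: bump0.
Qed.

Lemma bump_integral a e : 0 < e -> \int[mu]_(x in `[a, a + e]) bump a e x = 1.
Proof.
move=> e0; have ae : a < a + e by rewrite ltrDl.
have cs (f : R -> R) : smooth_expr f -> {within `[a, a + e], continuous f}.
  by move=> sf; apply: continuous_subspaceT; exact: smooth_expr_continuous.
have := @continuous_FTC2 R (bump a e) (step a e) a (a + e) ae (cs _ (bump_smooth _ _)).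
rewrite /Rintegral => ->.
- by rewrite /= step1// step0// subr0.
- have ss : smooth_expr (step a e) by apply: SmoothAff; exact: smooth_step_smooth.
  have /(continuous_within_itvP _ ae) [_ c1 c2] := cs _ ss.
  by split => // x _; have [] := step_derive a e x.
- by move=> x _; rewrite derive1E; have [_ ->] := step_derive a e x.
Qed.

(** As the bump has integral 1, the left side is the integral of u - u a against it, and its height
    is at most M / e. The open ball of radius 2 e contains the closed interval [a, a + e] and has
    length 4 e, whence the factor 4 M. *)
Lemma bump_lebesgue_pt u a e : 0 < e -> locally_integrable setT u ->
  (`|(\int[mu]_(x in `[a, a + e]) (u x * bump a e x) - u a)%R|%:E <=
     (4 * M)%:E * davg u a (2 * e))%E.
Proof.
move=> e0 [mu_u _ liu].
have iu : mu.-integrable `[a, a + e] (EFin \o u).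
  apply/integrableP; split.
    by apply/measurable_EFinP; exact: measurable_funS mu_u.
  by apply: liu => //; exact: segment_compact.
have mb : measurable_fun `[a, a + e] (bump a e).
  apply: measurable_funS (continuous_measurable_fun _) => //.
  exact: smooth_expr_continuous (bump_smooth a e).
have bM x : x \in `[a, a+e] -> `|bump a e x| <= M / e by move=> _; exact: bump_le.
have iub := integrable_bounded_mul iu mb bM.
have iua : mu.-integrable `[a, a + e] (EFin \o (fun=> u a)).
  apply: continuous_compact_integrable; first exact: segment_compact.
  by apply: continuous_subspaceT => ?; exact: cvg_cst.
have iuab := integrable_bounded_mul iua mb bM.
have ib : mu.-integrable `[a, a + e] (EFin \o bump a e).
  apply: continuous_compact_integrable; first exact: segment_compact.
  by apply: continuous_subspaceT; exact: smooth_expr_continuous (bump_smooth a e).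
have iud : mu.-integrable `[a, a + e] (EFin \o (fun x => u x - u a)).
  exact: (integrableB _ iu iua).
have -> : \int[mu]_(x in `[a, a + e]) (u x * bump a e x) - u a =
   \int[mu]_(x in `[a, a + e]) ((u x - u a) * bump a e x).
  under [RHS]eq_Rintegral do rewrite mulrBl.
  by rewrite RintegralB // RintegralZl// bump_integral// mulr1.
have id := integrable_bounded_mul iud mb bM.
apply: (@le_trans _ _ (\int[mu]_(x in `[a, a + e]) `|(u x - u a) * bump a e x|)%:E).
  by rewrite lee_fin; exact: le_normr_Rintegral.
pose Y := (\int[mu]_(x in `[a, (a + e)%R]) ((M / e)%:E * (`|u x - u a|%R)%:E))%E.
apply: (@le_trans _ (\bar R) Y).
  rewrite /Y /Rintegral fineK; last first.
    by apply: integrable_fin_num => //; exact: (integrable_norm id).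
  apply: ge0_le_integral => //.
  - by apply: (measurable_int mu); exact: (integrable_norm id).
  - apply: measurable_funeM; apply: (measurable_int mu); exact: (integrable_norm iud).
  by move=> x _; rewrite lee_fin normrM mulrC ler_wpM2r// bump_le.
have Me : 0 <= M / e by rewrite divr_ge0 ?ltW.
rewrite /Y ge0_integralZl; [|by []|by apply: (measurable_int mu); exact: (integrable_norm iud)|by move=> x _; rewrite lee_fin|by rewrite lee_fin].
rewrite /davg /iavg lebesgue_measure_ball; last by rewrite mulr_ge0 ?ltW.
have e20 : (2 * e *+ 2) != 0 by rewrite mulrn_eq0 /= mulf_neq0 ?gt_eqF.
rewrite inver (negbTE e20) muleA -EFinM.
rewrite (_ : 4 * M * _ = M / e); last by rewrite -mulr_natr; field; rewrite gt_eqF.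
apply: lee_wpmul2l; first by rewrite lee_fin.
apply: ge0_subset_integral => //.
- exact: measurable_ball.
- apply/measurable_EFinP; apply: measurableT_comp => //.
  by apply: measurable_funB => //; exact: measurable_funS mu_u.
- move=> x /=; rewrite in_itv /= => /andP[ax xe].
  by rewrite /ball /= distrC ger0_norm ?subr_ge0//; lra.
Qed.

Lemma integrable_oo_cc u : mu.-integrable U (EFin \o u) ->
  mu.-integrable `[lo, hi] (EFin \o u).
Proof.
move=> /integrableP[mu_u iu].
have mcc : measurable_fun `[lo, hi] u.
  by apply: measurable_fun_itv_cc; apply/measurable_EFinP; exact: mu_u.
apply/integrableP; split; first exact/measurable_EFinP.
rewrite -integral_itv_bndo_bndc; last first.
  apply/measurable_EFinP; apply: measurableT_comp => //.
  by apply: measurable_funS mcc => //; apply: subset_itvl; rewrite bnd_simp.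
rewrite -integral_itv_obnd_cbnd//.
by apply/measurable_EFinP; apply: measurableT_comp => //; apply/measurable_EFinP.
Qed.

Lemma Rintegral_oo_cc u : mu.-integrable U (EFin \o u) ->
  \int[mu]_(x in U) u x = \int[mu]_(x in `[lo, hi]) u x.
Proof.
move=> /integrable_oo_cc iu; rewrite -Rintegral_itv_bndo_bndc; last first.
  by apply: (integrableS _ _ _ iu) => //; apply: subset_itvl; rewrite bnd_simp.
rewrite -Rintegral_itv_obnd_cbnd//.
by apply: (integrableS _ _ _ iu) => //; apply: subset_itv; rewrite bnd_simp.
Qed.

Lemma Rintegral_bump u a e : 0 < e -> lo <= a -> a + e <= hi ->
  \int[mu]_(x in `[lo, hi]) (u x * bump a e x) =
  \int[mu]_(x in `[a, a + e]) (u x * bump a e x).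
Proof.
move=> e0 la eh; rewrite Rintegral_mkcond [RHS]Rintegral_mkcond.
apply: eq_Rintegral => x _; rewrite !patchE !mem_setE.
case: (boolP (x \in `[a, a + e])) => xI; last by rewrite (bump0 e0 xI) mulr0 if_same.
rewrite ifT//; move: xI; rewrite !in_itv /= => /andP[/(le_trans la) -> ].
by move=> /le_trans; apply.
Qed.

Lemma davg_small (w : R -> R) c d : 0 < d -> lebesgue_pt w c ->
  \forall e \near 0^'+, ((4 * M)%:E * davg w c (2 * e) <= (d / 2)%:E)%E.
Proof.
move=> d0 wc.
have d8 : 0 < d / (8 * M) by rewrite divr_gt0 ?mulr_gt0.
have d80 : (0 < (d / (8 * M))%:E)%E by rewrite lte_fin.
have w2 : davg w c (2 * e) @[e --> 0^'+] --> 0%E.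
  have := @cvg_comp _ _ _ (fun e : R => 2 * e) (davg w c) (0^'+) (0^'+) _ _ wc.
  apply; move=> A [r /= r0 rA]; exists (r / 2); first by rewrite /= divr_gt0.
  move=> z /= zr z0; apply: rA; last by rewrite mulr_gt0.
  move: zr; rewrite /ball_ /= !sub0r !normrN normrM ger0_norm// => zr.
  by rewrite mulrC -ltr_pdivlMr.
near=> e.
have : (davg w c (2 * e) <= (d / (8 * M))%:E)%E.
  by apply/ltW; near: e; exact: (w2 _ (open_ereal_lt' d80)).
move=> /(lee_wpmul2l _) h.
have h4 : (0 <= (4 * M)%:E)%E by rewrite lee_fin mulr_ge0 ?ltW.
apply: (le_trans (h _ h4)); rewrite -EFinM lee_fin.
rewrite le_eqVlt; apply/orP; left; apply/eqP; field; exact: lt0r_neq0.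
Unshelve. all: by end_near. Qed.

(** The test function [step a e - step b e] has derivative [bump a e - bump b e], so u - V has the
    same weighted mean to the right of a as to the right of b. As e tends to 0, these means tend to
    the values at Lebesgue points, which therefore all coincide. *)
Lemma du_bois_reymond_bump u v :
  mu.-integrable U (EFin \o u) -> mu.-integrable U (EFin \o v) ->
  (forall phi, test_function U phi ->
     \int[mu]_(x in U) (u x * derive1n 1 phi x) =
     - \int[mu]_(x in U) (v x * phi x)) ->
  exists c : R, {ae mu, forall x, U x -> u x = c + \int[mu]_(t in `[lo, x]) v t}.
Proof.
move=> /integrable_oo_cc iu /integrable_oo_cc iv weak.
pose V x := \int[mu]_(t in `[lo, x]) v t.
have cV : {within `[lo, hi], continuous V}.
  exact: (parameterized_integral_continuous (ltW lohi) iv).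
have iV : mu.-integrable `[lo, hi] (EFin \o V).
  by apply: continuous_compact_integrable => //; exact: segment_compact.
pose w := (fun x => u x - V x) \_ `[lo, hi].
have iuV : mu.-integrable `[lo, hi] (EFin \o (fun x => u x - V x)).
  exact: (integrableB _ iu iV).
have liw : locally_integrable setT w by exact: integrable_locally_restrict.
have aew := lebesgue_differentiation liw.
(* integration by parts turns the weak equation into [\int (u - V) phi' = 0] *)
have key a b e : 0 < e -> lo < a -> a < b -> b + e < hi ->
    \int[mu]_(x in `[a, a + e]) (w x * bump a e x) =
    \int[mu]_(x in `[b, b + e]) (w x * bump b e x).
  move=> e0 la ab bh; have lb := lt_trans la ab.
  have ah : a + e < hi by apply: lt_trans bh; rewrite ltrD2r.
  pose phi x := step a e x + (-1) * step b e x.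
  pose psi x := bump a e x + (-1) * bump b e x.
  have sphi : smooth_expr phi.
    apply: SmoothAdd; first by apply: SmoothAff; exact: smooth_step_smooth.
    apply: SmoothMul; first exact: SmoothCst.
    by apply: SmoothAff; exact: smooth_step_smooth.
  have spsi : smooth_expr psi.
    apply: SmoothAdd; first exact: bump_smooth.
    by apply: SmoothMul; [exact: SmoothCst|exact: bump_smooth].
  have dphi (x : R) : is_derive x 1 phi (psi x).
    apply: is_deriveD; first exact: step_derive.
    by have := is_deriveZ (-1) (step_derive b e x).
  have phi0 x : x <= a -> phi x = 0.
    by move=> xa; rewrite /phi !step0 ?mulr0 ?addr0// (le_trans xa) ?ltW.
  have phi1 x : b + e <= x -> phi x = 0.
    move=> xb; rewrite /phi !step1 ?mulr1 ?subrr//.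
    by rewrite (le_trans _ xb)// lerD2r ltW.
  have tphi : test_function U phi.
    split; first exact: smooth_derivable.
    exists [set` `[a, b + e]]; split; first exact: segment_compact.
      move=> x /=; rewrite !in_itv /= => /andP[ax xe].
      by rewrite (lt_le_trans la ax) (le_lt_trans xe bh).
    move=> x /=; rewrite in_itv /= => /negP; rewrite negb_and -!ltNge.
    by move=> /orP[/ltW/phi0|/ltW/phi1].
  have := weak _ tphi.
  have -> : derive1n 1 phi = psi.
    by apply/funext => x; rewrite derive1n1 derive1E; have [_ ->] := dphi x.
  have bdd (z : R -> R) : smooth_expr z ->
      exists B : R, forall x, x \in `[lo, hi] -> `|z x| <= B.
    move=> sz; have : compact (z @` `[lo, hi]).
      apply: continuous_compact; last exact: segment_compact.
      by apply: continuous_subspaceT; exact: smooth_expr_continuous.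
    move=> /compact_bounded [B [Br HB]]; exists (`|B| + 1) => x xI.
    by apply: HB; [rewrite (le_lt_trans (ler_norm B))// ltrDl|exists x].
  have imul (f z : R -> R) : mu.-integrable `[lo, hi] (EFin \o f) -> smooth_expr z ->
      mu.-integrable `[lo, hi] (EFin \o (fun x => f x * z x)).
    move=> fi sz; have [B HB] := bdd _ sz; apply: (integrable_bounded_mul fi _ HB).
    by apply: measurable_funS (continuous_measurable_fun (smooth_expr_continuous sz)).
  have toU (f : R -> R) : mu.-integrable `[lo, hi] (EFin \o f) -> mu.-integrable U (EFin \o f).
    by move=> fi; apply: (integrableS _ _ _ fi) => //; apply: subset_itv; rewrite bnd_simp.
  rewrite !Rintegral_oo_cc; [|exact/toU/imul|exact/toU/imul] => wk.
  have ismooth (f : R -> R) : smooth_expr f -> mu.-integrable `[lo, hi] (EFin \o f).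
    move=> sf; apply: continuous_compact_integrable; first exact: segment_compact.
    by apply: continuous_subspaceT; exact: smooth_expr_continuous.
  (* The product rule on [lo, hi], without boundary terms since [phi] vanishes at both ends. *)
  have ibp : \int[mu]_(t in `[lo, hi]) (v t * phi t + V t * psi t) = 0.
    have := @Rintegral_mul_primitive R v psi lo hi V phi (ltW lohi) iv (ismooth _ spsi).
    rewrite (phi1 hi (ltW bh)) (phi0 lo (ltW la)) !mulr0 add0r => <- //.
      by move=> x _; rewrite /V set_itv1 Rintegral_set1 add0r.
    move=> x; rewrite in_itv /= => /andP[]; rewrite le_eqVlt => /predU1P[<- _|lx xh].
      by rewrite set_itv1 Rintegral_set1 addr0 (phi0 lo (ltW la)).
    have cs (f : R -> R) : smooth_expr f -> {within `[lo, x], continuous f}.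
      by move=> sf; apply: continuous_subspaceT; exact: smooth_expr_continuous.
    have := @continuous_FTC2 R psi phi lo x lx (cs _ spsi); rewrite /Rintegral => ->.
    - by rewrite /= (phi0 lo (ltW la)); ring.
    - have /(continuous_within_itvP _ lx) [_ c1 c2] := cs _ sphi.
      by split => // y _; have [] := dphi y.
    - by move=> y _; rewrite derive1E; have [_ ->] := dphi y.
  have w0 : \int[mu]_(t in `[lo, hi]) (w t * psi t) = 0.
    transitivity (\int[mu]_(t in `[lo, hi]) (u t * psi t - V t * psi t)).
      by apply: eq_Rintegral => x xI; rewrite /w patchE xI mulrBl.
    rewrite RintegralB //; [|exact: imul|exact: imul].
    move: ibp; rewrite RintegralD //; [|exact: imul|exact: imul].
    by rewrite wk => /eqP; rewrite addr_eq0 => /eqP ->; rewrite opprK subrr.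
  have iw : mu.-integrable `[lo, hi] (EFin \o w).
    apply: eq_integrable iuV => // x xI.
    by rewrite /w /= patchE xI.
  apply/eqP; rewrite -subr_eq0 -!Rintegral_bump ?ltW//.
  rewrite -RintegralB //; [|exact/imul/bump_smooth|exact/imul/bump_smooth].
  rewrite -[X in _ == X]w0; apply/eqP; apply: eq_Rintegral => x _.
  by rewrite /psi; ring.
have const a b : lo < a -> a < b -> b < hi -> lebesgue_pt w a -> lebesgue_pt w b -> w a = w b.
  move=> la ab bh wa wb.
  apply/eqP; rewrite -subr_eq0 -normr_le0; apply/ler_addgt0Pl => d d0.
  rewrite addr0.
  have bh0 : 0 < hi - b by rewrite subr_gt0.
  have [e [s1 s2 eb e0]] := at_right_ex (davg_small d0 wa) (davg_small d0 wb) (nbhs_right_lt bh0).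
  have h1 := bump_lebesgue_pt a e0 liw; have h2 := bump_lebesgue_pt b e0 liw.
  have := le_trans h1 s1; have := le_trans h2 s2; rewrite !lee_fin (key a b)//; last first.
    by rewrite -ltrBrDl.
  set z := (\int[mu]_(x in `[b, b + e]) _) => q1 q2.
  have -> : w a - w b = (z - w b) - (z - w a) by ring.
  by rewrite (le_trans (ler_normB _ _))// [leRHS](splitr d) lerD.
(* Almost every point is a Lebesgue point, and U is not a null set. *)
have [a [lah wa]] : exists a, (a \in `]lo, hi[) /\ lebesgue_pt w a.
  apply: contrapT => /forallNP noa.
  have : mu.-negligible U.
    apply: negligibleS aew => x Ux wx; exact: (noa x).
  move=> neg; have := (negligibleP mu (measurable_itv `]lo, hi[)).1 neg; rewrite /= lebesgue_measure_itv /= lte_fin lohi.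
  by rewrite -EFinD => -[] /eqP; rewrite subr_eq0 gt_eqF.
exists (w a).
apply: leb_aeS aew => x wx Ux.
have xI : x \in `[lo, hi] by move: Ux => /=; rewrite !in_itv /= => /andP[/ltW -> /ltW ->].
have wxE : u x = w x + V x by rewrite /w patchE mem_setE xI subrK.
rewrite wxE; congr (_ + _).
move: Ux lah => /=; rewrite !in_itv /= => /andP[lx xh] /andP[la ah].
by have [xa|ax|->//] := ltgtP x a; [exact: const|rewrite (const a x)].
Unshelve. all: by end_near. Qed.

(* Testing against bumps shrinking to a Lebesgue point. *)
Lemma weak0_ae0_bump u : mu.-integrable U (EFin \o u) ->
  (forall phi, test_function U phi -> \int[mu]_(x in U) (u x * phi x) = 0) ->
  {ae mu, forall x, U x -> u x = 0}.
Proof.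
move=> /integrable_oo_cc iu weak.
pose w := u \_ `[lo, hi].
have liw : locally_integrable setT w by exact: integrable_locally_restrict.
have iw : mu.-integrable `[lo, hi] (EFin \o w).
  by apply: eq_integrable iu => // x xI; rewrite /w /= patchE xI.
apply: leb_aeS (lebesgue_differentiation liw) => a wa.
rewrite /= in_itv /= => /andP[la ah].
have -> : u a = w a by rewrite /w patchE mem_setE in_itv /= !ltW.
apply/eqP; rewrite -normr_le0; apply/ler_addgt0Pl => d d0; rewrite addr0.
have ah0 : 0 < hi - a by rewrite subr_gt0.
have [e [s1 _ eb e0]] := at_right_ex (davg_small d0 wa) (davg_small d0 wa) (nbhs_right_lt ah0).
have eh : a + e < hi by rewrite -ltrBrDl.
have h1 := bump_lebesgue_pt a e0 liw.
have := le_trans h1 s1; rewrite lee_fin.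
have -> : \int[mu]_(x in `[a, a + e]) (w x * bump a e x) = 0.
  rewrite -Rintegral_bump ?ltW// -[RHS](weak _ (bump_test e0 la eh)) Rintegral_oo_cc.
    by apply: eq_Rintegral => x xI; rewrite /w patchE xI.
  have : mu.-integrable `[lo, hi] (EFin \o (fun x => u x * bump a e x)).
    apply: (integrable_bounded_mul iu _ (fun x _ => bump_le a x e0)).
    by apply: measurable_funS (continuous_measurable_fun (smooth_expr_continuous (bump_smooth a e))).
  by move=> ib; apply: (integrableS _ _ _ ib) => //; apply: subset_itv; rewrite bnd_simp.
rewrite sub0r normrN => /le_trans; apply.
by rewrite ler_pdivrMr// ler_peMr ?ltW// ltr1n.
Unshelve. all: by end_near. Qed.

End DuBoisReymond.

Section WeakConsequences.
Context {R : realType}.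
Local Notation mu := (@lebesgue_measure R).
Implicit Types (lo hi : R) (u v : R -> R).

Lemma du_bois_reymond lo hi u v : lo < hi ->
  mu.-integrable `]lo, hi[ (EFin \o u) -> mu.-integrable `]lo, hi[ (EFin \o v) ->
  (forall phi, test_function `]lo, hi[ phi ->
     \int[mu]_(x in `]lo, hi[) (u x * derive1n 1 phi x) =
     - \int[mu]_(x in `]lo, hi[) (v x * phi x)) ->
  exists c : R, {ae mu, forall x, `]lo, hi[%classic x ->
     u x = c + \int[mu]_(t in `[lo, x]) v t}.
Proof.
move=> lohi; have [g [gs dg g0 [M M0 gM]]] := @smooth_step_deriv R.
exact: (du_bois_reymond_bump lohi gs dg g0 M0 gM).
Qed.

Lemma weak0_ae0 lo hi u : mu.-integrable `]lo, hi[ (EFin \o u) ->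
  (forall phi, test_function `]lo, hi[ phi ->
     \int[mu]_(x in `]lo, hi[) (u x * phi x) = 0) ->
  {ae mu, forall x, `]lo, hi[%classic x -> u x = 0}.
Proof.
have [g [gs dg g0 [M M0 gM]]] := @smooth_step_deriv R.
exact: (weak0_ae0_bump gs dg g0 M0 gM).
Qed.

End WeakConsequences.

Section SobolevChain.
Context {R : realType}.
Local Notation mu := (@lebesgue_measure R).
Local Notation U := (`](-1 : R), 1[%classic).
Implicit Types (u v w : R -> R).

Lemma interior_Omega : interior (@Omega R) = U.
Proof. exact: interior_itv_bnd. Qed.

(** For p = 2: on a bounded interval L^2 is contained in L^1, by t <= 1 + t^2. *)
Lemma Lp_integrable p (lo hi : R) u : p = 1 \/ p = 2 ->
  measurable_fun (`]lo, hi[%classic : set R) u ->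
  (Lp_norm `]lo, hi[ p u < +oo)%E -> mu.-integrable `]lo, hi[ (EFin \o u).
Proof.
move=> p12 mu_u Lp; apply/integrableP; split; first exact/measurable_EFinP.
have muE : measurable_fun (`]lo, hi[%classic : set R) (EFin \o u) by exact/measurable_EFinP.
have mup : measurable_fun setT ((EFin \o u) \_ `]lo, hi[).
  exact: (measurable_restrictT _ (measurable_itv _)).1 muE.
move: Lp; rewrite /Lp_norm -restrict_EFin; case: p12 => ->.
  rewrite Lnorm1; apply: le_lt_trans; rewrite [leLHS]integral_mkcond.
  rewrite le_eqVlt; apply/orP; left; apply/eqP; apply: eq_integral => x _.
  by rewrite !patchE; case: ifP => // _; rewrite abse0.
move=> L2; have : ((\int[mu]_x `|((EFin \o u) \_ `]lo, hi[) x| `^ 2) < +oo)%E.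
  by rewrite -poweR_Lnorm//; exact: poweR_lty.
move=> I2; apply: (@le_lt_trans _ _ (\int[mu]_(x in `]lo, hi[) (1 + (`|u x| ^+ 2)%:E))%E).
  apply: ge0_le_integral => //.
  - by apply/measurable_EFinP; apply: measurableT_comp.
  - apply: emeasurable_funD => //.
    by apply/measurable_EFinP; apply: measurable_funX; exact: measurableT_comp.
  - move=> x _; rewrite lee_fin; have := sqr_ge0 (`|u x| - 1); nra.
have mu2 : measurable_fun (`]lo, hi[%classic : set R) (fun x => (`|u x| ^+ 2)%:E).
  by apply/measurable_EFinP; apply: measurable_funX; exact: measurableT_comp.
rewrite ge0_integralD//.
apply: lte_add_pinfty.
  rewrite integral_cst//= mul1e lebesgue_measure_itv /= lte_fin.
  by case: ifP => // _; rewrite -EFinD ltry.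
rewrite integral_mkcond; apply: le_lt_trans I2.
apply: ge0_le_integral => //.
- by move=> x _; rewrite patchE; case: ifP => // _; rewrite lee_fin exprn_ge0.
- exact: (measurable_restrictT _ (measurable_itv _)).1 mu2.
- apply: (@measurableT_comp _ _ _ _ _ _ (fun x : \bar R => (x `^ 2)%E)); first exact: measurable_poweR.
  exact: measurableT_comp.
- move=> x _ /=; rewrite !patchE; case: ifP => _ /=.
    by rewrite powR_mulrn.
  by rewrite normr0 powR0.
Qed.

Lemma test_function_derive1n j (V : set R) (phi : R -> R) : test_function V phi ->
  test_function V (derive1n j phi).
Proof.
move=> [dphi [K [cK KU K0]]]; split.
  by move=> k x; rewrite /derive1n -iterD; exact: dphi.
exists K; split => //.
elim: j => [|j IH]; first exact: K0.
move=> x Kx; rewrite derive1nS derive1E.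
have oK : nbhs x (~` K).
  apply: open_nbhs_nbhs; split => //; apply: closed_openC.
  exact: compact_closed.
have d0 : is_derive x 1 (cst 0 : R -> R) 0 by exact: is_derive_cst.
suff [_ ->] : is_derive x 1 (derive1n j phi) 0 by [].
apply: (near_eq_is_derive _ d0).
by apply: filterS oK => y Ky; rewrite IH.
Qed.

(** [in_sobolev] gives every weak derivative relative to u itself. Testing the equation of v with
    the j-th derivative of phi makes them weak derivatives of v, as an induction on the order
    requires. *)
Lemma weak_deriv_shift V j u v w : is_weak_deriv V 1 u v ->
  is_weak_deriv V j.+1 u w -> is_weak_deriv V j v w.
Proof.
move=> [lu lv wv] [_ lw ww]; split => // phi tphi.
have := wv _ (test_function_derive1n j tphi); have := ww _ tphi.
rewrite derive1n1 -derive1nS => -> /eqP.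
by rewrite expr1 mulN1r exprS mulN1r mulNr eqr_opp => /eqP ->.
Qed.

(** The primitive of the weak derivative v does not change when v is replaced by its representative
    w, so the representative of u can be taken as a primitive of w. *)
Lemma sobolev_chain k p u : p = 1 \/ p = 2 -> mu.-integrable U (EFin \o u) ->
  in_sobolev U k p u ->
  exists2 w, chain (@L1 R) k w & {ae mu, forall x, U x -> u x = w x}.
Proof.
move=> p12; elim: k u => [|k IH] u iu Hu.
  exists u; first exact: integrable_oo_cc.
  exact: ae_eq_refl.
have [v [wv Lv]] := Hu 1%N isT.
have iv : mu.-integrable U (EFin \o v).
  by apply: (Lp_integrable p12) => //; case: wv => _ [].
have [w cw vw] : exists2 w, chain (@L1 R) k w & {ae mu, forall x, U x -> v x = w x}.
  apply: IH => // j jk; have [w [ww Lw]] := Hu j.+1 jk.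
  by exists w; split => //; exact: weak_deriv_shift ww.
have l11 : (-1 : R) < 1 by lra.
have [c uc] : exists c : R, {ae mu, forall x, U x -> u x = c + \int[mu]_(t in `[-1, x]) v t}.
  apply: (du_bois_reymond l11 iu iv).
  by case: wv => _ _ wv phi tphi; rewrite wv// expr1 mulN1r.
have iw : L1 w by exact: (chain_L1 _ cw).
exists (fun x => c + \int[mu]_(t in `[-1, x]) w t).
  exists w => // x xI.
  by rewrite set_itv1 Rintegral_set1 addr0.
apply: leb_aeS uc => x ux Ux; rewrite ux//; congr (c + _).
have x1 : -1 < x < 1 by move: Ux; rewrite /= in_itv.
have sub (z : R -> R) : mu.-integrable `[-1, 1] (EFin \o z) -> mu.-integrable `[-1, x] (EFin \o z).
  by apply: integrable_itvS => //; lra.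
have sub' (z : R -> R) : mu.-integrable `[-1, 1] (EFin \o z) -> mu.-integrable `]-1, x] (EFin \o z).
  move=> /sub iz; apply: (integrableS _ _ _ iz) => //.
  by apply: subset_itvr; rewrite bnd_simp.
rewrite -Rintegral_itv_obnd_cbnd; last exact/sub'/integrable_oo_cc.
rewrite -[RHS]Rintegral_itv_obnd_cbnd; last exact/sub'.
congr fine; apply: ae_eq_integral => //.
- exact: measurable_int (sub' _ (integrable_oo_cc iv)).
- exact: measurable_int (sub' _ iw).
apply: leb_aeS vw => y vy /=; rewrite in_itv /= => /andP[y1 yx].
by rewrite vy//= in_itv /= y1 (le_lt_trans yx)//; case/andP: x1.
Qed.

End SobolevChain.

(** * Change of variables and densities *)

Section ChangeOfVariables.
Context {R : realType}.
Local Notation mu := (@lebesgue_measure R).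
Variables (h d : R -> R).
Hypothesis mh : measurable_fun setT h.
Hypothesis md : measurable_fun setT d.
Hypothesis d0 : forall x, 0 <= d x.
Hypothesis hd : forall a b, a < b ->
  (\int[mu]_(x in h @^-1` `]a, b]) (d x)%:E = (b - a)%:E)%E.

(** Planar Lebesgue measure, restricted to this region and projected to the first coordinate, is
    d(x) dx: a measure by construction. *)
Let S : set (measurableTypeR R * measurableTypeR R) :=
  [set z | 0 <= z.2 <= d z.1].

Let mS : measurable S.
Proof.
rewrite (_ : S = [set z | 0 <= z.2] `&` [set z | z.2 <= d z.1]); last first.
  by apply/seteqP; split => z; rewrite /S /=; [move=> /andP[]|move=> [-> ->]].
have m2 : measurable_fun setT (fun z : measurableTypeR R * measurableTypeR R => z.2 : R).
  exact: measurable_snd.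
have m1 : measurable_fun setT (fun z : measurableTypeR R * measurableTypeR R => d z.1 : R).
  by apply: measurableT_comp => //; exact: measurable_fst.
have m0 : measurable_fun setT (fun z : measurableTypeR R * measurableTypeR R => 0 : R) by [].
have := measurable_fun_le measurableT m0 m2; rewrite setTI => mA.
have := measurable_fun_le measurableT m2 m1; rewrite setTI => mB.
exact: measurableI mA mB.
Qed.

Lemma integral_mrestr (G : measurableTypeR R * measurableTypeR R -> \bar R) :
  measurable_fun setT G -> (forall z, (0 <= G z)%E) ->
  (\int[mrestr (mu \x mu)%E mS]_z G z = \int[(mu \x mu)%E]_(z in S) G z)%E.
Proof.
move=> mG G0; rewrite -(setvU S) ge0_integral_setU//;
  do ?[exact: measurableC|by rewrite setvU|by rewrite disj_set2E setICl].
rewrite [X in (X + _)%E](_ : _ = 0%E) ?add0e; last first.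
  apply: null_set_integral; first exact: measurableC.
    exact: measurable_funTS mG.
  by rewrite /= /mrestr setICl measure0.
by apply: eq_measure_integral => A mA AS; rewrite /= /mrestr setIidl.
Qed.

Lemma integral_subgraph (F : R -> \bar R) : measurable_fun setT F ->
  (forall x, (0 <= F x)%E) ->
  (\int[mrestr (mu \x mu)%E mS]_z F z.1 = \int[mu]_x (F x * (d x)%:E))%E.
Proof.
move=> mF F0.
have mF1 : measurable_fun setT (fun z : measurableTypeR R * measurableTypeR R => F z.1).
  by apply: measurableT_comp => //; exact: measurable_fst.
rewrite integral_mrestr// integral_mkcond.
rewrite (fubini_tonelli1 (m1 := mu) (m2 := mu)); last 2 first.
- exact: (measurable_restrictT _ mS).1 (measurable_funTS mF1).
- by move=> z; rewrite patchE; case: ifP.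
apply: eq_integral => x _; rewrite /fubini_F.
transitivity (\int[mu]_y ((F x) * (\1_(`[0, d x]) y)%:E))%E.
  apply: eq_integral => y _.
  rewrite patchE indicE (_ : ((x, y) \in S) = (y \in [set` `[0, d x]])); last first.
    rewrite [in RHS]mem_setE [in RHS]in_itv /=; apply/idP/idP => [|H]; first by rewrite in_setE.
    exact: mem_set.
  by case: (y \in _); rewrite ?mule1 ?mule0.
rewrite ge0_integralZl//; do ?[by apply/measurable_EFinP; exact: measurable_indic|by move=> y _; rewrite lee_fin].
rewrite integral_indic//= setIT lebesgue_measure_itv /= lte_fin.
congr (_ * _)%E; rewrite lt_neqAle d0 andbT eq_sym.
by case: eqVneq => [->//|_]; rewrite -EFinD subr0.
Qed.

(* The area under the graph of [d], pushed forward along [h], agrees with the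
   Lebesgue measure on intervals. *)
Lemma change_of_variables (F : R -> \bar R) : measurable_fun setT F ->
  (forall x, (0 <= F x)%E) ->
  (\int[mu]_y F y = \int[mu]_x (F (h x) * (d x)%:E))%E.
Proof.
move=> mF F0; pose m0 := mrestr (mu \x mu)%E mS.
have mh1 : measurable_fun setT (fun z : measurableTypeR R * measurableTypeR R => (h z.1 : measurableTypeR R)).
  by apply: measurableT_comp => //; exact: measurable_fst.
pose m1 := pushforward m0 (fun z : measurableTypeR R * measurableTypeR R => (h z.1 : measurableTypeR R)).
have m1E X : measurable X -> mu X = m1 X.
  move=> mX; apply: (@lebesgue_measure_unique R m1) => // _ [[a b] _ <-] /=.
  have [ab|ba] := ltP a b; last first.
    by rewrite set_itv_ge ?bnd_simp -?leNgt// !measure0.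
  rewrite lebesgue_measure_itv /= lte_fin ab -EFinD -hd//.
  have E := integral_subgraph (F := fun x => (\1_(h @^-1` `]a, b]) x)%:E).
  transitivity (\int[mu]_x ((\1_(h @^-1` `]a, b]) x)%:E * (d x)%:E))%E.
    rewrite integral_mkcond; apply: eq_integral => x _.
    by rewrite patchE indicE; case: ifP => _; rewrite ?mul1e ?mul0e.
  have mX' : measurable (h @^-1` `]a, b]) by rewrite -[X in measurable X]setTI; exact: mh.
  rewrite -integral_subgraph; do ?[by apply/measurable_EFinP; exact: measurable_indic|by move=> x; rewrite lee_fin].
  rewrite /m1 /pushforward; set T := (X in _ = _ X).
  have mT : measurable T by rewrite -[X in measurable X]setTI; exact: mh1.
  by rewrite -[in RHS](setIT T) -integral_indic.
have -> : (\int[mu]_y F y = \int[m1]_y F y)%E.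
  by apply: eq_measure_integral => X mX _; exact: m1E.
rewrite ge0_integral_pushforward//= -integral_subgraph//.
exact: measurableT_comp.
Qed.

End ChangeOfVariables.

Section Diffeo.
Context {R : realType}.
Local Notation mu := (@lebesgue_measure R).
Implicit Types (h k : R -> R) (F : R -> \bar R).

Lemma is_derive_continuous h k : (forall x : R, is_derive x 1 h (k x)) -> continuous h.
Proof.
by move=> dh x; apply: differentiable_continuous; apply/derivable1_diffP; have [] := dh x.
Qed.

Lemma derive_lower_bound h k (c a b : R) : (forall x : R, is_derive x 1 h (k x)) ->
  (forall x, c <= k x) -> a <= b -> c * (b - a) <= h b - h a.
Proof.
move=> dh ch ab.
have [|z _ ->] := MVT_segment ab (fun x _ => dh x).
  by apply: continuous_subspaceT; exact: is_derive_continuous dh.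
by rewrite ler_wpM2r// subr_ge0.
Qed.

(** The bound k >= c > 0 makes h expand distances by the factor c at least, which gives injectivity,
    surjectivity and the Lipschitz inverse. On half-open intervals the change of variables is the
    fundamental theorem of calculus. *)
Lemma inc_diffeo h k (c : R) : 0 < c -> (forall x : R, is_derive x 1 h (k x)) ->
  continuous k -> (forall x, c <= k x) ->
  exists phi, [/\ cancel h phi, cancel phi h,
    (forall y z, `|phi y - phi z| <= c^-1 * `|y - z|) &
    (forall F, measurable_fun setT F -> (forall x, (0 <= F x)%E) ->
      (\int[mu]_y F y = \int[mu]_x (F (h x) * `|k x|%:E))%E)].
Proof.
move=> c0 dh ck hc.
have ch : continuous h := is_derive_continuous dh.
have low a b : a <= b -> c * (b - a) <= h b - h a by exact: (derive_lower_bound dh hc).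
have inc a b : a <= b -> h a <= h b.
  by move=> ab; rewrite -subr_ge0 (le_trans _ (low _ _ ab))// mulr_ge0 ?subr_ge0// ltW.
have lip a b : `|b - a| <= c^-1 * `|h b - h a|.
  wlog ab : a b / a <= b => [H|].
    by have [/H//|/ltW/H] := leP a b; rewrite distrC [X in _ * X]distrC.
  rewrite mulrC ler_pdivlMr// !ger0_norm ?subr_ge0 ?inc// mulrC.
  exact: low.
have inj : injective h.
  move=> a b hab; apply/eqP; rewrite -subr_eq0 -normr_le0 distrC.
  by rewrite (le_trans (lip _ _))// hab subrr normr0 mulr0.
have surj y : exists x, h x = y.
  (* An expanding map starting from h 0 has reached y within distance T of 0. *)
  pose T := c^-1 * `|y - h 0|.
  have T0 : 0 <= T by rewrite mulr_ge0// invr_ge0 ltW.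
  have cT : c * T = `|y - h 0| by rewrite mulVKf ?gt_eqF.
  have hT : y <= h T.
    have := low 0 T T0; rewrite subr0 cT; have := ler_norm (y - h 0); lra.
  have hmT : h (- T) <= y.
    have := low (- T) 0; rewrite oppr_le0 sub0r opprK => /(_ T0); rewrite cT.
    have := ler_norm (- (y - h 0)); rewrite normrN; lra.
  have TT : - T <= T by lra.
  have [x _ hx] := @IVT _ h (- T) T y TT (continuous_subspaceT ch)
    ltac:(by rewrite ge_min hmT le_max hT orbT).
  by exists x.
pose phi (y : R) : R := xget 0 [set x | h x = y].
have phiK : cancel phi h.
  by move=> y; rewrite /phi; case: xgetP => [x _ //|H]; have [x] := surj y; move/(H x).
have hK : cancel h phi by move=> x; apply: inj; rewrite phiK.
exists phi; split => //.
  by move=> y z; rewrite (le_trans (lip _ _))// !phiK.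
have k0 x : 0 <= k x by exact: le_trans (ltW c0) (hc x).
have E := @change_of_variables R h (fun x => `|k x|).
apply: E.
- exact: continuous_measurable_fun.
- by apply: measurableT_comp => //; exact: continuous_measurable_fun.
- by move=> x.
move=> a b ab.
have -> : h @^-1` `]a, b] = `]phi a, phi b]%classic.
  apply/seteqP; split => x /=; rewrite !in_itv /=.
    move=> /andP[ax xb]; apply/andP; split.
      rewrite ltNge; apply/negP => /inc; rewrite phiK; move: ax; lra.
    rewrite leNgt; apply/negP => xb'; have := low _ _ (ltW xb').
    rewrite phiK => q; have : 0 < c * (x - phi b) by rewrite mulr_gt0 ?subr_gt0.
    lra.
  move=> /andP[ax xb]; apply/andP; split; last by rewrite -[b]phiK inc.
  have := low _ _ (ltW ax); rewrite phiK => q.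
  have : 0 < c * (x - phi a) by rewrite mulr_gt0 ?subr_gt0.
  lra.
have pab : phi a < phi b.
  rewrite ltNge; apply/negP => /inc; rewrite !phiK; lra.
have mk : measurable_fun setT (fun x => `|k x|).
  by apply: measurableT_comp => //; exact: continuous_measurable_fun.
rewrite integral_itv_obnd_cbnd; last exact/measurable_EFinP/measurable_funTS.
under eq_integral do rewrite (ger0_norm (k0 _)).
rewrite (@continuous_FTC2 R k h _ _ pab).
- by rewrite !phiK EFinB.
- exact: continuous_subspaceT.
- have /(continuous_within_itvP _ pab) [_ c1 c2] := @continuous_subspaceT _ _ `[phi a, phi b] _ ch.
  by split => // x _; have [] := dh x.
- by move=> x _; rewrite derive1E; have [_ ->] := dh x.
Qed.

Lemma ge0_integral_opp F : measurable_fun setT F -> (forall x, (0 <= F x)%E) ->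
  (\int[mu]_y F (- y)%R = \int[mu]_y F y)%E.
Proof.
move=> mF F0.
rewrite -(@ge0_integral_pushforward _ _ _ _ _ (-%R : measurableTypeR R -> measurableTypeR R) _ mu setT)//.
by apply: eq_measure_integral => A mA _; exact: lebesgue_measureN.
Qed.

(** Reduction to [inc_diffeo]: F is split into positive and negative parts, and a decreasing h is
    replaced by - h, with y reflected to - y. *)
Lemma diffeo h k (c : R) : 0 < c -> (forall x : R, is_derive x 1 h (k x)) ->
  continuous k -> (forall x, c <= k x) \/ (forall x, k x <= - c) ->
  exists phi, [/\ cancel h phi, cancel phi h,
    (forall y z, `|phi y - phi z| <= c^-1 * `|y - z|) &
    (forall F, measurable_fun setT F ->
      (\int[mu]_y F y = \int[mu]_x (F (h x) * `|k x|%:E))%E)].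
Proof.
move=> c0 dh ck hc.
suff [phi [p1 p2 p3 cov]] : exists phi, [/\ cancel h phi, cancel phi h,
    (forall y z, `|phi y - phi z| <= c^-1 * `|y - z|) &
    (forall F, measurable_fun setT F -> (forall x, (0 <= F x)%E) ->
      (\int[mu]_y F y = \int[mu]_x (F (h x) * `|k x|%:E))%E)].
  exists phi; split => // F mF.
  rewrite integralE [RHS]integralE; congr (_ - _)%E.
    rewrite cov//; last exact: measurable_funepos.
    apply: eq_integral => x _; by rewrite !funeposE maxe_pMl// mul0e.
  rewrite cov//; last exact: measurable_funeneg.
  apply: eq_integral => x _; by rewrite !funenegE maxe_pMl// mul0e mulNe.
case: hc => hc; first exact: (inc_diffeo c0 dh).
have dN (x : R) : is_derive x 1 (fun x => - h x) (- k x) by apply: is_deriveN.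
have [phi [p1 p2 p3 cov]] := inc_diffeo c0 dN
  (fun x => continuousN (ck x)) (fun x => ltac:(by rewrite lerNr; exact: hc)).
exists (fun y => phi (- y)); split.
- exact: p1.
- by move=> y; apply: oppr_inj; rewrite p2.
- by move=> y z; rewrite (le_trans (p3 _ _))// -opprD normrN.
move=> F mF F0; rewrite -ge0_integral_opp// cov//; last first.
  by apply: measurableT_comp => //.
by apply: eq_integral => x _; rewrite opprK normrN.
Qed.

End Diffeo.

(** * Extension of functions from [-1, 1] to the line *)

Section Extension.
Context {R : realType}.
Local Notation mu := (@lebesgue_measure R).
Local Notation I11 := (`[(-1 : R), 1]).
Implicit Types (u v : R -> R).

Definition clamp (x : R) : R := Num.max (-1) (Num.min x 1).

Lemma clamp_itv x : clamp x \in I11.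
Proof. by rewrite in_itv /= /clamp le_max lexx /= ge_max ge_min lexx orbT andbT; lra. Qed.

Lemma clamp_id x : x \in I11 -> clamp x = x.
Proof.
rewrite in_itv /= => /andP[x1 x2]; rewrite /clamp.
by rewrite (min_idPl x2) (max_idPr x1).
Qed.

Lemma clamp_continuous : continuous clamp.
Proof.
move=> x; apply/cvgrPdist_lt => e e0; near=> y.
apply: le_lt_trans (_ : `|x - y| < e); last by near: y; exact: (nbhsx_ballx x e e0).
have [d1 d2] := (ler_norm (x - y), ler_norm (- (x - y))); rewrite normrN in d2.
rewrite ler_norml; apply/andP.
by rewrite /clamp !maxEle !minEle; do !case: ifPn; rewrite -?ltNge => *; split; lra.
Unshelve. all: by end_near. Qed.

Lemma clamp_comp_continuous v : C0 v -> continuous (v \o clamp).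
Proof.
move=> /subspace_continuousP cv x.
have h := cv (clamp x) (clamp_itv x).
apply: cvg_comp h => A [e e0 eA].
have H : \forall y \near x, ball (clamp x) e (clamp y).
  exact: (clamp_continuous (nbhsx_ballx (clamp x) e e0)).
by apply: filterS H => y ye; apply: eA => //; exact: clamp_itv.
Qed.

(* The integral from [-1] to [x]: one of the two domains is empty or a point. *)
Definition sprim (k : R -> R) (x : R) : R :=
  \int[mu]_(t in `[-1, x]) k t - \int[mu]_(t in `[x, -1]) k t.

Lemma continuous_itv_integrable (k : R -> R) (a b : R) : continuous k ->
  mu.-integrable `[a, b] (EFin \o k).
Proof.
move=> ck; apply: continuous_compact_integrable; first exact: segment_compact.
exact: continuous_subspaceT.
Qed.

(** Moving the base point to the left of -1 gives one formula on both sides of -1, to which the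
    fundamental theorem of calculus applies near x. *)
Lemma sprim_base k b x : continuous k -> b < -1 -> b <= x ->
  sprim k x = \int[mu]_(t in `[b, x]) k t - \int[mu]_(t in `[b, -1]) k t.
Proof.
move=> ck b1 bx; rewrite /sprim; have [x1|x1] := leP x (-1).
  rewrite (Rintegral_itv_split bx x1); last exact: continuous_itv_integrable.
  move: x1; rewrite le_eqVlt => /predU1P[->|x1].
    by rewrite set_itv1 Rintegral_set1; ring.
  rewrite (_ : `[-1, x]%classic = set0); last by rewrite set_itv_ge ?bnd_simp -?ltNge.
  by rewrite Rintegral_set0; ring.
rewrite [in X in X - _ = _]/= (@Rintegral_itv_split R k b x (-1)) ?ltW//; last exact: continuous_itv_integrable.
rewrite (_ : `[x, -1]%classic = set0); last by rewrite set_itv_ge ?bnd_simp -?ltNge.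
by rewrite Rintegral_set0; ring.
Qed.

Lemma sprim_derive (k : R -> R) (x : R) : continuous k -> is_derive x 1 (sprim k) (k x).
Proof.
move=> ck; pose b := Num.min x (-1) - 1.
have mn1 : Num.min x (-1) <= -1 by rewrite ge_min lexx orbT.
have mn2 : Num.min x (-1) <= x by rewrite ge_min lexx.
have b1 : b < -1 by rewrite /b; lra.
have bx : b < x by rewrite /b; lra.
have xx1 : x < x + 1 by lra.
have [d1 d2] := continuous_FTC1_closed xx1 (continuous_itv_integrable b (x + 1) ck) bx (ck x).
have d0 : is_derive x 1 (fun x => \int[mu]_(t in `[b, x]) k t) (k x).
  by apply: DeriveDef; [exact: d1|rewrite -derive1E].
have d3 : is_derive x 1 (fun x => \int[mu]_(t in `[b, x]) k t - \int[mu]_(t in `[b, -1]) k t) (k x).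
  rewrite -[k x]subr0; apply: is_deriveB; exact: d0.
apply: (near_eq_is_derive _ d3).
near=> y; rewrite (@sprim_base k b)//; apply/ltW; near: y; exact: lt_nbhsr.
Unshelve. all: by end_near. Qed.

Lemma sprim_itv k x : x \in I11 -> sprim k x = \int[mu]_(t in `[-1, x]) k t.
Proof.
rewrite in_itv /= => /andP[x1 _]; rewrite /sprim; move: x1.
rewrite le_eqVlt => /predU1P[<-|x1]; first by rewrite set_itv1 Rintegral_set1 subr0.
rewrite (_ : `[x, -1]%classic = set0); last by rewrite set_itv_ge ?bnd_simp -?ltNge.
by rewrite Rintegral_set0 subr0.
Qed.

(* The linear extension of a function that is continuously differentiable on
   [-1, 1] to a continuously differentiable function on the line. *)
Lemma C1_extension u v (c : R) : 0 < c -> C0 v ->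
  (forall x, x \in I11 -> u x = u (-1) + \int[mu]_(t in `[-1, x]) v t) ->
  (forall x, x \in I11 -> c <= `|v x|) ->
  exists h k, [/\ continuous k, (forall x : R, is_derive x 1 h (k x)),
    (forall x, x \in I11 -> h x = u x /\ k x = v x) &
    (forall x, c <= k x) \/ (forall x, k x <= - c)].
Proof.
move=> c0 cv uE vc; pose k := v \o clamp.
have ck : continuous k by exact: clamp_comp_continuous.
exists (fun x => u (-1) + sprim k x), k; split => //.
- move=> x; rewrite -[k x]add0r; apply: is_deriveD; exact: sprim_derive.
- move=> x xI; rewrite {2}/k /= clamp_id// sprim_itv// (uE x xI); split => //.
  congr (_ + _); apply: eq_Rintegral => t; rewrite inE /= in_itv /= => /andP[t1 tx].
  rewrite /k /= clamp_id// in_itv /= t1 (le_trans tx)//.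
  by move: xI; rewrite in_itv => /andP[].
have kc x : c <= `|k x| by apply: vc; exact: clamp_itv.
(* A sign change of k would produce a zero, against |k| >= c. *)
have kpos a b : 0 < k a -> k b < 0 -> False.
  move=> ka kb.
  have mab : Num.min a b <= Num.max a b by rewrite ge_min le_max !lexx.
  have kab : Num.min (k (Num.min a b)) (k (Num.max a b)) <= 0 <=
             Num.max (k (Num.min a b)) (k (Num.max a b)).
    rewrite ge_min le_max; have [ab|ab] := leP a b.
      by rewrite (ltW ka) (ltW kb) orbT.
    by rewrite (ltW ka) (ltW kb) orbT.
  have [y] := IVT mab (continuous_subspaceT ck) kab.
  by move=> _ ky; have := kc y; rewrite ky normr0 leNgt c0.
have [k0|k0] := leP 0 (k 0); [left|right] => x; have := kc x.
  have k00 : 0 < k 0 by rewrite lt_neqAle k0 andbT eq_sym -normr_gt0 (lt_le_trans c0).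
  by rewrite ler_normr => /orP[//|kx]; exfalso; apply: (kpos 0 x) => //; lra.
by rewrite ler_normr => /orP[kx|]; [exfalso; apply: (kpos x 0) => //; lra|rewrite lerNr].
Qed.

End Extension.

(** * Densities of image measures *)

Section PushDensity.
Context {R : realType}.
Local Notation mu := (@lebesgue_measure R).
Local Notation I11 := (`[(-1 : R), 1]).
Variables (h k phi r : R -> R).
Hypothesis ch : continuous h.
Hypothesis ck : continuous k.
Hypothesis k0 : forall x, k x != 0.
Hypothesis hK : cancel h phi.
Hypothesis phiK : cancel phi h.
Hypothesis cphi : continuous phi.
Hypothesis cov : forall F : R -> \bar R, measurable_fun setT F ->
  (\int[mu]_y F y = \int[mu]_x (F (h x) * `|k x|%:E))%E.
Hypothesis ir : L1 r.

Let mr : measurable_fun setT (r \_ [set` I11]).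
Proof.
by apply/measurable_EFinP; exact: measurable_int (integrable_patchT (measurable_itv I11) ir).
Qed.

(** The transformation formula for densities, with r cut off outside [-1, 1] because phi is defined
    on the whole line. *)
Definition push_density (y : R) : R := (r \_ [set` I11]) (phi y) / `|k (phi y)|.

Lemma measurable_push_density : measurable_fun setT push_density.
Proof.
have mphi : measurable_fun setT (phi : measurableTypeR R -> measurableTypeR R).
  exact: continuous_measurable_fun.
apply: measurable_funM; first exact: measurableT_comp mr mphi.
apply: (@measurableT_comp _ _ _ _ _ _ (fun x => `|k x|^-1) _ phi) => //.
apply: continuous_measurable_fun => x; apply: cvgV; first by rewrite normr_eq0.
by apply: cvg_norm; exact: ck.
Qed.

Lemma push_density_comp x : push_density (h x) * `|k x| = (r \_ [set` I11]) x.
Proof. by rewrite /push_density hK divfK// normr_eq0. Qed.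

Lemma push_density_integrable : mu.-integrable setT (EFin \o push_density).
Proof.
apply/integrableP; split; first by apply/measurable_EFinP; exact: measurable_push_density.
rewrite cov; last first.
  by do 2 apply: measurableT_comp => //; exact: measurable_push_density.
have [_] := integrableP _ _ _ (integrable_patchT (measurable_itv I11) ir).
apply: le_lt_trans; rewrite le_eqVlt; apply/orP; left; apply/eqP.
apply: eq_integral => x _ /=.
by rewrite -EFinM -[X in _ * X]normr_id -normrM push_density_comp.
Qed.

Lemma push_density_has_density (rho : set R -> \bar R) :
  has_density rho Omega r -> has_density (pushforward_on Omega rho h) setT push_density.
Proof.
move=> [mr' rhoE]; split; first exact: measurable_push_density.
move=> B mB; rewrite /pushforward_on.
have mhB : measurable (h @^-1` B).
  rewrite -[X in measurable X]setTI.
  by apply: (continuous_measurable_fun ch).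
rewrite rhoE//; last by apply: measurableI => //; exact: measurable_itv.
rewrite setIA setIid setTI [RHS]integral_mkcond cov; last first.
  apply: (measurable_restrictT _ mB).1; apply: measurable_funTS.
  by apply/measurable_EFinP; exact: measurable_push_density.
rewrite integral_mkcond; apply: eq_integral => x _.
rewrite !patchE in_setI.
have -> : (x \in h @^-1` B) = (h x \in B) by [].
case: (h x \in B); rewrite ?andbT ?andbF ?mul0e// -EFinM push_density_comp patchE.
by case: ifP.
Qed.

End PushDensity.

Section DensityFacts.
Context {R : realType}.
Local Notation mu := (@lebesgue_measure R).

Lemma density_unique (nu : set R -> \bar R) (p q : R -> R) :
  mu.-integrable setT (EFin \o p) -> has_density nu setT p -> has_density nu setT q ->
  {ae mu, forall x, p x = q x}.
Proof.
move=> ip [_ pE] [mq qE].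
have : ae_eq mu setT (EFin \o p) (EFin \o q).
  apply: integral_ae_eq => //; first exact/measurable_EFinP.
  by move=> E _ mE; have := pE _ mE; have := qE _ mE; rewrite setTI => -> ->.
by apply: leb_aeS => x /(_ I) [].
Qed.

Lemma integrable_ae (D : set R) (u v : R -> R) : measurable D ->
  measurable_fun D v -> mu.-integrable D (EFin \o u) ->
  {ae mu, forall x, D x -> u x = v x} -> mu.-integrable D (EFin \o v).
Proof.
move=> mD mv iu uv; apply/integrableP; split; first exact/measurable_EFinP.
have [mu_u] := integrableP _ _ _ iu; apply: le_lt_trans.
rewrite le_eqVlt; apply/orP; left; apply/eqP; apply: ae_eq_integral => //.
- by apply: measurableT_comp => //; exact/measurable_EFinP.
- exact: measurableT_comp.
by apply: leb_aeS uv => x uvx Dx /=; rewrite uvx.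
Qed.

Lemma pdf_has_density (nu : set R -> \bar R) (p : R -> R) :
  has_density nu setT p -> has_density nu setT (pdf nu).
Proof. by move=> hp; rewrite /pdf; case: xgetP => [q _ //|/(_ p)]. Qed.

(** The integral of r over the set where r >= 0 is a probability, hence finite. Over the rest it is
    nonnegative as a probability and nonpositive as an integral, so |r| has integral 0 there. *)
Lemma density_integrable (rho : probability (measurableTypeR R) R) (r : R -> R) :
  has_density rho Omega r -> L1 r.
Proof.
move=> [mr rE]; apply/integrableP; split; first exact/measurable_EFinP.
have mO : measurable (Omega : set R) by exact: measurable_itv.
pose P := Omega `&` [set x | 0 <= r x].
pose N := Omega `&` [set x | r x <= 0].
have mP : measurable P by exact: measurable_fun_le.
have mN : measurable N by exact: measurable_fun_le.
have PN : Omega = P `|` (N `\` P).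
  apply/seteqP; split => x; last by move=> [[]|[[]]].
  move=> Ox; have [r0|r0] := leP 0 (r x); first by left.
  by right; split; [split => //; exact: ltW|move=> [_]/=; rewrite leNgt r0].
have mNP : measurable (N `\` P) by exact: measurableD.
have ma : measurable_fun (Omega : set R) (fun x => `|r x|%:E).
  by apply/measurable_EFinP; exact: measurableT_comp.
have fin (B : set R) : measurable B -> (rho B < +oo)%E.
  by move=> mB; rewrite (le_lt_trans (probability_le1 rho mB)) ?ltry.
rewrite [X in (\int[_]_(x in X) _)%E]PN ge0_integral_setU//; last 2 first.
- by rewrite -PN.
- by apply/disj_setPS => x [? []].
apply: lte_add_pinfty.
  have := fin _ mP; rewrite rE// (_ : Omega `&` P = P); last by rewrite /P setIA setIid.
  apply: le_lt_trans; rewrite le_eqVlt; apply/orP; left; apply/eqP.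
  by apply: eq_integral => x; rewrite inE => -[_ /= r0]; rewrite ger0_norm.
have := rE _ mNP; rewrite (_ : Omega `&` (N `\` P) = N `\` P); last first.
  by apply/seteqP; split => x; [case|move=> NPx; split => //; case: NPx => [[]]].
move=> E; have : (0 <= rho (N `\` P))%E by exact: measure_ge0.
rewrite E.
rewrite (_ : (\int[mu]_(x in N `\` P) (r x)%:E)%E = (- \int[mu]_(x in N `\` P) `|r x|%:E)%E).
  by rewrite oppe_ge0 => /le_lt_trans; apply; exact: ltry.
rewrite -integral_ge0N//; apply: eq_integral => x; rewrite inE => -[[_ /= r0] _].
by rewrite /= ler0_norm// ?opprK ?EFinN ?oppeK.
Qed.

End DensityFacts.

(** * Weak derivatives of the density on the image *)

Section PushSobolev.
Context {R : realType}.
Local Notation mu := (@lebesgue_measure R).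
Local Notation I11 := (`[(-1 : R), 1]).
Local Notation U11 := (`](-1 : R), 1[%classic : set R).
Variables (h k phi : R -> R).
Hypothesis ch : continuous h.
Hypothesis ck : continuous k.
Hypothesis dh : forall x : R, is_derive x 1 h (k x).
Hypothesis k0 : forall x, k x != 0.
Hypothesis hK : cancel h phi.
Hypothesis cphi : continuous phi.
Hypothesis cov : forall F : R -> \bar R, measurable_fun setT F ->
  (\int[mu]_y F y = \int[mu]_x (F (h x) * `|k x|%:E))%E.
Variable s : R.
Hypothesis ks : forall x, `|k x| = s * k x.
Variables a b : R.
Hypothesis hab : forall x, (h x \in `]a, b[) = (x \in `](-1 : R), 1[).

Definition transport (U : R -> R) (y : R) : R := (U \_ [set` I11]) (phi y).

Let mU U : L1 U -> measurable_fun setT (U \_ [set` I11]).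
Proof.
by move=> iU; apply/measurable_EFinP; exact: measurable_int (integrable_patchT (measurable_itv I11) iU).
Qed.

Lemma measurable_transport U : L1 U -> measurable_fun setT (transport U).
Proof.
move=> iU; apply: (@measurableT_comp _ _ _ _ _ _ (U \_ [set` I11]) _ (phi : measurableTypeR R -> measurableTypeR R)).
  exact: mU.
exact: continuous_measurable_fun.
Qed.

Lemma transport_comp U x : x \in `](-1 : R), 1[ -> transport U (h x) = U x.
Proof.
rewrite /transport hK patchE mem_setE => xI; rewrite ifT//.
by move: xI; rewrite !in_itv /= => /andP[/ltW -> /ltW ->].
Qed.

Lemma transport_integral U (w : R -> R) : L1 U -> continuous w ->
  (\int[mu]_(y in `]a, b[) (transport U y * w y)%:E =
   \int[mu]_(x in U11) (U x * (w (h x) * `|k x|))%:E)%E.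
Proof.
move=> iU cw.
have mw : measurable_fun setT w by exact: continuous_measurable_fun.
have mF : measurable_fun setT (fun y => (transport U y * w y)%:E).
  by apply/measurable_EFinP; apply: measurable_funM => //; exact: measurable_transport.
rewrite integral_mkcond cov; last first.
  by apply: (measurable_restrictT _ (measurable_itv _)).1; exact: measurable_funTS mF.
rewrite [RHS]integral_mkcond; apply: eq_integral => x _.
rewrite !patchE !mem_setE hab; case: ifP => xI; last by rewrite mul0e.
by rewrite transport_comp// -EFinM -!mulrA.
Qed.

Lemma transport_integrable U : L1 U -> mu.-integrable `]a, b[ (EFin \o transport U).
Proof.
move=> iU; apply/integrableP; split.
  by apply/measurable_EFinP; apply: measurable_funTS; exact: measurable_transport.
have iUk : mu.-integrable U11 (EFin \o (fun x => U x * k x)).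
  have : L1 (fun x => U x * k x).
    by apply: L1M => //; exact: continuous_subspaceT.
  by move=> i1; apply: (integrableS _ _ _ i1) => //; apply: subset_itv; rewrite bnd_simp.
have [_] := integrableP _ _ _ iUk; apply: le_lt_trans.
rewrite integral_mkcond cov; last first.
  apply: (measurable_restrictT _ (measurable_itv _)).1; apply: measurable_funTS.
  by do 2 apply: measurableT_comp => //; exact: measurable_transport.
rewrite le_eqVlt; apply/orP; left; apply/eqP.
rewrite [RHS]integral_mkcond; apply: eq_integral => x _.
rewrite !patchE !mem_setE hab; case: ifP => xI; last by rewrite mul0e.
by rewrite /= transport_comp// -EFinM normrM.
Qed.

(** The chain rule (U o phi)' = (U' / k) o phi in weak form. Under y = h(x) it becomes an
    integration by parts on [-1, 1] of U against psi o h; the constant sign s turns |k| into the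
    derivative k of h. *)
Lemma transport_ibp j U : chain (@L1 R) j.+1 U -> chain (@C0 R) j k ->
  exists2 V, chain (@L1 R) j V &
    forall psi, test_function `]a, b[ psi ->
      \int[mu]_(y in `]a, b[) (transport U y * derive1n 1 psi y) =
      - \int[mu]_(y in `]a, b[) (transport V y * psi y).
Proof.
move=> cU cck; have [U' cU' UE] := cU.
have cki : chain (@C0 R) j (fun x => (k x)^-1) by apply: chainC_inv.
have iU' : L1 U' by exact: (chain_L1 _ cU').
have iU : L1 U by exact: (chain_L1 _ cU).
have cV : chain (@L1 R) j (fun x => U' x * (k x)^-1) by exact: chainLC_mul.
exists (fun x => U' x * (k x)^-1) => // psi tpsi.
have iV : L1 (fun x => U' x * (k x)^-1) by exact: (chain_L1 _ cV).
have dpsi (y : R) : is_derive y 1 psi (derive1n 1 psi y).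
  by apply: DeriveDef; [exact: (tpsi.1 0%N)|rewrite derive1n1 derive1E].
have ddpsi (y : R) : is_derive y 1 (derive1n 1 psi) (derive1n 2 psi y).
  by apply: DeriveDef; [exact: (tpsi.1 1%N)|rewrite [in RHS]derive1nS derive1E].
have cpsi : continuous psi := is_derive_continuous dpsi.
have cdpsi : continuous (derive1n 1 psi) := is_derive_continuous ddpsi.
rewrite /Rintegral !transport_integral//.
pose X x := psi (h x); pose Xd x := derive1n 1 psi (h x) * k x.
have dX (x : R) : is_derive x 1 X (Xd x) by exact: is_derive1_comp.
have cX : continuous X := is_derive_continuous dX.
have cXd : continuous Xd.
  move=> x; apply: cvgM; last exact: ck.
  apply: (@continuous_comp _ _ _ h (derive1n 1 psi)); [exact: ch|exact: cdpsi].
have psi0 y : y \notin `]a, b[ -> psi y = 0.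
  have [_ [K [_ KU K0]]] := tpsi; move=> yI; apply: K0 => /KU /=.
  exact/negP.
(* By [hab] the values of h at 1 and -1 lie outside ]a, b[, where [psi] vanishes: there are no
   boundary terms. *)
have X1 : X 1 = 0 by rewrite /X psi0// hab in_itv /= ltxx andbF.
have Xm1 : X (-1) = 0 by rewrite /X psi0// hab in_itv /= ltxx.
have XE x : x \in I11 -> X x = X (-1) + \int[mu]_(t in `[-1, x]) Xd t.
  by apply: FTC2_C0 => //; exact: continuous_subspaceT.
have l11 : (-1 : R) <= 1 by lra.
have iXd : L1 Xd by apply: C0_L1; exact: continuous_subspaceT.
have := Rintegral_mul_primitive l11 iU' iXd UE XE.
rewrite X1 Xm1 !mulr0 add0r => /esym.
have i1 : L1 (fun t => U' t * X t) by apply: L1M => //; exact: continuous_subspaceT.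
have i2 : L1 (fun t => U t * Xd t) by apply: L1M => //; exact: continuous_subspaceT.
rewrite RintegralD// addrC => /eqP; rewrite addr_eq0 => /eqP ibp.
have toI (w : R -> R) : L1 w -> \int[mu]_(x in U11) w x = \int[mu]_(x in [set` I11]) w x.
  move=> iw; apply: Rintegral_oo_cc.
  by apply: (integrableS _ _ _ iw) => //; apply: subset_itv; rewrite bnd_simp.
have := congr1 ( *%R s) ibp; rewrite mulrN -!RintegralZl//.
rewrite -!toI; [|exact: (integrableZl _ s i1)|exact: (integrableZl _ s i2)].
rewrite /Rintegral => E; etransitivity; last etransitivity; [|exact: E|].
  congr fine; apply: eq_integral => x _; congr EFin; rewrite ks /Xd; ring.
congr (- fine _); apply: eq_integral => x _; congr EFin; rewrite ks /X.
by field; exact: k0.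
Qed.

Lemma transport_weak_deriv j U : chain (@L1 R) j U -> chain (@C0 R) j k ->
  exists2 V, L1 V & forall psi, test_function `]a, b[ psi ->
      \int[mu]_(y in `]a, b[) (transport U y * derive1n j psi y) =
      (-1) ^+ j * \int[mu]_(y in `]a, b[) (transport V y * psi y).
Proof.
elim: j U => [|j IH] U.
  by move=> iU _; exists U => // psi _; rewrite expr0 mul1r.
move=> cU cck; have cck' := chain_down (fun _ h => h) (@C0_L1 R) cck.
have [V cV VE] := transport_ibp cU cck'.
have [W iW WE] := IH V cV cck'; exists W => // psi tpsi.
have -> : derive1n j.+1 psi = derive1n 1 (derive1n j psi) by [].
rewrite VE; last exact: test_function_derive1n.
by rewrite WE// exprS mulN1r mulNr.
Qed.

Lemma transport_sobolev m U (p : R -> R) : chain (@L1 R) m U -> chain (@C0 R) m k ->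
  measurable_fun setT p ->
  {ae mu, forall y, `]a, b[%classic y -> p y = transport U y} ->
  in_sobolev `]a, b[ m 1 p.
Proof.
move=> cU cck mp pU j jm.
have [V iV VE] := transport_weak_deriv
  (chain_le (@C0_L1 R) (fun _ h => h) jm cU) (chain_le (fun _ h => h) (@C0_L1 R) jm cck).
have iU : L1 U by exact: (chain_L1 _ cU).
have itU := transport_integrable iU; have itV := transport_integrable iV.
exists (transport V); split; last first.
  rewrite /Lp_norm Lnorm1 -restrict_EFin.
  have [_] := integrableP _ _ _ itV; apply: le_lt_trans.
  rewrite [leRHS]integral_mkcond le_eqVlt; apply/orP; left; apply/eqP.
  by apply: eq_integral => x _; rewrite !patchE; case: ifP => // _; rewrite abse0.
split.
- apply: open_integrable_locally; first exact: interval_open.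
  apply: (integrable_ae _ _ itU) => //; first exact: measurable_funTS.
  by apply: leb_aeS pU => y py yI; rewrite py.
- apply: open_integrable_locally => //; exact: interval_open.
- move=> psi tpsi; rewrite -VE//; congr fine; apply: ae_eq_integral => //.
  + apply/measurable_EFinP; apply: measurable_funM; first exact: measurable_funTS.
    apply: measurable_funTS; apply: continuous_measurable_fun.
    apply: (is_derive_continuous (k := derive1n j.+1 psi)) => x.
    by apply: DeriveDef; [exact: (tpsi.1 j)|rewrite [in RHS]derive1nS derive1E].
  + apply/measurable_EFinP; apply: measurable_funM.
      by apply: measurable_funTS; exact: measurable_transport.
    apply: measurable_funTS; apply: continuous_measurable_fun.
    apply: (is_derive_continuous (k := derive1n j.+1 psi)) => x.
    by apply: DeriveDef; [exact: (tpsi.1 j)|rewrite [in RHS]derive1nS derive1E].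
  + by apply: leb_aeS pU => y py yI /=; rewrite py.
Qed.

End PushSobolev.

(** * Gauss-Lobatto interpolation *)

Section PolyRolle.
Context {R : realType}.
Implicit Types (p q : {poly R}) (x y : R) (s t : seq R).

Lemma horner_is_derive p x : is_derive x 1 (horner p) (p^`().[x]).
Proof. by apply: DeriveDef; [exact: derivable_horner|rewrite derivE derive1E]. Qed.

Lemma horner_continuous p : continuous (horner p).
Proof.
by move=> x; apply: differentiable_continuous; apply/derivable1_diffP; exact: derivable_horner.
Qed.

Lemma poly_rolle p x y : x < y -> p.[x] = 0 -> p.[y] = 0 ->
  exists c, [/\ x < c, c < y & p^`().[c] = 0].
Proof.
move=> xy px py.
have [c cI dc] : exists2 c, c \in `]x, y[ & is_derive c 1 (horner p) 0.
  apply: Rolle => //; last by rewrite px py.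
  exact: (continuous_subspaceT (@horner_continuous p)).
move: cI; rewrite in_itv /= => /andP[xc cy]; exists c; split => //.
by have [_ <-] := horner_is_derive p c; have [_ ->] := dc.
Qed.

(** Rolle between consecutive roots. The last clause keeps the new roots strictly below the last old
    one, so that they can again be framed by -1 and 1. *)
Lemma rolle_path p x s : path <%R x s -> all (root p) (x :: s) ->
  exists t, [/\ size t = size s, path <%R x t, all (root p^`()) t &
    (s != [::] -> last x t < last x s)].
Proof.
elim: s x => [|y s IH] x; first by exists [::].
rewrite /= => /andP[xy ps] /and3P[rx ry rs].
have [t [st pt rt lt]] := IH y ps ltac:(by rewrite /= ry).
have [c [xc cy dc]] := poly_rolle xy (rootP rx) (rootP ry).
exists (c :: t); split; rewrite /= ?st//.
- rewrite xc /=; case: t pt {st rt lt} => //= z t /andP[yz ->].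
  by rewrite (lt_trans cy yz).
- by rewrite rt andbT; apply/rootP.
move=> _; case: s ps rs st lt {IH} => [|z s] ps rs st lt.
  by move: st => /size0nil ->.
have := lt isT; case: t st pt {rt lt} => [//|w t] /= _ _; exact.
Qed.

(** A strictly increasing path from -1 to 1 encodes at once that the roots are distinct, sorted and
    inside the open interval. *)
Definition inner_roots p k := exists s, [/\ size s = k,
  path <%R (-1) (rcons s 1) & all (root p) s].

Lemma rcons_path_last x t z : path <%R x t -> last x t < z -> path <%R x (rcons t z).
Proof. by move=> pt ltz; rewrite rcons_path pt. Qed.

(** With the endpoints as two further roots Rolle gains an inner root; [inner_roots_deriv], without
    them, loses one. *)
Lemma inner_roots_deriv0 p k : p.[-1] = 0 -> p.[1] = 0 -> inner_roots p k ->
  inner_roots p^`() k.+1.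
Proof.
move=> pm p1 [s [ss ps rs]].
have rps : all (root p) (-1 :: rcons s 1).
  by rewrite /= all_rcons rs !andbT; apply/andP; split; apply/rootP.
have [t [st pt rt lt]] := rolle_path ps rps.
exists t; split => //; first by rewrite st size_rcons ss.
apply: rcons_path_last => //; have := lt ltac:(by rewrite -size_eq0 size_rcons).
by rewrite last_rcons.
Qed.

Lemma inner_roots_deriv p k : inner_roots p k.+1 -> inner_roots p^`() k.
Proof.
case=> -[|x s] [ss ps0 rs] //.
case: ss ps0 => ss /= /andP[x1 ps].
move: (ps); rewrite rcons_path => /andP[ps' l1].
have [t [st pt rt lt]] := rolle_path ps' rs.
exists t; split; [by rewrite st| |by []].
apply: rcons_path_last.
  case: t pt {st rt lt} => //= z t /andP[xz ->].
  by rewrite (lt_trans x1 xz).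
case: s st lt l1 {ss ps rs ps'} => [|y s] st lt l1.
  by move: st => /size0nil ->; rewrite /=; lra.
have := lt isT; case: t st {pt rt lt} => [//|w t] /= _ H; exact: lt_trans H l1.
Qed.

End PolyRolle.

Lemma qpow_ring (A : comNzRingType) (X Q Qk : A) k :
  Q * (X *+ 2 * Qk *+ k.+1) = X * (Q * Qk) *+ (2 * k.+1).
Proof. by ring. Qed.

(** Here a, b, c stand for the derivatives of orders n, n + 1, n + 2 of u = (X^2 - 1)^n. The right
    side is the difference of the Leibniz expansions of the (n + 1)-st derivatives of (X^2 - 1) u'
    and of 2 n X u. *)
Lemma legendre_ring (A : comNzRingType) (X a b c : A) n :
  X *+ 2 * b + (X * (X * c) - c) - a *+ (n * n.+1) =
  X * (X * c + b *+ n.+1) + (X * b + a *+ n) *+ n.+1 - c -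
  (X * b + a *+ n.+1) *+ (2 * n).
Proof. by ring. Qed.

Section Legendre.
Context {R : realType}.
Local Notation q := ('X ^+ 2 - 1 : {poly R}).

Lemma derivn_exp_dvd (p : {poly R}) n j : (j <= n)%N ->
  exists w : {poly R}, (p ^+ n)^`(j) = p ^+ (n - j) * w.
Proof.
elim: j => [|j IH] jn; first by exists 1; rewrite subn0 mulr1.
have [w E] := IH (ltnW jn); rewrite derivnS E.
have -> : (n - j = (n - j.+1).+1)%N by rewrite subnSK.
move: (n - j.+1)%N => k.
exists (p^`() *+ k.+1 * w + p * w^`()).
rewrite derivM deriv_exp exprS /= mulrDr; congr (_ + _); last by rewrite [p * _]mulrC mulrA.
by rewrite -mulrnAl [_ * p ^+ k]mulrC mulrA.
Qed.

Lemma derivnMX (p : {poly R}) n : ('X * p)^`(n) = 'X * p^`(n) + p^`(n.-1) *+ n.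
Proof.
case: n => [|n]; first by rewrite mulr0n addr0.
by have := derivnMXaddC n p 0; rewrite addr0 mulrC addrC [_ * 'X]mulrC.
Qed.

Lemma deriv_q : q^`() = 'X *+ 2.
Proof. by rewrite derivB derivXn derivC subr0 expr1. Qed.

Lemma q_deriv_qpow n : q * (q ^+ n)^`() = ('X * q ^+ n) *+ (2 * n).
Proof.
case: n => [|k]; first by rewrite expr0 derivC mulr0 muln0 mulr0n.
rewrite deriv_exp deriv_q [in RHS]exprS /=.
exact: qpow_ring.
Qed.

(** Legendre's differential equation, from the first-order equation (X^2 - 1) u' = 2 n X u
    differentiated n + 1 times. *)
Lemma legendre_ode n : let u := q ^+ n in
  (q * u^`(n.+1))^`() = u^`(n) *+ (n * n.+1).
Proof.
move=> u; have E := q_deriv_qpow n; rewrite -/u in E.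
have qE (v : {poly R}) : q * v = 'X * ('X * v) - v by rewrite mulrBl mul1r mulrA expr2.
have := congr1 (derivn n.+1) E; rewrite qE derivnB derivnMX derivnMn !derivnMX /=.
rewrite -!derivSn; have -> : (u^`(n.-1.+1) *+ n) = u^`(n) *+ n by case: (n).
move=> H; rewrite derivM deriv_q qE.
move: H; rewrite /=; move: (u^`(n)) => a; move: (a^`()^`()) => c; move: (a^`()) 'X => b X.
move=> /eqP; rewrite -subr_eq0 => /eqP H.
apply/eqP; rewrite -subr_eq0; apply/eqP; rewrite -[RHS]H.
exact: legendre_ring.
Qed.

Lemma qpow_roots n j : (j < n)%N -> ((q ^+ n)^`(j)).[-1] = 0 /\ ((q ^+ n)^`(j)).[1] = 0.
Proof.
move=> jn; have [w ->] := derivn_exp_dvd q (ltnW jn).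
by rewrite -(subnSK jn) exprS !hornerE; split; ring.
Qed.

(** Up to order n - 1 the derivatives of (X^2 - 1)^n still vanish at -1 and 1, so each of the first
    n differentiations gains an inner root. *)
Lemma qpow_inner_roots n j : (j <= n)%N -> inner_roots (q ^+ n)^`(j) j.
Proof.
elim: j => [|j IH] jn.
  by exists [::]; split => //=; rewrite andbT; lra.
have [p1 p2] := qpow_roots jn.
exact: (inner_roots_deriv0 p1 p2 (IH (ltnW jn))).
Qed.

Lemma size_qpow n : size (q ^+ n) = (2 * n).+1.
Proof.
have q0 : size q = 3 by rewrite size_XnsubC.
have qn0 : q ^+ n != 0 by rewrite expf_neq0// -size_poly_eq0 q0.
by rewrite -[LHS]prednK ?size_poly_gt0// size_exp q0.
Qed.

(** The Legendre polynomial up to its normalising factor, which does not affect roots. *)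
Definition rodrigues n : {poly R} := (q ^+ n)^`(n).

Lemma rodrigues_deriv_neq0 n : (0 < n)%N -> (rodrigues n)^`() != 0.
Proof.
move=> n0; rewrite /rodrigues -derivnS; apply/eqP => /(congr1 (fun p : {poly R} => p`_(n.-1))).
rewrite coef_derivn coef0 => /eqP; rewrite mulrn_eq0 => /orP[].
  by rewrite -leqn0 leqNgt ffact_gt0 => /negP[]; lia.
rewrite (_ : (n.+1 + n.-1)%N = (size (q ^+ n)).-1); last first.
  by rewrite size_qpow /= addSnnS prednK// mul2n addnn.
by rewrite -/(lead_coef _) lead_coef_eq0 -size_poly_eq0 size_qpow.
Qed.

Lemma size_rodrigues_deriv n : (size (rodrigues n)^`() <= n)%N.
Proof.
apply/leq_sizeP => j nj; rewrite /rodrigues -derivnS coef_derivn nth_default ?mul0rn//.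
by rewrite size_qpow; lia.
Qed.

(** Rolle gives n roots of the Legendre polynomial in the open interval and n - 1 of its derivative;
    the degree excludes any other. *)
Lemma gauss_lobatto_nodes n : (0 < n)%N -> exists s : seq R,
  [/\ size s = n.-1, path <%R (-1) (rcons s 1), all (root (rodrigues n)^`()) s &
      forall x, gauss_lobatto n x <-> x \in -1 :: rcons s 1].
Proof.
move=> n0; have [s [ss ps rs]] : inner_roots (rodrigues n)^`() n.-1.
  by apply: inner_roots_deriv; rewrite prednK//; exact: qpow_inner_roots.
exists s; split => // x.
have us : uniq s.
  have := lt_sorted_uniq (path_sorted ps); rewrite rcons_uniq => /andP[_ //].
have inE' : (x \in -1 :: rcons s 1) = [|| x == -1, x == 1 | x \in s].
  by rewrite inE mem_rcons inE.
have lr : root (deriv (legendre n)) x = root (rodrigues n)^`() x.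
  by rewrite /legendre derivZ rootZ.
rewrite /gauss_lobatto /= inE' lr; split.
  move=> [->|->|rx]; rewrite ?eqxx ?orbT//.
  have [xs|xs] := boolP (x \in s); first by rewrite !orbT.
  have := max_poly_roots (rodrigues_deriv_neq0 n0) (rs := x :: s).
  rewrite /= rx rs xs us => /(_ isT isT); rewrite ss prednK// => h.
  by have := leq_trans h (size_rodrigues_deriv n); rewrite ltnn.
move=> /or3P[/eqP ->|/eqP ->|xs]; [by constructor 1|by constructor 2|constructor 3].
exact: (allP rs).
Qed.

End Legendre.

(** * Lagrange polynomials and the bound for interpolation *)

Section Lagrange.
Context {R : realType}.
Implicit Types (l : seq R) (a b : R) (p : {poly R}).

Definition nodal l : {poly R} := \prod_(a <- l) ('X - a%:P).

Definition lagrange l a : {poly R} :=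
  ((nodal (rem a l)).[a])^-1 *: nodal (rem a l).

Lemma nodal_rem l a : a \in l -> nodal l = ('X - a%:P) * nodal (rem a l).
Proof.
by move=> al; rewrite /nodal (perm_big _ (perm_to_rem al)) big_cons.
Qed.

Lemma nodal_rem_neq0 l a : uniq l -> (nodal (rem a l)).[a] != 0.
Proof. by move=> ul; rewrite -[_ == 0]/(root _ _) root_prod_XsubC mem_rem_uniqF. Qed.

Lemma lagrange_self l a : uniq l -> (lagrange l a).[a] = 1.
Proof. by move=> ul; rewrite hornerZ mulVf// nodal_rem_neq0. Qed.

Lemma lagrange_other l a b : uniq l -> a \in l -> b \in l -> a != b ->
  (lagrange l a).[b] = 0.
Proof.
move=> ul al bl ab; apply/rootP; rewrite rootZ ?invr_eq0 ?nodal_rem_neq0//.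
by rewrite root_prod_XsubC mem_rem_uniq// inE eq_sym ab.
Qed.

Lemma size_lagrange l a : uniq l -> a \in l -> size (lagrange l a) = size l.
Proof.
move=> ul al; rewrite size_scale ?invr_eq0 ?nodal_rem_neq0//.
by rewrite size_prod_XsubC size_rem// prednK// (leq_ltn_trans _ (_ : index a l < _)%N) ?index_mem.
Qed.

Lemma sum_lagrange_node l (u : R -> R) b : uniq l -> b \in l ->
  \sum_(a <- l) u a * (lagrange l a).[b] = u b.
Proof.
move=> ul bl; rewrite (bigD1_seq b)//= lagrange_self// mulr1 big_seq_cond big1 ?addr0//.
by move=> a /andP[al ab]; rewrite lagrange_other// mulr0.
Qed.

Lemma poly_nodes0 l p : uniq l -> (size p <= size l)%N ->
  (forall a, a \in l -> p.[a] = 0) -> p = 0.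
Proof.
move=> ul sp pl; apply/eqP/negP => /negP p0.
have := max_poly_roots p0 _ ul; rewrite ltnNge sp => /(_ _)/notF; apply.
by apply/allP => a /pl /rootP.
Qed.

Lemma lagrange_exists l (u : R -> R) : uniq l ->
  exists p, (size p <= size l)%N /\ (forall a, a \in l -> p.[a] = u a).
Proof.
move=> ul; exists (\sum_(a <- l) u a *: lagrange l a); split.
  rewrite big_seq_cond; apply: (leq_trans (size_sum _ _ _)).
  apply/bigmax_leqP_seq => a _ /andP[al _].
  by rewrite (leq_trans (size_scale_leq _ _))// size_lagrange.
move=> b bl; rewrite horner_sum -[RHS](sum_lagrange_node u ul bl).
by apply: eq_bigr => a _; rewrite hornerZ.
Qed.

Lemma lagrange_repr l p : uniq l -> (size p <= size l)%N ->
  p = \sum_(a <- l) p.[a] *: lagrange l a.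
Proof.
move=> ul sp; apply/eqP; rewrite -subr_eq0; apply/eqP.
apply: (poly_nodes0 ul) => [|b bl].
  rewrite (leq_trans (size_polyD _ _))// geq_max sp size_polyN /= big_seq_cond.
  apply: (leq_trans (size_sum _ _ _)).
  apply/bigmax_leqP_seq => a _ /andP[al _].
  by rewrite (leq_trans (size_scale_leq _ _))// size_lagrange.
rewrite hornerD hornerN horner_sum -[X in X - _](sum_lagrange_node (horner p) ul bl).
apply/eqP; rewrite subr_eq0; apply/eqP; apply: eq_bigr => a _.
by rewrite [in RHS]hornerZ.
Qed.

Lemma coef_sqr_top p n : (size p <= n.+1)%N -> (p * p)`_(n + n) = p`_n ^+ 2.
Proof.
move=> sp; rewrite coefM.
have nlt : (n < (n + n).+1)%N by rewrite ltnS leq_addr.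
rewrite (bigD1 (Ordinal nlt))//= addnK big1 ?addr0// => i /eqP ni.
have {}ni : (i != n :> nat)%N by apply/eqP => E; apply: ni; apply: val_inj.
have [ltin|] := ltnP i n; first by rewrite [p`_(_ - _)]nth_default ?mulr0// (leq_trans sp)//; lia.
rewrite leq_eqVlt eq_sym (negbTE ni) /= => lt.
by rewrite nth_default ?mul0r// (leq_trans sp).
Qed.

(** Hence, if the second derivative of the nodal polynomial vanishes at a node, the Lagrange
    polynomial of this node is stationary there. *)
Lemma nodal_deriv2 l a : a \in l -> (nodal l)^`()^`().[a] = (nodal (rem a l))^`().[a] *+ 2.
Proof.
move=> al; rewrite (nodal_rem al); move: (nodal (rem a l)) => N.
rewrite derivM derivXsubC mul1r derivD derivM derivXsubC mul1r !hornerD hornerM.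
by rewrite hornerXsubC subrr mul0r addr0 mulr2n.
Qed.

Lemma nodal_ends (s : seq R) : nodal (-1 :: rcons s 1) = ('X ^+ 2 - 1) * nodal s.
Proof.
rewrite /nodal big_cons -cats1 big_cat /= big_seq1 polyCN opprK polyC1.
by rewrite mulrCA mulrC; congr (_ * _); rewrite [RHS]subr_sqr_1 mulrC.
Qed.

(* Fejer's argument: 1 minus the sum of the squares vanishes at all nodes, and to
   second order at the inner ones, where the derivative of the Lagrange
   polynomials is zero; this determines it up to a factor, which is negative. *)
Lemma fejer_sum_sqr (s : seq R) (x : R) : let l := -1 :: rcons s 1 in
  path <%R (-1) (rcons s 1) ->
  (forall a, a \in s -> (nodal l)^`()^`().[a] = 0) ->
  -1 <= x <= 1 -> \sum_(a <- l) (lagrange l a).[x] ^+ 2 <= 1.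
Proof.
move=> l pl d2 xI.
have ul : uniq l by exact: (lt_sorted_uniq (s := l)).
have [us sl] : uniq s /\ {subset s <= l}.
  split; last by move=> a sa; rewrite inE mem_rcons inE sa !orbT.
  by move: ul; rewrite /= rcons_uniq => /andP[_ /andP[]].
have nodalE : nodal l = ('X ^+ 2 - 1) * nodal s by exact: nodal_ends.
pose S : {poly R} := \sum_(a <- l) lagrange l a * lagrange l a.
pose T := 1 - S.
have sizeS : (size S <= (size s).+1 + (size s).+2)%N.
  rewrite /S big_seq_cond; apply: (leq_trans (size_sum _ _ _)).
  apply/bigmax_leqP_seq => a _ /andP[al _].
  by rewrite (leq_trans (size_polyMleq _ _))// size_lagrange//= size_rcons; lia.
have Sb b : b \in l -> S.[b] = 1.
  move=> bl; rewrite -(lagrange_self b ul).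
  rewrite -[RHS](sum_lagrange_node (fun a => (lagrange l a).[b]) ul bl) horner_sum.
  by apply: eq_bigr => a _; rewrite hornerM.
have dS b : b \in s -> S^`().[b] = 0.
  move=> bs.
  suff key a : a \in l -> (lagrange l a * lagrange l a)^`().[b] = 0.
    by rewrite raddf_sum horner_sum big_seq_cond big1// => a /andP[/key].
  move=> al; rewrite derivM hornerD !hornerM.
  have [ab|ab] := eqVneq a b; last first.
    have z : (lagrange l a).[b] = 0 by exact: (lagrange_other ul al (sl _ bs) ab).
    by rewrite !z mul0r mulr0 addr0.
  suff -> : (lagrange l a)^`().[b] = 0 by rewrite mul0r mulr0 addr0.
  move: (d2 b bs); rewrite nodal_deriv2 ?sl// -ab => /eqP.
  by rewrite mulrn_eq0 /= /lagrange derivZ hornerZ => /eqP ->; rewrite mulr0.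
have [Q TE] : exists Q, T = Q * nodal l.
  apply: uniq_roots_prod_XsubC; last by rewrite uniq_rootsE.
  by apply/allP => a al; apply/rootP; rewrite !hornerE Sb// subrr.
have [V QE] : exists V, Q = V * nodal s.
  apply: uniq_roots_prod_XsubC; last by rewrite uniq_rootsE.
  apply/allP => a sa; apply/rootP.
  have : T^`().[a] = 0 by rewrite derivB derivC sub0r hornerN dS// oppr0.
  rewrite TE (nodal_rem (sl _ sa)) derivM derivM derivXsubC mul1r !(hornerXsubC, hornerD, hornerM).
  rewrite subrr !mul0r mulr0 add0r addr0.
  by move=> /eqP; rewrite mulf_eq0 (negbTE (nodal_rem_neq0 a ul)) orbF => /eqP.
(* M collects the known zeros of T. Its degree 2 k is the largest that T can have, so the cofactor V
   is a constant. *)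
pose M := ('X ^+ 2 - 1) * nodal s * nodal s; pose k := (size s).+1.
have q_monic : ('X ^+ 2 - 1 : {poly R}) \is monic by rewrite monicXnsubC.
have ns_monic : nodal s \is monic by exact: monic_prod_XsubC.
have M_monic : M \is monic by rewrite !monicMl.
have sizeM : size M = (k + k).+1.
  rewrite !size_Mmonic ?monic_neq0// ?monicMl// size_XnsubC// size_prod_XsubC /k; lia.
have TM : T = V * M by rewrite TE QE nodalE /M -mulrA; congr (_ * _); rewrite mulrCA mulrA.
have sV : (size V <= 1)%N.
  have [->|V0] := eqVneq V 0; first by rewrite size_poly0.
  have : (size T <= (k + k).+1)%N.
    by rewrite (leq_trans (size_polyD _ _))// geq_max size_polyN size_polyC oner_neq0 (leq_trans sizeS)// /k; lia.
  by rewrite TM size_Mmonic// sizeM addnS /= -add1n leq_add2r.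
(* Coefficients of degree 2 k are compared: the Lagrange polynomials have degree k, so their squares
   contribute the squares of their leading coefficients. *)
have cE : V`_0 = - \sum_(a <- l) (lagrange l a)`_k ^+ 2.
  have <- : T`_(k + k) = V`_0.
    have ML : M`_(k + k) = 1 by rewrite -(monicP M_monic) /lead_coef sizeM.
    by rewrite TM {1}(size1_polyC sV) coefCM ML mulr1.
  rewrite coefB coef1 addnS sub0r coef_sum; congr (- _).
  rewrite big_seq [RHS]big_seq; apply: eq_bigr => a al; rewrite -addnS coef_sqr_top//.
  by rewrite size_lagrange//= size_rcons.
have c0 : V`_0 <= 0 by rewrite cE oppr_le0 sumr_ge0// => a _; rewrite sqr_ge0.
have : 0 <= T.[x].
  rewrite TM {1}(size1_polyC sV) hornerM hornerC !(hornerM _ (nodal s)).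
  rewrite hornerD hornerXn hornerN hornerC; move: (V`_0) c0 (nodal s).[x] => c c0 v.
  rewrite -mulrA mulrA mulr_ge0//; last by rewrite -expr2 sqr_ge0.
  by rewrite mulr_le0// subr_le0; case/andP: xI => ? ?; nra.
rewrite hornerD hornerN hornerC subr_ge0 horner_sum; apply: le_trans.
by rewrite le_eqVlt; apply/orP; left; apply/eqP/eq_bigr => a _; rewrite hornerM expr2.
Qed.

Lemma lagrange_bound (s : seq R) p (x B : R) : let l := -1 :: rcons s 1 in
  path <%R (-1) (rcons s 1) ->
  (forall a, a \in s -> (nodal l)^`()^`().[a] = 0) -> (size p <= size l)%N ->
  (forall a, a \in l -> `|p.[a]| <= B) ->
  -1 <= x <= 1 -> `|p.[x]| <= Num.sqrt (size l)%:R * B.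
Proof.
move=> l pl d2 sp pB xI.
have ul : uniq l by exact: (lt_sorted_uniq (s := l)).
have F := fejer_sum_sqr pl d2 xI; rewrite -/l in F.
have B0 : 0 <= B by rewrite (le_trans _ (pB (-1) _))// inE eqxx.
pose w := Num.sqrt (size l)%:R : R.
have w0 : 0 < w by rewrite sqrtr_gt0 ltr0n.
have ww : w * w = (size l)%:R by rewrite -expr2 sqr_sqrtr.
rewrite [in X in `|X|](lagrange_repr ul sp) horner_sum (le_trans (ler_norm_sum _ _ _))//.
(* Cauchy-Schwarz in additive form: t <= (1 / w + w t^2) / 2 with w the square root of the number of
   nodes, while the squares sum to at most 1. *)
apply: (@le_trans _ _ (\sum_(a <- l) (w^-1 + w * (lagrange l a).[x] ^+ 2) / 2 * B)).
  rewrite big_seq [leRHS]big_seq; apply: ler_sum => a al.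
  rewrite hornerZ normrM mulrC ler_pM// ?pB//.
  rewrite -[X in X ^+ 2]mulr1 -real_normK ?num_real// mulr1 ler_pdivlMr//.
  rewrite -(ler_pM2l w0) [leRHS]mulrDr mulfV ?gt_eqF//.
  move: (normr_ge0 (lagrange l a).[x]); move: (`|_|) => t t0.
  by have := sqr_ge0 (w * t - 1); nra.
rewrite -mulr_suml ler_wpM2r// -mulr_suml big_split /= -mulr_sumr big_const_seq count_predT iter_addr_0 -[_ *+ size l]mulr_natr -[in X in X + _]ww -/w.
by rewrite mulrA mulVf ?gt_eqF// mul1r ler_pdivrMr// mulr_natr mulr2n lerD2l ler_piMr// ltW.
Qed.

End Lagrange.

Section GaussLobatto.
Context {R : realType}.

(** By its degree, the derivative of the Legendre polynomial is a constant times [nodal s].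
    Legendre's equation, differentiated once, then makes the second derivative of the whole nodal
    polynomial a multiple of [nodal s], which vanishes at the inner nodes. *)
Lemma gauss_lobatto_list n : (0 < n)%N -> exists s : seq R,
  [/\ size (-1 :: rcons s 1) = n.+1, path <%R (-1) (rcons s 1),
      forall a, a \in s -> (nodal (-1 :: rcons s 1))^`()^`().[a] = 0 &
      forall x, gauss_lobatto n x <-> x \in -1 :: rcons s 1].
Proof.
move=> n0; have [s [ss ps rs sP]] := @gauss_lobatto_nodes R n n0.
exists s; split => //; first by rewrite /= size_rcons ss prednK.
have us : uniq s.
  by have := lt_sorted_uniq (path_sorted ps); rewrite rcons_uniq => /andP[].
have [V DE] : exists V, (rodrigues n)^`() = V * nodal s.
  by apply: uniq_roots_prod_XsubC; rewrite ?uniq_rootsE.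
have ns_monic : nodal s \is monic by exact: monic_prod_XsubC.
have V0 : V != 0.
  by apply: contraNneq (@rodrigues_deriv_neq0 R n n0) => V0; rewrite DE V0 mul0r.
have sV : (size V <= 1)%N.
  have := @size_rodrigues_deriv R n.
  by rewrite DE size_Mmonic// size_prod_XsubC ss; lia.
have c0 : V`_0 != 0.
  by move: V0; rewrite (size1_polyC sV) polyC_eq0 coefC.
move=> a sa; have := @legendre_ode R n; rewrite /= -/(rodrigues n) DE.
rewrite (size1_polyC sV) mul_polyC -scalerAr -nodal_ends derivZ => /(congr1 (fun p => p^`().[a])).
rewrite derivZ hornerZ derivMn hornerMn -/(rodrigues n) (rootP (allP rs _ sa)) mul0rn.
by move=> /eqP; rewrite mulf_eq0 (negbTE c0) => /eqP.
Qed.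

Lemma interpolantP n (f : R -> R) : (0 < n)%N -> is_interpolant n f (interpolant n f).
Proof.
move=> n0; have [s [ss ps _ sP]] := gauss_lobatto_list n0.
have [p [sp pf]] := lagrange_exists f (lt_sorted_uniq (ps : sorted <%O (-1 :: rcons s 1))).
rewrite ss in sp.
have : is_interpolant n f p by split => // x /sP /pf.
by move=> H; rewrite /interpolant; case: xgetP => [g -> //|/(_ p)].
Qed.

Lemma gauss_lobatto_bound n (p : {poly R}) (B x : R) : (0 < n)%N ->
  (size p <= n.+1)%N -> (forall a, gauss_lobatto n a -> `|p.[a]| <= B) ->
  -1 <= x <= 1 -> `|p.[x]| <= Num.sqrt n.+1%:R * B.
Proof.
move=> n0 sp pB; have [s [ss ps d2 sP]] := gauss_lobatto_list n0.
rewrite -ss; apply: lagrange_bound => //; first by rewrite ss.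
by move=> a /sP /pB.
Qed.

Lemma gauss_lobatto_itv n (x : R) : (0 < n)%N -> gauss_lobatto n x -> -1 <= x <= 1.
Proof.
move=> n0; have [s [ss ps d2 sP]] := gauss_lobatto_list n0.
move=> /sP; rewrite inE mem_rcons inE => /or3P[/eqP ->|/eqP ->|xs]; [lra|lra|].
have /= := order_path_min lt_trans ps; rewrite all_rcons => /andP[_ /allP /(_ _ xs)/ltW -> /=].
have := path_sorted ps; rewrite lt_sorted_pairwise pairwise_rcons => /andP[].
by move=> /allP /(_ _ xs) /ltW.
Qed.

End GaussLobatto.

(** * Jackson's theorem and Markov's inequality *)

Section Chebyshev.
Context {R : realType}.

Fixpoint chebTU (k : nat) : {poly R} * {poly R} :=
  if k is k'.+1 then
    let: (T, U) := chebTU k' in ('X * T - (1 - 'X ^+ 2) * U, 'X * U + T)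
  else (1, 0).

(* [cheb_T k] at [cos t] is [cos (k t)] and [cheb_U k] is [sin (k t) / sin t],
   so that [cheb_U k] is the usual U_(k-1). *)
Definition cheb_T k := (chebTU k).1.
Definition cheb_U k := (chebTU k).2.

Lemma cheb_TS k : cheb_T k.+1 = 'X * cheb_T k - (1 - 'X ^+ 2) * cheb_U k.
Proof. by rewrite /cheb_T /cheb_U /=; case: (chebTU k). Qed.

Lemma cheb_US k : cheb_U k.+1 = 'X * cheb_U k + cheb_T k.
Proof. by rewrite /cheb_T /cheb_U /=; case: (chebTU k). Qed.

Lemma cheb_cos_sin k (t : R) : (cheb_T k).[cos t] = cos (k%:R * t) /\
  (cheb_U k).[cos t] * sin t = sin (k%:R * t).
Proof.
elim: k => [|k [IHT IHU]]; first by rewrite /cheb_T /cheb_U /= hornerC horner0 !mul0r cos0 sin0.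
have -> : k.+1%:R * t = k%:R * t + t by rewrite -natr1 mulrDl mul1r.
rewrite cheb_TS cheb_US cosD sinD -IHT -IHU.
have E := sin2cos2 t.
rewrite !(hornerD, hornerM, hornerX, hornerN, hornerC, hornerXn) -E.
by split; ring.
Qed.

Lemma cheb_T_cos k (t : R) : (cheb_T k).[cos t] = cos (k%:R * t).
Proof. by have [] := cheb_cos_sin k t. Qed.

Lemma cheb_T_bound k (x : R) : -1 <= x <= 1 -> `|(cheb_T k).[x]| <= 1.
Proof.
move=> xI; rewrite -(acosK _ : cos (acos x) = x) ?in_itv// cheb_T_cos ler_norml.
by rewrite cos_geN1 cos_le1.
Qed.

Lemma cheb_U_bound k (x : R) : -1 <= x <= 1 -> `|(cheb_U k).[x]| <= k%:R.
Proof.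
move=> xI; elim: k => [|k IH]; first by rewrite /cheb_U /= horner0 normr0.
rewrite cheb_US hornerD hornerM hornerX (le_trans (ler_normD _ _))// -natr1 lerD ?cheb_T_bound//.
by rewrite normrM (le_trans _ IH)// ler_piMl// ler_norml.
Qed.

Lemma cheb_deriv_ring (A : comNzRingType) (X T U c : A) :
  (T + X * (c * U) - ((- (X *+ 2)) * U + (X * U - c * T)) = (c + 1) * (X * U + T)) /\
  (1 - X ^+ 2) * U + X * (X * U - c * T) + (1 - X ^+ 2) * (c * U) =
    X * (X * U + T) - (c + 1) * (X * T - (1 - X ^+ 2) * U).
Proof. by split; ring. Qed.

(** The two identities need each other in the induction. The factor 1 - X^2 clears the denominator
    that arises when sin (k t) / sin t is differentiated with respect to cos t. *)
Lemma cheb_deriv_aux k : (cheb_T k)^`() = k%:R * cheb_U k /\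
  (1 - 'X ^+ 2) * (cheb_U k)^`() = 'X * cheb_U k - k%:R * cheb_T k.
Proof.
elim: k => [|k [IHT IHU]].
  by rewrite /cheb_T /cheb_U /= derivC !mul0r linear0 !mulr0 subr0.
have d1 : (1 - 'X ^+ 2 : {poly R})^`() = - ('X *+ 2).
  by rewrite derivB derivXn derivC sub0r expr1.
rewrite cheb_TS cheb_US derivB !derivM d1 !derivD derivM derivX !mul1r -natr1 IHT.
have [E1 E2] := cheb_deriv_ring 'X (cheb_T k) (cheb_U k) k%:R.
split; first by rewrite -E1 -IHU.
by rewrite -E2 -IHU !mulrDr; congr (_ + _ + _); rewrite mulrCA.
Qed.

Lemma cheb_T_deriv k : (cheb_T k)^`() = k%:R * cheb_U k.
Proof. by have [] := cheb_deriv_aux k. Qed.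

Lemma cheb_T_deriv_bound k (x : R) : -1 <= x <= 1 ->
  `|(cheb_T k)^`().[x]| <= k%:R ^+ 2.
Proof.
move=> xI; rewrite cheb_T_deriv -polyC_natr hornerM hornerC normrM ger0_norm//.
by rewrite expr2 ler_wpM2l// cheb_U_bound.
Qed.

Lemma cheb_size k : [/\ (size (cheb_T k) <= k.+1)%N, (size (cheb_U k) <= k)%N,
  0 < (cheb_T k)`_k & 0 <= (cheb_U k)`_k.-1].
Proof.
elim: k => [|k [sT sU cT cU]].
  by rewrite /cheb_T /cheb_U /= size_poly1 size_poly0 coef1 coef0.
have sX2 : (size (1 - 'X ^+ 2 : {poly R})%R <= 3)%N.
  by rewrite -opprB size_polyN size_XnsubC.
rewrite cheb_TS cheb_US; split.
- rewrite (leq_trans (size_polyD _ _))// geq_max size_polyN.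
  rewrite (leq_trans (size_polyMleq _ _)) ?size_polyX//=.
  rewrite (leq_trans (size_polyMleq _ _))//.
  by move: sX2 sU; move: (size _) (size _) => a b; lia.
- rewrite (leq_trans (size_polyD _ _))// geq_max sT andbT.
  by rewrite (leq_trans (size_polyMleq _ _)) ?size_polyX//=.
- rewrite coefB coefXM /= mulrBl mul1r coefB opprB [X in _ + (X - _)]coefXnM.
  rewrite [in X in _ - X]nth_default ?subr0; last exact: leq_trans sU _.
  case: k sU cT cU {sT} => [|k] sU cT cU; first by rewrite addr0.
  by rewrite ltnS /= subn2 /= ltr_wpDr.
rewrite coefD coefXM /=; case: k cU {sU} cT {sT} => [|k] cU cT /=; first by rewrite add0r ltW.
by rewrite addr_ge0// ltW.
Qed.

(** T_n has a positive coefficient in degree n, so a multiple of it removes the top term of p. *)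
Lemma cheb_span (n : nat) (P : {poly R} -> Prop) : P 0 ->
  (forall (c : R) p q, P p -> P q -> P (c *: p + q)) ->
  (forall k, (k < n)%N -> P (cheb_T k)) -> forall p : {poly R}, (size p <= n)%N -> P p.
Proof.
move=> P0 PD; elim: n => [|n IH] PT p; first by rewrite leqn0 size_poly_eq0 => /eqP ->.
move=> sp; have [sT _ cT _] := cheb_size n.
pose c := p`_n / (cheb_T n)`_n.
rewrite -(subrK (c *: cheb_T n) p) addrC; apply: PD; first exact: PT.
apply: IH; first by move=> k kn; apply: PT; rewrite ltnS ltnW.
apply/leq_sizeP => j; rewrite leq_eqVlt => /orP[/eqP <-|nj].
  by rewrite coefB coefZ divfK ?subrr// gt_eqF.
by rewrite coefB coefZ !nth_default ?mulr0 ?subrr// (leq_trans _ nj).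
Qed.

End Chebyshev.

Section DiscreteMean.
Context {R : realType}.
Variable M : nat.
Hypothesis M0 : (0 < M)%N.
Implicit Types (phi : R -> R).

(** Means over M equally spaced angles integrate trigonometric polynomials of degree below M
    exactly, so that finite sums replace Fourier integrals. *)
Definition circle_pt (l : nat) : R := pi *+ 2 * l%:R / M%:R.
Definition circle_mean phi : R := M%:R^-1 * \sum_(l < M) phi (circle_pt l).

Let M_neq0 : (M%:R : R) != 0. Proof. by rewrite pnatr_eq0 -lt0n. Qed.

Lemma circle_meanZ (c : R) phi : circle_mean (fun s => c * phi s) = c * circle_mean phi.
Proof. by rewrite /circle_mean -mulr_sumr mulrCA. Qed.

Lemma circle_meanD phi psi :
  circle_mean (fun s => phi s + psi s) = circle_mean phi + circle_mean psi.
Proof. by rewrite /circle_mean big_split /= mulrDr. Qed.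

Lemma circle_mean_sum (n : nat) (F : nat -> R -> R) :
  circle_mean (fun s => \sum_(i < n) F i s) = \sum_(i < n) circle_mean (F i).
Proof. by rewrite /circle_mean exchange_big /= mulr_sumr. Qed.

Lemma circle_mean_ext phi psi : phi =1 psi -> circle_mean phi = circle_mean psi.
Proof. by move=> E; rewrite /circle_mean; congr (_ * _); apply: eq_bigr. Qed.

Lemma circle_mean_le phi psi : (forall s, phi s <= psi s) ->
  circle_mean phi <= circle_mean psi.
Proof. by move=> E; rewrite ler_wpM2l ?invr_ge0// ler_sum. Qed.

Lemma circle_mean_norm phi : `|circle_mean phi| <= circle_mean (fun s => `|phi s|).
Proof.
rewrite normrM ger0_norm ?invr_ge0// ler_wpM2l ?invr_ge0//; exact: ler_norm_sum.
Qed.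

Lemma circle_mean_cst (c : R) : circle_mean (fun=> c) = c.
Proof. by rewrite /circle_mean sumr_const card_ord -[c *+ M]mulr_natl mulKf. Qed.

Lemma circle_mean_cos (k : nat) : (0 < k < M)%N ->
  circle_mean (fun s => cos (k%:R * s)) = 0.
Proof.
(* Multiplied by 2 sin b, with 2 b the step between the angles k s, the sum of cosines
   telescopes. *)
move=> /andP[k0 kM]; pose b : R := pi * k%:R / M%:R.
have sb : 0 < sin b.
  apply: sin_gt0_pi; rewrite divr_gt0 ?mulr_gt0 ?pi_gt0 ?ltr0n//=.
  by rewrite ltr_pdivrMr ?ltr0n// ltr_pM2l ?pi_gt0// ltr_nat.
apply/eqP; rewrite mulf_eq0; apply/orP; right.
rewrite -(mulrI_eq0 _ (mulfI (lt0r_neq0 sb))) -(mulrI_eq0 _ (mulfI (_ : (2 : R) != 0)))//.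
pose g (l : nat) := sin (l%:R * (b *+ 2) - b).
have -> : 2 * (sin b * \sum_(l < M) cos (k%:R * circle_pt l)) = \sum_(0 <= l < M) (g l.+1 - g l).
  rewrite big_mkord !mulr_sumr; apply: eq_bigr => l _; rewrite /g.
  have -> : k%:R * circle_pt l = l%:R * (b *+ 2) by rewrite /circle_pt /b; field.
  have -> : l.+1%:R * (b *+ 2) - b = l%:R * (b *+ 2) + b by rewrite -natr1; ring.
  by rewrite sinD sinB; ring.
rewrite telescope_sumr// /g mul0r sub0r sinN opprK.
have -> : M%:R * (b *+ 2) - b = - b + (pi *+ 2) *+ k by rewrite /b; field.
by rewrite (periodicn (@sinD2pi R)) sinN addNr.
Qed.

Lemma circle_mean_cosB (i j : nat) : (i < M)%N -> (j < M)%N ->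
  circle_mean (fun s => cos ((i%:R - j%:R) * s)) = (i == j)%:R.
Proof.
move=> iM jM; have [ij|ji|<-] := ltngtP i j.
- rewrite -[RHS](@circle_mean_cos (j - i)) ?subn_gt0 ?ij ?(leq_ltn_trans (leq_subr _ _))//.
  apply: circle_mean_ext => s; rewrite (natrB _ (ltnW ij)).
  by rewrite -[RHS]cosN -mulNr opprB.
- rewrite -[RHS](@circle_mean_cos (i - j)) ?subn_gt0 ?ji ?(leq_ltn_trans (leq_subr _ _))//.
  by apply: circle_mean_ext => s; rewrite (natrB _ (ltnW ji)).
rewrite -[RHS](circle_mean_cst 1).
by apply: circle_mean_ext => s; rewrite subrr mul0r cos0.
Qed.

Lemma cosM_half (x y : R) : cos x * cos y = 2^-1 * (cos (x + y) + cos (x - y)).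
Proof. by rewrite cosD cosB; field. Qed.

Lemma circle_mean_cos_cos (i j p : nat) : (i + p < M)%N -> (j + p < M)%N ->
  circle_mean (fun s => cos ((i%:R - j%:R) * s) * cos (p%:R * s)) =
  2^-1 * ((i + p == j)%N%:R + (j + p == i)%N%:R).
Proof.
move=> ip jp; rewrite [(j + p == i)%N]eq_sym.
rewrite -(@circle_mean_cosB (i + p) j)//; last by rewrite (leq_ltn_trans _ jp)// leq_addr.
rewrite -(@circle_mean_cosB i (j + p))//; last by rewrite (leq_ltn_trans _ ip)// leq_addr.
rewrite -circle_meanD -circle_meanZ; apply: circle_mean_ext => s.
by rewrite cosM_half !natrD; congr (_ * (cos _ + cos _)); ring.
Qed.

End DiscreteMean.

Section Markov.
Context {R : realType}.

(** The discrete Dirichlet kernel. Products of two cosines of frequency below n have frequencies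
    below 2 n <= M, where the mean is exact. *)
Lemma cheb_reproduce (n M : nat) (p : {poly R}) : (0 < n)%N -> (n + n <= M)%N ->
  (size p <= n)%N ->
  p = (M%:R^-1 : R) *: \sum_(l < M) p.[cos (circle_pt M l)] *:
        (1 + \sum_(1 <= k < n) (2 * cos (k%:R * circle_pt M l)) *: cheb_T k).
Proof.
move=> n0 nM; have M0 : (0 < M)%N by lia.
move: p; apply: cheb_span.
- by rewrite big1 ?scaler0// => l _; rewrite horner0 scale0r.
- move=> c p q pE qE; rewrite {1}pE {1}qE scalerA mulrC -scalerA -scalerDr; congr (_ *: _).
  rewrite scaler_sumr -big_split /=; apply: eq_bigr => l _.
  by rewrite hornerD hornerZ scalerDl scalerA.
move=> j jn; rewrite scaler_sumr.
transitivity ((circle_mean M (fun s => cos (j%:R * s)))%:P +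
    \sum_(1 <= k < n) (2 * circle_mean M (fun s => cos (j%:R * s) * cos (k%:R * s))) *: (@cheb_T R k)).
  have E k : (1 <= k < n)%N ->
      2 * circle_mean M (fun s => cos (j%:R * s) * cos (k%:R * s)) = (k == j)%:R :> R.
    move=> /andP[k1 kn]; have := @circle_mean_cos_cos R M M0 j 0 k; rewrite mulr0n subr0 => -> //; [|lia|lia].
    by rewrite add0n addn_eq0 (gtn_eqF k1) andbF add0r mulrA mulfV// mul1r.
  have -> : \sum_(1 <= k < n) (2 * circle_mean M (fun s => cos (j%:R * s) * cos (k%:R * s))) *: (@cheb_T R k) =
      \sum_(1 <= k < n) (k == j)%:R *: cheb_T k.
    by rewrite big_nat [RHS]big_nat; apply: eq_bigr => k kI; rewrite E.
  case: j jn {E} => [|j] jn.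
    rewrite big_nat big1 ?addr0; last by move=> [|k] //= _; rewrite scale0r.
    rewrite /cheb_T /= -polyC1 -(circle_mean_cst M0 1); congr polyC.
    by apply: circle_mean_ext => s; rewrite mul0r cos0.
  rewrite circle_mean_cos//; last by lia.
  rewrite polyC0 add0r (bigD1_seq j.+1) ?iota_uniq ?mem_index_iota//= eqxx scale1r.
  by rewrite big1 ?addr0// => k /negbTE ->; rewrite scale0r.
transitivity (\sum_(l < M) ((M%:R^-1 * cos (j%:R * circle_pt M l))%:P +
    \sum_(1 <= k < n) (M%:R^-1 * cos (j%:R * circle_pt M l) * (2 * cos (k%:R * circle_pt M l))) *: (@cheb_T R k))); last first.
  apply: eq_bigr => l _; rewrite cheb_T_cos scalerA scalerDr alg_polyC; congr (_ + _).
  by rewrite scaler_sumr; apply: eq_bigr => k _; rewrite scalerA.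
rewrite big_split /= -raddf_sum -mulr_sumr; congr (_ + _).
rewrite exchange_big; apply: eq_bigr => k _ /=; rewrite -scaler_suml; congr (_ *: _).
by rewrite /circle_mean !mulr_sumr; apply: eq_bigr => l _; ring.
Qed.

(** Differentiating the reproducing formula leaves fewer than n terms 2 cos (k s) T_k', each at most
    2 n^2. The sharp exponent is 2; with 3 the uniform error of g_n' is O(n^(19/4 - sigma)), which
    still tends to 0. *)
Lemma markov_crude (n : nat) (p : {poly R}) (B x : R) : (0 < n)%N -> (size p <= n)%N ->
  (forall y, -1 <= y <= 1 -> `|p.[y]| <= B) -> -1 <= x <= 1 ->
  `|p^`().[x]| <= 2 * n%:R ^+ 3 * B.
Proof.
move=> n0 sp pB xI; have M0 : (0 < n + n)%N by lia.
rewrite [in X in `|X|](cheb_reproduce n0 (leqnn _) sp) derivZ raddf_sum hornerZ horner_sum /=.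
have B0 : 0 <= B by rewrite (le_trans _ (pB x xI)).
have cI (s : R) : -1 <= cos s <= 1 by rewrite cos_geN1 cos_le1.
rewrite -(circle_mean_cst M0 (2 * n%:R ^+ 3 * B)) normrM ger0_norm ?invr_ge0//.
rewrite ler_wpM2l ?invr_ge0// (le_trans (ler_norm_sum _ _ _))// ler_sum// => l _.
rewrite derivZ hornerZ normrM mulrC ler_pM ?pB// derivD derivC add0r raddf_sum horner_sum /=.
rewrite (le_trans (ler_norm_sum _ _ _))//.
apply: (@le_trans _ _ (\sum_(1 <= k < n) 2 * n%:R ^+ 2)).
  rewrite big_nat [leRHS]big_nat ler_sum// => k /andP[_ kn].
  rewrite derivZ hornerZ normrM ler_pM//.
    by rewrite normrM ger0_norm// ler_piMr// ler_norml cos_geN1 cos_le1.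
  by rewrite (le_trans (cheb_T_deriv_bound k xI))// lerXn2r ?nnegrE// ler_nat ltnW.
rewrite sumr_const_nat -[leLHS]mulr_natr [n%:R ^+ 3]exprSr mulrA ler_wpM2l// ?ler_nat ?leq_subr//.
Qed.

End Markov.

Section Jackson.
Context {R : realType}.
Variable n : nat.
Hypothesis n0 : (0 < n)%N.
Let N := (n + n)%N.
(** The kernel has frequencies below N and is tested against cos (p s) with p <= 2. *)
Let M := N.+2.
Let M0 : (0 < M)%N. Proof. by []. Qed.

(** Triangular weights: the squared modulus K(u) of the sum of a_j e^(i j u) is Jackson's kernel
    (sin (n u / 2) / sin (u / 2))^4. Below, D is the mean of K(t + s) and K(t - s), nonnegative and
    even in s. *)
Let a (j : nat) : R := (minn j (N - j))%:R.
Let S : R := \sum_(j < N) a j ^+ 2.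
Let rho (p : nat) : R := \sum_(j < N) a j * a (j + p)%N.
Let D (t s : R) : R := \sum_(i < N) \sum_(j < N)
  a i * a j * (cos ((i%:R - j%:R) * t) * cos ((i%:R - j%:R) * s)).

Let a_out j : (N <= j)%N -> a j = 0.
Proof. by move=> jN; rewrite /a; have -> : minn j (N - j) = 0%N by lia. Qed.

Let sum_delta (F : nat -> R) q : ((N <= q)%N -> F q = 0) ->
  \sum_(j < N) F j * (q == j)%N%:R = F q.
Proof.
move=> Fq; have [qN|qN] := ltnP q N.
  rewrite (bigD1 (Ordinal qN))//= eqxx mulr1 big1 ?addr0// => i iq.
  rewrite (_ : (q == i)%N = false) ?mulr0//; apply/negbTE.
  by apply: contraNneq iq => E; apply/eqP/val_inj.
rewrite Fq// big1// => i _; rewrite (_ : (q == i)%N = false) ?mulr0//.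
by apply/eqP => E; move: (ltn_ord i); rewrite -E ltnNge qN.
Qed.

Let mean_D (p : nat) (t : R) : (p <= 2)%N ->
  circle_mean M (fun s => D t s * cos (p%:R * s)) = cos (p%:R * t) * rho p.
Proof.
move=> p2.
pose G i j := a i * a j * cos ((i%:R - j%:R) * t).
transitivity (\sum_(i < N) \sum_(j < N) G i j * (2^-1 * ((i + p == j)%N%:R + (j + p == i)%N%:R))).
  transitivity (\sum_(i < N) \sum_(j < N) G i j *
      circle_mean M (fun s => cos ((i%:R - j%:R) * s) * cos (p%:R * s))).
    pose F i j s := G i j * (cos ((i%:R - j%:R) * s) * cos (p%:R * s)).
    transitivity (circle_mean M (fun s => \sum_(i < N) \sum_(j < N) F i j s)).
      apply: circle_mean_ext => s; rewrite /D mulr_suml; apply: eq_bigr => i _.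
      by rewrite mulr_suml; apply: eq_bigr => j _; rewrite /F /G !mulrA.
    rewrite (circle_mean_sum M N (fun i s => \sum_(j < N) F i j s)); apply: eq_bigr => i _.
    rewrite (circle_mean_sum M N (F i)); apply: eq_bigr => j _.
    exact: circle_meanZ.
  apply: eq_bigr => i _; apply: eq_bigr => j _; rewrite circle_mean_cos_cos//.
    by rewrite /M; have := ltn_ord i; lia.
  by rewrite /M; have := ltn_ord j; lia.
have E1 : \sum_(i < N) \sum_(j < N) G i j * (i + p == j)%N%:R = cos (p%:R * t) * rho p.
  rewrite /rho mulr_sumr; apply: eq_bigr => i _.
  rewrite (sum_delta (F := G i)); last by move=> ip; rewrite /G (a_out ip) mulr0 mul0r.
  rewrite /G mulrC -cosN -mulNr natrD; congr (cos (_ * _) * _); ring.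
have E2 : \sum_(i < N) \sum_(j < N) G i j * (j + p == i)%N%:R = cos (p%:R * t) * rho p.
  rewrite exchange_big /rho mulr_sumr; apply: eq_bigr => i _.
  rewrite (sum_delta (F := G^~ i)); last by move=> ip; rewrite /G (a_out ip) !mul0r.
  rewrite /G mulrC [a (i + p)%N * _]mulrC natrD; congr (cos (_ * _) * _); ring.
transitivity (2^-1 * (\sum_(i < N) \sum_(j < N) G i j * (i + p == j)%N%:R +
    \sum_(i < N) \sum_(j < N) G i j * (j + p == i)%N%:R)); last by rewrite E1 E2; field.
rewrite -big_split mulr_sumr /=.
apply: eq_bigr => i _; rewrite -big_split mulr_sumr /=; apply: eq_bigr => j _; ring.
Qed.

Let D_ge0 (t s : R) : 0 <= D t s.
Proof.
have K0 u : 0 <= \sum_(i < N) \sum_(j < N) a i * a j * cos ((i%:R - j%:R) * u).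
  rewrite (_ : \sum_(i < N) _ = (\sum_(i < N) a i * cos (i%:R * u)) ^+ 2 +
     (\sum_(i < N) a i * sin (i%:R * u)) ^+ 2) ?addr_ge0 ?sqr_ge0//.
  rewrite !expr2 !mulr_suml -big_split /=; apply: eq_bigr => i _.
  rewrite !mulr_sumr -big_split /=; apply: eq_bigr => j _.
  by rewrite mulrBl cosB; ring.
suff -> : D t s = 2^-1 * (\sum_(i < N) \sum_(j < N) a i * a j * cos ((i%:R - j%:R) * (t + s)) +
    \sum_(i < N) \sum_(j < N) a i * a j * cos ((i%:R - j%:R) * (t - s))).
  by rewrite mulr_ge0 ?invr_ge0// addr_ge0.
rewrite -big_split mulr_sumr; apply: eq_bigr => i _.
rewrite -big_split mulr_sumr; apply: eq_bigr => j _ /=.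
by rewrite cosM_half [_ * (t + s)]mulrDr [_ * (t - s)]mulrBr; ring.
Qed.

Let a_lip i p : `|a i - a (i + p)%N| <= p%:R.
Proof.
have h1 : a i <= a (i + p)%N + p%:R by rewrite /a -natrD ler_nat; lia.
have h2 : a (i + p)%N <= a i + p%:R by rewrite /a -natrD ler_nat; lia.
by rewrite ler_norml; apply/andP; split; lra.
Qed.

(** The rising half of the weights already gives 1 + 4 + ... + n^2 >= n^3 / 3. *)
Let S_ge : n%:R ^+ 3 / 3 <= S.
Proof.
have sq k : (k%:R : R) ^+ 3 / 3 <= \sum_(0 <= j < k.+1) j%:R ^+ 2.
  elim: k => [|k IH]; first by rewrite big_nat1; lra.
  rewrite big_nat_recr//= -natr1; move: IH (ler0n R k); move: (k%:R : R) => x IH x0.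
  by apply: (@le_trans _ _ (x ^+ 3 / 3 + (x + 1) ^+ 2)); [nra|rewrite lerD2r].
apply: (le_trans (sq n)).
have nN : (n.+1 <= N)%N by rewrite /N; lia.
rewrite /S -(big_mkord xpredT (fun j => a j ^+ 2)) (big_cat_nat _ nN)//=.
rewrite -[leLHS]addr0 lerD//; last by apply: sumr_ge0 => j _; exact: sqr_ge0.
rewrite big_nat [leRHS]big_nat ler_sum// => j /andP[_ jn].
by rewrite lerXn2r ?nnegrE ?ler0n// /a ler_nat /N; lia.
Qed.

(** 2 (S - rho p) is the sum of the squares of a_j - a_(j+p), each at most p^2 <= 4, plus the a_j^2
    with j < p that the shift loses. So S - rho p is O(n), while S is at least n^3 / 3. *)
Let rho_bounds p : (p <= 2)%N -> 0 <= S - rho p <= 2^-1 * (n%:R * 8 + 1).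
Proof.
move=> p2; pose b j : R := a j ^+ 2.
have b0 j : 0 <= b j by exact: sqr_ge0.
have shift : \sum_(j < N) b (j + p)%N = S - \sum_(0 <= j < p) b j.
  rewrite -(big_mkord xpredT (fun j => b (j + p)%N)) -{1}[N](addnK p).
  rewrite -(big_addn 0 (N + p) p xpredT b) add0n.
  have pN : (p <= N + p)%N by rewrite leq_addl.
  have : \sum_(0 <= j < N + p) b j = S.
    rewrite (big_cat_nat _ (leq_addr p N))//= big_mkord -/S big_nat big1 ?addr0//.
    by move=> j /andP[Nj _]; rewrite /b a_out// expr0n.
  by rewrite (big_cat_nat _ pN)//= => <-; rewrite addrC addrK.
have head : 0 <= \sum_(0 <= j < p) b j <= 1.
  have a0 : b 0%N = 0 by rewrite /b /a min0n expr0n.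
  have a1 : b 1%N <= 1 by rewrite /b expr_le1 ?ler0n// /a lern1; lia.
  case: p p2 {shift} => [|[|[|//]]] _.
  - by rewrite big_geq// lexx ler01.
  - by rewrite big_nat1 a0 lexx ler01.
  by rewrite big_nat_recr//= big_nat1 a0 add0r b0 a1.
have E : 2 * (S - rho p) = \sum_(j < N) (a j - a (j + p)%N) ^+ 2 + \sum_(0 <= j < p) b j.
  have -> : \sum_(j < N) (a j - a (j + p)%N) ^+ 2 = S - 2 * rho p + \sum_(j < N) b (j + p)%N.
    rewrite /S /rho mulr_sumr -sumrB -big_split; apply: eq_bigr => j _ /=; rewrite /b; ring.
  by rewrite shift; ring.
have sqs : 0 <= \sum_(j < N) (a j - a (j + p)%N) ^+ 2 <= n%:R * 8.
  rewrite sumr_ge0 => [|j _]; last exact: sqr_ge0.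
  apply: (@le_trans _ _ (\sum_(j < N) 4)).
    apply: ler_sum => j _; rewrite -real_normK ?num_real// (_ : 4 = 2 ^+ 2)//; last by ring.
    by rewrite lerXn2r ?nnegrE// (le_trans (a_lip j p))// ler_nat.
  by rewrite sumr_const card_ord /N -[leLHS]mulr_natr natrD; lra.
by apply/andP; split; lra.
Qed.

Let S0 : 0 < S.
Proof. by rewrite (lt_le_trans _ S_ge)// divr_gt0 ?exprn_gt0 ?ltr0n. Qed.

Let mean_D0 t : circle_mean M (D t) = S.
Proof.
have := @mean_D 0 t isT; rewrite mul0r cos0 mul1r => E.
transitivity (circle_mean M (fun s => D t s * cos (0%:R * s))).
  by apply: circle_mean_ext => s; rewrite mul0r cos0 mulr1.
by rewrite E /rho; apply: eq_bigr => j _; rewrite addn0 expr2.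
Qed.

(** The relative second moment is O(n^-2), so the kernel is concentrated near cos s = cos t. The
    constant comes from 12 n = 36 / n^2 times n^3 / 3. *)
Let mean_D_sqr t : circle_mean M (fun s => D t s * (cos s - cos t) ^+ 2) <=
  36 / n%:R ^+ 2 * S.
Proof.
have E : circle_mean M (fun s => D t s * (cos s - cos t) ^+ 2) =
    2^-1 * (S + cos (2%:R * t) * rho 2) - 2 * cos t * (cos (1%:R * t) * rho 1) + cos t ^+ 2 * S.
  transitivity (circle_mean M (fun s => 2^-1 * (D t s + D t s * cos (2%:R * s)) +
      (- (2 * cos t)) * (D t s * cos (1%:R * s)) + cos t ^+ 2 * D t s)).
    apply: circle_mean_ext => s.
    by rewrite mul1r mulr_natl cos_mulr2n; field.
  by rewrite !circle_meanD !circle_meanZ circle_meanD !mean_D// mean_D0; ring.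
rewrite {}E mul1r mulr_natl cos_mulr2n.
have c1 : cos t ^+ 2 <= 1 by rewrite cos2sin2 lerBlDr lerDl sqr_ge0.
have /andP[r1 r1'] := @rho_bounds 1 isT; have /andP[r2 r2'] := @rho_bounds 2 isT.
have c0 := sqr_ge0 (cos t).
have n1 : 1 <= n%:R :> R by rewrite ler1n.
apply: (@le_trans _ _ (12 * n%:R)).
  (* After cos (2 t) = 2 cos^2 t - 1, only the differences S - rho p of order n remain. *)
  rewrite (_ : _ + _ = 2^-1 * (S - rho 2) + cos t ^+ 2 * (S + rho 2 - 2 * rho 1)); last by field.
  apply: (@le_trans _ _ (2^-1 * (S - rho 2) + (2 * (S - rho 1)))).
    by rewrite lerD2l (le_trans (_ : _ <= cos t ^+ 2 * (2 * (S - rho 1))))//; nra.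
  by lra.
have n0' : 0 < n%:R :> R by rewrite ltr0n.
rewrite mulrAC ler_pdivlMr ?exprn_gt0//.
rewrite (_ : 12 * n%:R * n%:R ^+ 2 = 36 * (n%:R ^+ 3 / 3)); last by field.
by rewrite ler_pM2l ?S_ge.
Qed.

(* The discrete Jackson operator: the mean of [h (cos s)] against the nonnegative
   kernel [D], which is a polynomial in [cos t] of degree less than [2n] and
   concentrated where [cos s] is close to [cos t]. *)
Lemma jackson_operator (h : R -> R) (L : R) : 0 <= L ->
  (forall x y : R, -1 <= x <= 1 -> -1 <= y <= 1 -> `|h x - h y| <= L * `|x - y|) ->
  exists p : {poly R}, (size p <= n + n)%N /\
    forall x : R, -1 <= x <= 1 -> `|h x - p.[x]| <= 6 * L / n%:R.
Proof.
move=> L0 hL.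
(* With truncated subtraction (i - j) + (j - i) is |i - j|, the index of the Chebyshev
   polynomial. *)
pose p : {poly R} := \sum_(l < M) (M%:R^-1 * S^-1 * h (cos (circle_pt M l))) *:
  \sum_(i < N) \sum_(j < N) (a i * a j * cos ((i%:R - j%:R) * circle_pt M l)) *:
    cheb_T ((i - j) + (j - i)).
have dist i j u : cos (((i - j) + (j - i))%N%:R * u) = cos ((i%:R - j%:R) * u) :> R.
  have [ij|/ltnW ji] := leqP i j.
    have -> : ((i - j) + (j - i) = j - i)%N by lia.
    by rewrite natrB// -[RHS]cosN -mulNr opprB.
  have -> : ((i - j) + (j - i) = i - j)%N by lia.
  by rewrite natrB.
have pE t : p.[cos t] = circle_mean M (fun s => S^-1 * D t s * h (cos s)).
  rewrite /p horner_sum /circle_mean mulr_sumr; apply: eq_bigr => l _.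
  rewrite hornerZ horner_sum -!mulrA; congr (_ * (_ * _)); rewrite mulrC; congr (_ * _).
  apply: eq_bigr => i _; rewrite horner_sum; apply: eq_bigr => j _.
  by rewrite hornerZ cheb_T_cos dist -!mulrA; congr (_ * (_ * _)); rewrite mulrC.
exists p; split.
  rewrite (leq_trans (size_sum _ _ _))//; apply/bigmax_leqP => l _.
  rewrite (leq_trans (size_scale_leq _ _))// (leq_trans (size_sum _ _ _))//; apply/bigmax_leqP => i _.
  rewrite (leq_trans (size_sum _ _ _))//; apply/bigmax_leqP => j _.
  rewrite (leq_trans (size_scale_leq _ _))//.
  have [sT _ _ _] := @cheb_size R ((i - j) + (j - i)); rewrite (leq_trans sT)//.
  by have := ltn_ord i; have := ltn_ord j; rewrite /N; lia.
move=> x xI; rewrite -(acosK _ : cos (acos x) = x) ?in_itv//; move: (acos x) => t.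
have cI (s : R) : -1 <= cos s <= 1 by rewrite cos_geN1 cos_le1.
have n0' : 0 < n%:R :> R by rewrite ltr0n.
have SV0 : 0 < S^-1 by rewrite invr_gt0.
have -> : h (cos t) - p.[cos t] = circle_mean M (fun s => S^-1 * D t s * (h (cos t) - h (cos s))).
  rewrite pE -{1}[h (cos t)]mulr1 -(mulVf (lt0r_neq0 S0)) -{2}(mean_D0 t) -circle_meanZ -circle_meanZ.
  rewrite -mulN1r -circle_meanZ -circle_meanD; apply: circle_mean_ext => s; ring.
rewrite (le_trans (circle_mean_norm _ _))//.
(* The modulus is traded for the second moment by u <= n u^2 / 12 + 3 / n, that is (n u - 6)^2 >= 0;
   each of the two terms then contributes 3 L / n. *)
apply: (@le_trans _ _ (circle_mean M (fun s =>
   L * S^-1 * (n%:R / 12) * (D t s * (cos s - cos t) ^+ 2) + 3 * L * S^-1 / n%:R * D t s))).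
  apply: circle_mean_le => s; have SD0 : 0 <= S^-1 * D t s by rewrite mulr_ge0 ?D_ge0// ltW.
  rewrite normrM ger0_norm//.
  have hs := hL _ _ (cI t) (cI s).
  apply: (@le_trans _ _ (S^-1 * D t s * (L * (n%:R / 12 * (cos s - cos t) ^+ 2 + 3 / n%:R)))).
    rewrite ler_wpM2l// (le_trans hs)// ler_wpM2l//.
    rewrite distrC -[X in _ <= _ * X + _]real_normK ?num_real//.
    move: (normr_ge0 (cos s - cos t)); move: (`|_|) => u u0.
    rewrite -(ler_pM2l n0') mulrDr [X in _ + X]mulrC divfK ?gt_eqF//.
    by have := sqr_ge0 (n%:R * u - 6); nra.
  by rewrite le_eqVlt; apply/orP; left; apply/eqP; field; rewrite !gt_eqF.
rewrite circle_meanD !circle_meanZ mean_D0.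
apply: (@le_trans _ _ (L * S^-1 * (n%:R / 12) * (36 / n%:R ^+ 2 * S) + 3 * L * S^-1 / n%:R * S)).
  rewrite lerD2r ler_wpM2l ?mean_D_sqr// !mulr_ge0 ?invr_ge0// ?ltW//.
by rewrite le_eqVlt; apply/orP; left; apply/eqP; field; rewrite !gt_eqF.
Qed.

End Jackson.

(** * Primitives and the variation of polynomials on an interval *)

Section IntervalIntegrals.
Context {R : realType}.
Local Notation mu := (@lebesgue_measure R).
Local Notation I11 := (`[(-1 : R), 1]).
Implicit Types (u v : R -> R) (p q : {poly R}).

Lemma Rintegral_itv_cst (c a b : R) : a <= b -> \int[mu]_(x in `[a, b]) c = c * (b - a).
Proof.
rewrite le_eqVlt => /predU1P[<-|ab]; first by rewrite set_itv1 Rintegral_set1 subrr mulr0.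
by rewrite /Rintegral integral_cst//= lebesgue_measure_itv/= lte_fin ab.
Qed.

Lemma Rintegral_itv_le u (c a b : R) : a <= b -> mu.-integrable `[a, b] (EFin \o u) ->
  (forall x, x \in `[a, b] -> u x <= c) -> \int[mu]_(x in `[a, b]) u x <= c * (b - a).
Proof.
move=> ab iu uc; rewrite -(Rintegral_itv_cst c ab); apply: le_Rintegral => //.
by apply: continuous_compact_integrable; [exact: segment_compact|move=> x; exact: cvg_cst].
Qed.

Lemma Rintegral_itv_norm_le u (c a b : R) : a <= b -> mu.-integrable `[a, b] (EFin \o u) ->
  (forall x, x \in `[a, b] -> `|u x| <= c) -> `|\int[mu]_(x in `[a, b]) u x| <= c * (b - a).
Proof.
move=> ab iu uc; rewrite (le_trans (le_normr_Rintegral _ iu))//.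
by apply: Rintegral_itv_le => //; exact: integrable_norm.
Qed.

Lemma primitive_lipschitz u v (c x y : R) : L1 v ->
  (forall x, x \in I11 -> u x = u (-1) + \int[mu]_(t in `[-1, x]) v t) ->
  (forall x, x \in I11 -> `|v x| <= c) -> x \in I11 -> y \in I11 ->
  `|u x - u y| <= c * `|x - y|.
Proof.
move=> iv uE vc; wlog xy : x y / x <= y => [H|] xI yI.
  by have [/H|/ltW /H] := leP x y; [exact|rewrite distrC [`|x - y|]distrC; exact].
rewrite (uE _ xI) (uE _ yI); move: xI yI; rewrite !in_itv /= => /andP[x1 _] /andP[_ y1].
rewrite (Rintegral_itv_split x1 xy); last exact: integrable_itvS iv.
rewrite distrC [in leRHS]distrC (_ : _ - _ = \int[mu]_(t in `[x, y]) v t); last by ring.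
rewrite [X in c * X]ger0_norm ?subr_ge0//; apply: Rintegral_itv_norm_le => //.
  exact: integrable_itvS iv.
move=> z; rewrite in_itv /= => /andP[xz zy]; apply: vc.
by rewrite in_itv /= (le_trans x1 xz) (le_trans zy y1).
Qed.

Lemma horner_integrable p (a b : R) : mu.-integrable `[a, b] (EFin \o horner p).
Proof.
apply: continuous_compact_integrable; first exact: segment_compact.
by apply: continuous_subspaceT; exact: horner_continuous.
Qed.

Lemma horner_FTC2 p (a b : R) : a <= b ->
  \int[mu]_(x in `[a, b]) p^`().[x] = p.[b] - p.[a].
Proof.
rewrite le_eqVlt => /predU1P[<-|ab]; first by rewrite set_itv1 Rintegral_set1 subrr.
rewrite /Rintegral (continuous_FTC2 (F := horner p) ab)//.
- by apply: continuous_subspaceT; exact: horner_continuous.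
- split; first by move=> x _; exact: derivable_horner.
  + by apply: cvg_at_right_filter; exact: horner_continuous.
  + by apply: cvg_at_left_filter; exact: horner_continuous.
- by move=> x _; rewrite derivE.
Qed.

Lemma horner_primitive p x : x \in I11 ->
  p.[x] = p.[-1] + \int[mu]_(t in `[-1, x]) p^`().[t].
Proof. by rewrite in_itv /= => /andP[x1 _]; rewrite horner_FTC2// addrC subrK. Qed.

Lemma poly_roots_list p : p != 0 ->
  exists s : seq R, (size s < size p)%N /\ forall x, root p x -> x \in s.
Proof.
move: {2}(size p) (erefl (size p)) => n; elim: n p => [|n IH] p sp p0.
  by move: p0; rewrite -size_poly_eq0 sp.
have [[c rc]|nr] := pselect (exists c, root p c); last first.
  exists [::]; split; first by rewrite sp.
  by move=> x rx; exfalso; apply: nr; exists x.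
have [q pE] := factor_theorem _ _ rc.
have q0 : q != 0 by apply: contraNneq p0 => q0; rewrite pE q0 mul0r.
have sq : size q = n.
  by move: sp; rewrite pE size_Mmonic ?monicXsubC// size_XsubC addn2 /= => -[].
have [s [ss rs]] := IH q sq q0.
exists (c :: s); split; first by rewrite sp /= ltnS -sq.
move=> x; rewrite pE rootM root_XsubC inE => /orP[/rs ->|->//]; exact: orbT.
Qed.

(** A derivative without zeros inside keeps its sign by the intermediate value theorem, so the
    variation is |p b - p a| <= 2 B. *)
Lemma poly_variation_monotone p (B : R) (s : seq R) a b : a <= b ->
  ~ (exists c, a < c < b /\ root p^`() c) ->
  (forall x, a <= x <= b -> `|p.[x]| <= B) ->
  \int[mu]_(x in `[a, b]) `|p^`().[x]| <= 2 * (size s).+1%:R * B.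
Proof.
move=> ab nr pB; have [pa pb] : `|p.[a]| <= B /\ `|p.[b]| <= B.
  by split; apply: pB; rewrite lexx ab.
have B0 : 0 <= B by rewrite (le_trans _ pa).
suff h : \int[mu]_(x in `[a, b]) `|p^`().[x]| <= `|p.[b] - p.[a]|.
  rewrite (le_trans h)// (le_trans (ler_normB _ _))// (@le_trans _ _ (2 * B))//; first by lra.
  by rewrite ler_wpM2r// ler_peMr// ler1n.
have ivt q x y : q = p^`() \/ q = - p^`() -> a <= x -> y <= b -> x < y -> q.[x] < 0 -> 0 < q.[y] -> False.
  move=> qp ax yb xy qx qy.
  have [z /andP[xz zy] rz] : exists2 z, x <= z <= y & root q z.
    by apply: poly_ivt; [exact: ltW|rewrite !ltW].
  apply: nr; exists z; split; last by case: qp rz => ->; rewrite ?rootN.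
  have zx : z != x by apply: contraTneq qx => <-; rewrite (rootP rz) ltxx.
  have zy' : z != y by apply: contraTneq qy => <-; rewrite (rootP rz) ltxx.
  rewrite (le_lt_trans ax) ?(lt_le_trans _ yb)//; first by rewrite lt_neqAle zy'.
  by rewrite lt_neqAle eq_sym zx.
have [[x [xab px]]|nn] := pselect (exists x, a <= x <= b /\ p^`().[x] < 0).
  have np y : a <= y <= b -> p^`().[y] <= 0.
    move=> /andP[ay yb]; rewrite leNgt; apply/negP => py; case/andP: xab => ax xb.
    have [xy|yx|E] := ltgtP x y.
    - by apply: (ivt p^`() x y) => //; left.
    - by apply: (ivt (- p^`()) y x) => //; [right|rewrite hornerN oppr_lt0|rewrite hornerN oppr_gt0].
    - by move: py; rewrite -E ltNge (ltW px).
  rewrite (_ : \int[mu]_(x in _) _ = \int[mu]_(x in `[a, b]) (- p)^`().[x]).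
    by rewrite horner_FTC2// !hornerN opprK addrC -opprB -normrN opprB ler_norm.
  apply: eq_Rintegral => y; rewrite inE /= in_itv /= => /np py.
  by rewrite derivN hornerN ler0_norm.
rewrite (_ : \int[mu]_(x in _) _ = \int[mu]_(x in `[a, b]) p^`().[x]).
  by rewrite horner_FTC2// ler_norm.
apply: eq_Rintegral => y; rewrite inE /= in_itv /= => yab.
by rewrite ger0_norm// leNgt; apply/negP => py; apply: nn; exists y.
Qed.

(* Between consecutive zeros of the derivative the variation is an increment. *)
Lemma poly_variation_roots p (B : R) (s : seq R) a b : a <= b ->
  (forall x, a < x < b -> root p^`() x -> x \in s) ->
  (forall x, a <= x <= b -> `|p.[x]| <= B) ->
  \int[mu]_(x in `[a, b]) `|p^`().[x]| <= 2 * (size s).+1%:R * B.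
Proof.
move: {2}(size s) (leqnn (size s)) => n.
elim: n s a b => [|n IH] s a b sn ab sr pB.
  apply: poly_variation_monotone => // -[c [cab rc]]; have := sr _ cab rc.
  by move: sn; rewrite leqn0 size_eq0 => /eqP ->.
have [[c [cab rc]]|nr] := pselect (exists c, a < c < b /\ root p^`() c); last exact: poly_variation_monotone.
have /andP[ac cb] := cab.
have cs : c \in s := sr _ cab rc.
pose s1 := [seq x <- s | x < c]; pose s2 := [seq x <- s | c < x].
(* Neither half contains c, which pays for the extra 1: (size s1).+1 + (size s2).+1 <= (size
   s).+1. *)
have s12 : (size s1 + size s2 < size s)%N.
  rewrite !size_filter -count_predUI.
  rewrite [X in (_ + X)%N](@eq_count _ _ pred0) ?count_pred0 ?addn0; last first.
    by move=> x /=; case: ltgtP.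
  set A := predU _ _; rewrite -[X in (_ < X)%N](count_predC A s).
  rewrite -[X in (X < _)%N]addn0 ltn_add2l -has_count; apply/hasP; exists c => //.
  by rewrite /= ltxx.
rewrite (Rintegral_itv_split (ltW ac) (ltW cb)); last exact/integrable_norm/horner_integrable.
apply: (@le_trans _ _ (2 * (size s1).+1%:R * B + 2 * (size s2).+1%:R * B)).
  apply: lerD; apply: IH; rewrite ?ltW//.
  - by rewrite -ltnS (leq_trans _ sn)// (leq_ltn_trans _ s12)// leq_addr.
  - move=> x /andP[ax xc] rx; rewrite mem_filter xc sr// ax; exact: lt_trans xc cb.
  - by move=> x /andP[ax xc]; apply: pB; rewrite ax (le_trans xc (ltW cb)).
  - by rewrite -ltnS (leq_trans _ sn)// (leq_ltn_trans _ s12)// leq_addl.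
  - move=> x /andP[cx xb] rx; rewrite mem_filter cx sr// xb andbT; exact: lt_trans ac cx.
  - by move=> x /andP[cx xb]; apply: pB; rewrite xb (le_trans (ltW ac) cx).
have B0 : 0 <= B by rewrite (le_trans _ (pB a _))// lexx ab.
rewrite -mulrDl ler_wpM2r// -mulrDr ler_wpM2l// -natrD ler_nat; lia.
Qed.

Lemma poly_variation p (B : R) : (forall x, -1 <= x <= 1 -> `|p.[x]| <= B) ->
  \int[mu]_(x in `[-1, 1]) `|p^`().[x]| <= 2 * (size p)%:R * B.
Proof.
move=> pB; have B0 : 0 <= B by rewrite (le_trans _ (pB 0 _))//; lra.
have [p0|p0] := eqVneq p^`() 0.
  rewrite (_ : \int[mu]_(x in _) _ = 0); first by rewrite mulr_ge0.
  rewrite -[RHS](mul0r (1 - (-1))) -Rintegral_itv_cst; last by lra.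
  by apply: eq_Rintegral => x _; rewrite p0 horner0 normr0.
have [s [ss rs]] := poly_roots_list p0.
have sp : p != 0 by apply: contraNneq p0 => ->; rewrite derivC.
apply: (le_trans (@poly_variation_roots p B s _ _ _ _ pB)) => [|x _ /rs//|]; first by lra.
rewrite ler_wpM2r// ler_wpM2l// ler_nat.
exact: (leq_trans ss (ltnW (lt_size_deriv sp))).
Qed.

(** At i = 0 the division by zero gives 0, so the constant term vanishes. *)
Definition poly_prim q : {poly R} := \poly_(i < (size q).+1) (q`_i.-1 / i%:R).

Lemma size_poly_prim q : (size (poly_prim q) <= (size q).+1)%N.
Proof. exact: size_poly. Qed.

Lemma poly_primK q : (poly_prim q)^`() = q.
Proof.
apply/polyP => i; rewrite coef_deriv coef_poly ltnS /=; case: ltnP => iq.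
  by rewrite -[LHS]mulr_natr divfK// pnatr_eq0.
by rewrite mul0rn nth_default.
Qed.

End IntervalIntegrals.

Section JacksonChain.
Context {R : realType}.
Local Notation mu := (@lebesgue_measure R).
Local Notation I11 := (`[(-1 : R), 1]).

(** The operator with parameter d./2 gives a polynomial of size at most d, and d <= 3 d./2 for d >=
    2 turns the constant 6 into 18. For d = 1 a constant polynomial will do. *)
Lemma jackson_lipschitz (d : nat) (h : R -> R) (L : R) : (0 < d)%N -> 0 <= L ->
  (forall x y, x \in I11 -> y \in I11 -> `|h x - h y| <= L * `|x - y|) ->
  exists p : {poly R}, (size p <= d)%N /\
    forall x, x \in I11 -> `|h x - p.[x]| <= 18 * L / d%:R.
Proof.
move=> d0 L0 hL; have [d1|d2] := leqP d 1.
  have -> : d = 1%N by lia.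
  exists (h 0)%:P; split; first exact: size_polyC_leq1.
  move=> x xI; rewrite hornerC (le_trans (hL _ _ xI _))//; first by rewrite in_itv /=; lra.
  by move: xI; rewrite subr0 divr1 in_itv /= -ler_norml => x1; nra.
have n0 : (0 < d./2)%N by lia.
have [p [sp ph]] := jackson_operator n0 L0 (h := h) hL.
exists p; split; first by rewrite (leq_trans sp)//; lia.
move=> x xI; rewrite (le_trans (ph x xI))//.
rewrite ler_pdivrMr ?ltr0n// mulrAC ler_pdivlMr ?ltr0n// [18]( _ : 18 = 6 * 3); last by ring.
have h3 : (d%:R : R) <= (d./2 * 3)%N%:R by rewrite ler_nat; lia.
by have := ler_wpM2l L0 h3; rewrite natrM; lra.
Qed.

(** Each order gains a factor 1 / d: once v is approximated by q, the primitive of v - q is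
    Lipschitz with the error as its constant, and the Lipschitz case applies to it. Each primitive
    raises the degree by one, whence d + k. *)
Lemma jackson_chain k (u : R -> R) : chain (@C0 R) k u ->
  exists C, 0 < C /\ forall d, (0 < d)%N -> exists p : {poly R}, (size p <= d + k)%N /\
    forall x, x \in I11 -> `|u x - p.[x]| <= C / d%:R ^+ k.
Proof.
elim: k u => [|k IH] u.
  move=> /C0_bounded [M [M0 uM]]; exists M; split => // d d0.
  exists 0; split; first by rewrite size_poly0.
  by move=> x xI; rewrite horner0 subr0 expr0 divr1 uM.
move=> [v cv uE]; have [C [C0 HC]] := IH v cv.
exists (18 * C); split; first by rewrite mulr_gt0.
move=> d d0; have [q [sq qv]] := HC d d0.
pose P := poly_prim q; pose L := C / d%:R ^+ k.
have dk0 : 0 < d%:R ^+ k :> R by rewrite exprn_gt0 ?ltr0n.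
have iv : L1 v by apply: C0_L1; exact: chainC0 cv.
have iw : L1 (fun t => v t - q.[t]).
  rewrite /L1 (_ : _ \o _ = (EFin \o v) \- (EFin \o horner q))%E//.
  by apply: integrableB => //; exact: horner_integrable.
have wE x : x \in I11 -> u x - P.[x] = u (-1) - P.[-1] + \int[mu]_(t in `[-1, x]) (v t - q.[t]).
  move=> xI; have x1 : x <= 1 by move: xI; rewrite in_itv /= => /andP[].
  rewrite (uE x xI) (horner_primitive P xI) poly_primK RintegralB//; first by ring.
  - exact: integrable_itvS iv.
  - exact: horner_integrable.
have L0 : 0 <= L by rewrite divr_ge0// ltW.
have [p [sp ph]] := jackson_lipschitz d0 L0 (fun x y => primitive_lipschitz iw wE qv).
exists (P + p); split.
  rewrite (leq_trans (size_polyD _ _))// geq_max (leq_trans (size_poly_prim _))/= ?addnS//.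
  by rewrite (leq_trans sp)//; lia.
move=> x xI; rewrite hornerD opprD addrA (le_trans (ph x xI))//.
by rewrite le_eqVlt; apply/orP; left; apply/eqP; rewrite /L exprSr; field; rewrite expf_neq0 pnatr_eq0 -lt0n d0.
Qed.

End JacksonChain.

(** * The rate of convergence of the derivative of the interpolant *)

Section InterpolationRate.
Context {R : realType}.
Local Notation mu := (@lebesgue_measure R).
Local Notation I11 := (`[(-1 : R), 1]).

(** With w = n^(1/4) the exponents 3/4 and 11/4 of the estimates become integer powers. *)
Definition root4 (n : nat) : R := Num.sqrt (Num.sqrt n%:R).

Lemma root4K n : root4 n ^+ 4 = n%:R.
Proof. by rewrite /root4 (exprM _ 2 2) !sqr_sqrtr ?sqrtr_ge0. Qed.

Lemma root4_ge1 n : (0 < n)%N -> 1 <= root4 n.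
Proof.
by move=> n0; rewrite -[leLHS]sqrtr1 ler_wsqrtr// -[leLHS]sqrtr1 ler_wsqrtr// ler1n.
Qed.

(* [f = Q1 + h] with [Q1' = q] close to [f'], [h] small and Lipschitz, and
   [g = Q1 + Q2 + e] with [Q2] a Jackson approximation of [h] of degree about
   [n^(3/4)], which balances the variations of [Q2] and of [e]. *)
Lemma interpolation_split (n N : nat) (f f1 : R -> R) (q : {poly R}) (L : R) :
  (0 < N <= n)%N -> (size q < n)%N -> L1 f1 ->
  (forall x, x \in I11 -> f x = f (-1) + \int[mu]_(t in `[-1, x]) f1 t) ->
  (forall x, x \in I11 -> `|f1 x - q.[x]| <= L) ->
  let g := interpolant n f in let E := Num.sqrt n.+1%:R * (18 * L / N%:R) in
  \int[mu]_(x in `[-1, 1]) `|f1 x - g^`().[x]| <=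
    2 * L + 2 * N%:R * (20 * L) + 2 * n.+1%:R * E /\
  (forall x, x \in I11 -> `|f1 x - g^`().[x]| <=
    L + 2 * N%:R ^+ 3 * (20 * L) + 2 * n.+1%:R ^+ 3 * E).
Proof.
move=> /andP[N0 Nn] sq if1 fE qL g E.
have n0 : (0 < n)%N by lia.
(* The constant makes h vanish at -1, so that |h| <= 2 L follows from the Lipschitz bound. *)
pose P := poly_prim q; pose Q1 := P + (f (-1) - P.[-1])%:P.
have dQ1 : Q1^`() = q by rewrite derivD derivC addr0 poly_primK.
have L0 : 0 <= L by rewrite (le_trans _ (qL 0 _))// in_itv /=; lra.
have iw : L1 (fun t => f1 t - q.[t]).
  rewrite /L1 (_ : _ \o _ = (EFin \o f1) \- (EFin \o horner q))%E//.
  by apply: integrableB => //; exact: horner_integrable.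
pose h x := f x - Q1.[x].
have hm1 : h (-1) = 0 by rewrite /h hornerD hornerC; ring.
have hE x : x \in I11 -> h x = h (-1) + \int[mu]_(t in `[-1, x]) (f1 t - q.[t]).
  move=> xI; have x1 : x <= 1 by move: xI; rewrite in_itv /= => /andP[].
  rewrite /h (fE x xI) (horner_primitive Q1 xI) dQ1 RintegralB//; first by ring.
  - exact: integrable_itvS if1.
  - exact: horner_integrable.
have hlip x y : x \in I11 -> y \in I11 -> `|h x - h y| <= L * `|x - y|.
  exact: (primitive_lipschitz iw hE qL).
have h2L x : x \in I11 -> `|h x| <= 2 * L.
  move=> xI; have := hlip x (-1) xI; rewrite hm1 subr0 in_itv /= => /(_ ltac:(lra)) hx.
  rewrite (le_trans hx)// mulrC ler_wpM2r//.
  by move: xI; rewrite in_itv /= => /andP[x1 x2]; rewrite ler_norml; lra.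
have [Q2 [sQ2 hQ2]] := jackson_lipschitz N0 L0 hlip.
have N1 : 1 <= N%:R :> R by rewrite ler1n.
have E18 : 18 * L / N%:R <= 18 * L.
  by rewrite ler_pdivrMr ?(lt_le_trans ltr01)// ler_peMr// mulr_ge0.
(* 20 = 2 + 18: the bound of h plus Jackson's error, with N >= 1. *)
have Q2B x : -1 <= x <= 1 -> `|Q2.[x]| <= 20 * L.
  move=> xI; have -> : Q2.[x] = h x - (h x - Q2.[x]) by ring.
  rewrite (le_trans (ler_normB _ _))//.
  by have := h2L x xI; have := hQ2 x xI; lra.
have [sg gf] := interpolantP f n0; rewrite -/g in sg gf.
pose e := g - Q1 - Q2.
have sQ1 : (size Q1 <= n)%N.
  rewrite (leq_trans (size_polyD _ _))// geq_max (leq_trans (size_poly_prim _))//=.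
  by rewrite (leq_trans (size_polyC_leq1 _)).
have se : (size e <= n.+1)%N.
  rewrite (leq_trans (size_polyD _ _))// geq_max size_polyN (leq_trans sQ2) ?andbT; last by lia.
  by rewrite (leq_trans (size_polyD _ _))// geq_max size_polyN sg/= (leq_trans sQ1).
(* At the nodes g agrees with f, so there e is the Jackson error h - Q2. *)
have eB x : -1 <= x <= 1 -> `|e.[x]| <= E.
  apply: gauss_lobatto_bound => // a ga.
  have -> : e.[a] = h a - Q2.[a] by rewrite /e /h hornerD hornerN hornerD hornerN (gf a ga).
  by apply: hQ2; rewrite in_itv; exact: gauss_lobatto_itv n0 ga.
have dg x : f1 x - g^`().[x] = (f1 x - q.[x]) - Q2^`().[x] - e^`().[x].
  by rewrite /e !derivB dQ1 !hornerD !hornerN; ring.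
have E0 : 0 <= E by rewrite (le_trans _ (eB 0 _))//; lra.
split; last first.
  move=> x xI; rewrite dg (le_trans (ler_normB _ _))// lerD//; last exact: markov_crude.
  rewrite (le_trans (ler_normB _ _))// lerD ?qL//; exact: markov_crude.
have i1 : mu.-integrable `[-1, 1] (EFin \o (fun x => `|f1 x - q.[x]|)) by exact: integrable_norm.
have i2 p : mu.-integrable `[(-1 : R), 1] (EFin \o (fun x => `|p^`().[x]|)).
  exact/integrable_norm/horner_integrable.
apply: (@le_trans _ _ (\int[mu]_(x in `[-1, 1]) (`|f1 x - q.[x]| + `|Q2^`().[x]| + `|e^`().[x]|))).
  apply: le_Rintegral => //.
  - apply: integrable_norm.
    rewrite (_ : _ \o _ = (EFin \o f1) \- (EFin \o horner g^`()))%E//.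
    by apply: integrableB => //; exact: horner_integrable.
  - exact: (L1D (L1D i1 (i2 Q2)) (i2 e)).
  by move=> x _; rewrite dg (le_trans (ler_normB _ _))// lerD2r ler_normB.
rewrite RintegralD//; last exact: (L1D i1 (i2 Q2)).
rewrite RintegralD// !lerD//.
- rewrite mulrC (_ : 2 = 1 - (-1) :> R); last by ring.
  by apply: Rintegral_itv_le => //; lra.
- rewrite (le_trans (poly_variation Q2B))// ler_wpM2r ?mulr_ge0// ler_wpM2l// ler_nat//.
- by rewrite (le_trans (poly_variation eB))// ler_wpM2r// ler_wpM2l// ler_nat.
Qed.

Lemma interpolation_rate k (f f1 : R -> R) : chain (@C0 R) k f1 ->
  (forall x, x \in I11 -> f x = f (-1) + \int[mu]_(t in `[-1, x]) f1 t) ->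
  exists (n0 : nat) (C : R), 0 < C /\ forall n, (n0 <= n)%N ->
    let g := interpolant n f in let w := root4 n in
    \int[mu]_(x in `[-1, 1]) `|f1 x - g^`().[x]| <= C * w ^+ 3 / w ^+ (4 * k) /\
    (forall x, x \in I11 -> `|f1 x - g^`().[x]| <= C * w ^+ 11 / w ^+ (4 * k)).
Proof.
move=> cf1 fE; have [C [C0 HC]] := jackson_chain cf1.
(* 1200 dominates the constants 2 + 40 + 288 of the integral bound and 1 + 40 + 1152 of the uniform
   one. *)
have [K [K0 KE]] : exists K : R, 0 < K /\ K = 12 * 10 ^+ 2.
  by eexists; split; last reflexivity; rewrite mulr_gt0 ?exprn_gt0.
(* From n = 2 k + 2 on, d = n - 1 - k is at least n / 2, which costs the factor 2^k; d + k = n - 1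
   leaves room for a primitive. *)
exists (2 * k + 2)%N, (K * C * 2 ^+ k); split; first by rewrite !mulr_gt0 ?exprn_gt0.
move=> n nk g w; pose d := (n - 1 - k)%N.
have d0 : (0 < d)%N by lia.
have n0 : (0 < n)%N by lia.
have [q [sq qC]] := HC d d0.
have w1 : 1 <= w by exact: root4_ge1.
have w0 : 0 < w by rewrite (lt_le_trans ltr01).
have w4 : w ^+ 4 = n%:R by exact: root4K.
have w31 : 1 <= w ^+ 3 by exact: exprn_ege1.
pose N := Num.truncn (w ^+ 3).
have /andP[N1 N2] : N%:R <= w ^+ 3 < N.+1%:R by apply: truncn_itv; lra.
have N0 : (0 < N)%N by rewrite truncn_gt0.
have Nr : 1 <= N%:R :> R by rewrite ler1n.
have wN : w ^+ 3 <= 2 * N%:R by move: N2; rewrite -natr1; lra.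
have Nn : (N <= n)%N.
  by rewrite -(ler_nat R) (le_trans N1)// -w4 [leRHS]exprSr ler_peMr// exprn_ge0// ltW.
have if1 : L1 f1 by apply: C0_L1; exact: chainC0 cf1.
have sqn : (size q < n)%N by rewrite (leq_ltn_trans sq)// /d; lia.
have [] := @interpolation_split n N f f1 q _ _ sqn if1 fE qC; first by rewrite N0.
set L := C / d%:R ^+ k; rewrite -/g.
have wk0 : 0 < w ^+ (4 * k) by rewrite exprn_gt0.
have L0 : 0 <= L by rewrite divr_ge0 ?exprn_ge0// ltW.
have LC : L <= C * 2 ^+ k / w ^+ (4 * k).
  rewrite /L ler_pdivrMr ?exprn_gt0 ?ltr0n// mulrAC ler_pdivlMr// -!mulrA ler_pM2l//.
  rewrite exprM w4 -exprMn lerXn2r ?nnegrE ?mulr_ge0//.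
  by rewrite -natrM ler_nat /d; clear -nk; lia.
set E := Num.sqrt _ * _.
have nS : n.+1%:R <= 2 * w ^+ 4.
  by rewrite w4 -natrM ler_nat; clear -n0; lia.
have sn : Num.sqrt n.+1%:R <= 2 * w ^+ 2.
  rewrite -[leRHS]ger0_norm ?mulr_ge0 ?exprn_ge0 ?(ltW w0)// -sqrtr_sqr ler_wsqrtr//.
  rewrite (le_trans nS)// exprMn -exprM ler_wpM2r ?exprn_ge0 ?(ltW w0)//; lra.
have EL : E <= 72 * L / w.
  rewrite /E; apply: (@le_trans _ _ (2 * w ^+ 2 * (18 * L / N%:R))).
    by rewrite ler_wpM2r// divr_ge0// mulr_ge0.
  have Nr0 : 0 < N%:R :> R by rewrite (lt_le_trans ltr01).
  rewrite ler_pdivlMr// (_ : _ * w = 36 * L * w ^+ 3 / N%:R); last first.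
    by field; rewrite gt_eqF.
  by rewrite ler_pdivrMr//; have := ler_wpM2l L0 wN; lra.
have E0 : 0 <= E by rewrite /E mulr_ge0 ?sqrtr_ge0// divr_ge0// mulr_ge0.
have w11 : w ^+ 9 <= w ^+ 11 by rewrite ler_weXn2l.
move=> [ha hb]; split.
  apply: (le_trans ha); apply: (@le_trans _ _ (K * w ^+ 3 * L)); last first.
    by have := ler_wpM2l (mulr_ge0 (ltW K0) (ltW (exprn_gt0 3 w0))) LC; lra.
  have h1 : 2 * n.+1%:R * E <= 288 * w ^+ 3 * L.
    apply: (@le_trans _ _ (2 * (2 * w ^+ 4) * (72 * L / w))).
      by apply: ler_pM => //; rewrite ?mulr_ge0 ?ler_pM2l.
    by rewrite le_eqVlt; apply/orP; left; apply/eqP; field; rewrite gt_eqF.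
  have := ler_wpM2l L0 N1; have := ler_wpM2l L0 w31; move: h1; rewrite KE; lra.
move=> x xI; apply: (le_trans (hb x xI)); apply: (@le_trans _ _ (K * w ^+ 11 * L)); last first.
  by have := ler_wpM2l (mulr_ge0 (ltW K0) (ltW (exprn_gt0 11 w0))) LC; lra.
have h1 : 2 * n.+1%:R ^+ 3 * E <= 1152 * w ^+ 11 * L.
  apply: (@le_trans _ _ (2 * (2 * w ^+ 4) ^+ 3 * (72 * L / w))).
    apply: ler_pM => //.
    by rewrite ler_pM2l// lerXn2r ?nnegrE// mulr_ge0// exprn_ge0// ltW.
  by rewrite le_eqVlt; apply/orP; left; apply/eqP; field; rewrite gt_eqF.
have h2 : N%:R ^+ 3 <= w ^+ 11.
  by rewrite (le_trans _ w11)// (exprM w 3 3) lerXn2r ?nnegrE// exprn_ge0// ltW.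
have h3 : 1 <= w ^+ 11 by exact: exprn_ege1.
have := ler_wpM2l L0 h2; have := ler_wpM2l L0 h3; move: h1; rewrite KE; lra.
Qed.

End InterpolationRate.

(** * Distance of the densities *)

Lemma lebesgue_measure_ball (R : realType) (x e : R) : 0 <= e ->
  @lebesgue_measure R `[x - e, x + e] = (2 * e)%:E.
Proof.
move=> e0; rewrite lebesgue_measure_itv /= lte_fin.
case: ltP => d; first by rewrite -EFinD; congr (_%:E); ring.
have -> : e = 0 by lra.
by rewrite mulr0.
Qed.

Section PrimitiveTranslation.
Context {R : realType}.
Local Notation mu := (@lebesgue_measure R).
Local Notation I11 := (`[(-1 : R), 1]).
Variables (r r1 : R -> R).
Hypothesis ir1 : L1 r1.
Hypothesis rE : forall x, x \in I11 -> r x = r (-1) + \int[mu]_(t in `[-1, x]) r1 t.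

Lemma primitive_increment x y : x \in I11 -> y \in I11 ->
  (`|r x - r y|%:E <= \int[mu]_(s in `[Num.min x y, Num.max x y]) `|r1 s|%:E)%E.
Proof.
wlog xy : x y / x <= y => [H|] xI yI.
  have /orP[xy|yx] := le_total x y; first exact: H.
  by have := H y x yx yI xI; rewrite distrC minC maxC (min_idPr yx) (max_idPl yx).
rewrite (min_idPl xy) (max_idPr xy) (rE xI) (rE yI).
move: xI yI; rewrite !in_itv /= => /andP[x1 _] /andP[_ y1].
rewrite (Rintegral_itv_split x1 xy); last exact: integrable_itvS ir1.
have ir : mu.-integrable `[x, y] (EFin \o r1) by exact: integrable_itvS ir1.
rewrite distrC (_ : _ - _ = \int[mu]_(t in `[x, y]) r1 t); last by ring.
apply: (@le_trans _ _ (\int[mu]_(t in `[x, y]) `|r1 t|)%:E).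
  by rewrite lee_fin le_normr_Rintegral.
rewrite /Rintegral fineK//; apply: integrable_fin_num => //; exact: integrable_norm.
Qed.

Variables (tau : R -> R) (delta : R).
Hypothesis delta0 : 0 <= delta.
Hypothesis tauI : forall x, x \in I11 -> tau x \in I11.
Hypothesis taud : forall x, x \in I11 -> `|tau x - x| <= delta.
Hypothesis mr : measurable_fun [set` I11] (fun x => r (tau x) - r x).

(** The difference |r (tau x) - r x| is at most the integral of |r1| over the points within delta of
    x. After the exchange of integrals, each s is counted by an interval of x of length 2 delta. *)
Lemma primitive_translation :
  (\int[mu]_(x in [set` I11]) `|r (tau x) - r x|%:E <=
   (2 * delta)%:E * \int[mu]_(x in [set` I11]) `|r1 x|%:E)%E.
Proof.
pose v s := `|(r1 \_ [set` I11]) s|.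
have mv : measurable_fun setT v.
  apply: measurableT_comp => //.
  by apply/measurable_EFinP; exact: measurable_int (integrable_patchT (measurable_itv I11) ir1).
pose chi (x s : R) : R := (nat_of_bool (`|s - x| <= delta))%:R.
pose F (z : measurableTypeR R * measurableTypeR R) : \bar R :=
  (v z.2 * chi z.1 z.2)%:E.
have F0 z : (0 <= F z)%E by rewrite lee_fin mulr_ge0 ?normr_ge0 ?ler0n.
have mF : measurable_fun setT F.
  apply/measurable_EFinP; apply: measurable_funM.
    by apply: measurableT_comp => //; exact: measurable_snd.
  apply: (@measurableT_comp _ _ _ _ _ _ (fun b : bool => (b : nat)%:R : R)) => //.
  apply: measurable_fun_ler => //; apply: measurableT_comp => //.
  by apply: measurable_funB; [exact: measurable_snd|exact: measurable_fst].
apply: (@le_trans _ _ (\int[mu]_(x in [set` I11]) \int[mu]_s F (x, s))%E).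
  apply: ge0_le_integral => //.
  - by apply/measurable_EFinP; exact: measurableT_comp.
  - apply: measurable_funTS; exact: (measurable_fun_fubini_tonelli_F (m2 := mu) F).
  move=> x xI; have tI := tauI xI.
  have sub : [set` `[Num.min (tau x) x, Num.max (tau x) x]] `<=` [set` I11].
    move=> s /=; move: tI xI; rewrite /= !in_itv /= => /andP[t1 t2] /andP[x1 x2] /andP[s1 s2].
    by rewrite (le_trans _ s1) ?(le_trans s2)// ?le_min ?ge_max ?t1 ?t2 ?x1 ?x2.
  rewrite (le_trans (primitive_increment tI xI))// integral_mkcond.
  apply: ge0_le_integral => //.
  - by move=> s _; rewrite patchE; case: ifP.
  - apply: (measurable_restrictT _ (measurable_itv _)).1.
    apply: measurableT_comp => //; apply: measurableT_comp => //.
    apply: (measurable_funS (measurable_itv I11) sub).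
    by apply/measurable_EFinP; exact: measurable_int ir1.
  - exact: (@measurableT_comp _ _ _ _ _ _ F _ (pair x)).
  move=> s _; rewrite patchE; case: ifPn => // sI; rewrite lee_fin /F/=.
  have s11 : s \in [set` I11] by move: sI; rewrite !inE; exact: sub.
  have := taud xI; rewrite ler_norml => /andP[d1 d2].
  have sx : `|s - x| <= delta.
    move: sI; rewrite inE /= in_itv /= ge_min le_max ler_norml => /andP[].
    by move=> /orP[?|?] /orP[?|?]; apply/andP; split; lra.
  by rewrite /v patchE s11 /chi sx mulr1.
apply: (@le_trans _ _ (\int[mu]_x \int[mu]_s F (x, s))%E).
  apply: ge0_subset_integral => //.
    exact: (measurable_fun_fubini_tonelli_F (m2 := mu) F).
  by move=> x _; exact: integral_ge0.
rewrite (fubini_tonelli (m1 := mu) (m2 := mu))//.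
rewrite [in leRHS]integral_mkcond -ge0_integralZl//; last 3 first.
- apply: (measurable_restrictT _ (measurable_itv _)).1.
  do 2 apply: measurableT_comp => //.
  by apply/measurable_EFinP; exact: measurable_int ir1.
- by move=> s _; rewrite patchE; case: ifP.
- by rewrite lee_fin mulr_ge0.
rewrite le_eqVlt; apply/orP; left; apply/eqP; apply: eq_integral => s _.
transitivity (\int[mu]_x ((v s)%:E * (\1_(`[s - delta, s + delta]) x)%:E))%E.
  apply: eq_integral => x _; rewrite /F/chi/= EFinM indicE mem_setE in_itv /=.
  congr (_ * _%:R%:E)%E; congr (nat_of_bool _); rewrite ler_norml.
  by apply/andP/andP => -[? ?]; split; lra.
rewrite ge0_integralZl//; do ?[by apply/measurable_EFinP; exact: measurable_indic|by move=> y _; rewrite lee_fin].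
rewrite integral_indic//= setIT (lebesgue_measure_ball s delta0) muleC.
  by congr (_ * _)%E; rewrite /v !patchE; case: ifP; rewrite ?normr0.
by rewrite lee_fin normr_ge0.
Qed.

End PrimitiveTranslation.

Section MonotoneInterval.
Context {R : realType}.
Local Notation I11 := (`[(-1 : R), 1]).
Variables (h k : R -> R) (s c : R).
Hypothesis c0 : 0 < c.
Hypothesis dh : forall x : R, is_derive x 1 h (k x).
Hypothesis kc : forall x, c <= s * k x.

Let sdh : forall x : R, is_derive x 1 (fun x => s * h x) (s * k x).
Proof.
by move=> x; apply: is_deriveZ.
Qed.

(** The sign s lets increasing and decreasing maps be treated at once. *)
Lemma signed_mono x y : (s * h x <= s * h y) = (x <= y).
Proof.
have [xy|yx] := leP x y.
  have := derive_lower_bound sdh kc xy.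
  by rewrite -[s * h x <= _]subr_ge0 => /(le_trans _) ->//; rewrite mulr_ge0 ?subr_ge0 ?(ltW c0).
apply/negbTE; rewrite -ltNge -subr_gt0.
by rewrite (lt_le_trans _ (derive_lower_bound sdh kc (ltW yx)))// mulr_gt0 ?subr_gt0.
Qed.

Lemma signed_itv x : (x \in I11) = (s * h (-1) <= s * h x <= s * h 1).
Proof. by rewrite !signed_mono in_itv. Qed.

Lemma signed_neq0 x : k x != 0.
Proof. by apply: contraTneq (kc x) => ->; rewrite mulr0 -ltNge. Qed.

Lemma signed_norm : s = 1 \/ s = -1 -> forall x, `|k x| = s * k x.
Proof.
move=> s1 x; have := kc x; rewrite -[RHS]ger0_norm ?(le_trans (ltW c0) (kc x))// normrM => _.
by case: s1 => ->; rewrite ?normrN normr1 mul1r.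
Qed.

End MonotoneInterval.

Lemma lipschitz_is_continuous (R : realType) (phi : R -> R) (K : R) :
  (forall y z, `|phi y - phi z| <= K * `|y - z|) -> continuous phi.
Proof.
move=> lip x; apply/cvgrPdist_lt => e e0.
have K0 : 0 < (`|K| + 1)^-1 * e by rewrite mulr_gt0 ?invr_gt0 ?ltr_wpDl.
near=> y.
rewrite (le_lt_trans (lip x y))//.
apply: (@le_lt_trans _ _ ((`|K| + 1) * `|x - y|)).
  by rewrite ler_wpM2r// (le_trans (ler_norm K))// lerDl.
rewrite -ltr_pdivlMl ?ltr_wpDl//; near: y; exact: (nbhsx_ballx x _ K0).
Unshelve. all: by end_near. Qed.

Section PushDistance.
Context {R : realType}.
Local Notation mu := (@lebesgue_measure R).
Local Notation I11 := (`[(-1 : R), 1]).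
Variables (hf kf phif hg kg phig r r1 : R -> R) (s c d M L : R).
Hypothesis s1 : s = 1 \/ s = -1.
Hypothesis c0 : 0 < c.
Hypothesis d0 : 0 < d.
Hypothesis dhf : forall x : R, is_derive x 1 hf (kf x).
Hypothesis dhg : forall x : R, is_derive x 1 hg (kg x).
Hypothesis ckf : continuous kf.
Hypothesis ckg : continuous kg.
Hypothesis kfc : forall x, c <= s * kf x.
Hypothesis kgd : forall x, d <= s * kg x.
Hypothesis hfK : cancel hf phif.
Hypothesis phifK : cancel phif hf.
Hypothesis phif_lip : forall y z, `|phif y - phif z| <= c^-1 * `|y - z|.
Hypothesis hgK : cancel hg phig.
Hypothesis cphig : continuous phig.
Hypothesis covg : forall F : R -> \bar R, measurable_fun setT F ->
  (\int[mu]_y F y = \int[mu]_x (F (hg x) * `|kg x|%:E))%E.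
Hypothesis hm1 : hf (-1) = hg (-1).
Hypothesis h1 : hf 1 = hg 1.
Hypothesis ir1 : L1 r1.
Hypothesis rE : forall x, x \in I11 -> r x = r (-1) + \int[mu]_(t in `[-1, x]) r1 t.
Hypothesis rM : forall x, x \in I11 -> `|r x| <= M.
Hypothesis kf_lip : forall x y, x \in I11 -> y \in I11 -> `|kf x - kf y| <= L * `|x - y|.

Let tau x := phif (hg x).
Let I := \int[mu]_(x in [set` I11]) `|kf x - kg x|.

(** This rests on [hf] and [hg] agreeing at -1 and 1, which holds for the interpolant because both
    endpoints are nodes. *)
Let tau_itv x : (tau x \in I11) = (x \in I11).
Proof. by rewrite (signed_itv c0 dhf kfc) /tau phifK hm1 h1 -(signed_itv d0 dhg kgd). Qed.

Let ikfg : L1 (fun x => kf x - kg x).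
Proof.
by apply: C0_L1 => x; apply: cvgB; apply: continuous_subspaceT.
Qed.

(** tau x and x are the values of phif at hg x and hf x, and hg - hf is a primitive of kg - kf that
    vanishes at -1. *)
Let tau_close x : x \in I11 -> `|tau x - x| <= I / c.
Proof.
move=> xI; rewrite -{2}(hfK x) (le_trans (phif_lip _ _))// mulrC ler_pM2r ?invr_gt0//.
have prim h k : continuous k -> (forall x : R, is_derive x 1 h (k x)) ->
    h x = h (-1) + \int[mu]_(t in `[-1, x]) k t.
  move=> ck dh; apply: FTC2_C0 xI => //; apply: continuous_subspaceT => //.
  exact: is_derive_continuous dh.
have x1 : x <= 1 by move: xI; rewrite in_itv /= => /andP[].
have -> : hg x - hf x = - \int[mu]_(t in `[-1, x]) (kf t - kg t).
  rewrite RintegralB//; [|exact: continuous_itv_integrable|exact: continuous_itv_integrable].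
  by rewrite (prim hf kf)// (prim hg kg)// hm1; ring.
by rewrite normrN; exact: (integrable_itv_bound xI).
Qed.

Let I0 : 0 <= I.
Proof. by apply: Rintegral_ge0. Qed.

Let delta0 : 0 <= I / c.
Proof. by rewrite divr_ge0 ?(ltW c0). Qed.

Let cr : C0 r.
Proof. exact: prim_C0 ir1 rE. Qed.

Let ir : L1 r.
Proof. exact: C0_L1. Qed.

Let ctau : continuous tau.
Proof.
have chg : continuous hg := is_derive_continuous dhg.
have cphif : continuous phif := lipschitz_is_continuous phif_lip.
by move=> x; exact: (continuous_comp (chg x) (cphif (hg x))).
Qed.

Let mtau : measurable_fun [set` I11] (fun x => r (tau x) - r x).
Proof.
apply: measurable_funB; last first.
  by apply/measurable_EFinP; exact: measurable_int ir.
apply: (eq_measurable_fun (fun x => (r \_ [set` I11]) (tau x))).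
  by move=> x; rewrite inE /= => xI; rewrite patchE mem_setE tau_itv xI.
apply: measurable_funTS; apply: (@measurableT_comp _ _ _ _ _ _ (r \_ [set` I11]) _ (tau : measurableTypeR R -> measurableTypeR R)).
  by apply/measurable_EFinP; exact: measurable_int (integrable_patchT (measurable_itv I11) ir).
exact: (continuous_measurable_fun ctau).
Qed.

Let M0 : 0 <= M.
Proof. by rewrite (le_trans _ (rM (x := 0) _))// in_itv /=; lra. Qed.

Let L0 : 0 <= L.
Proof.
have := @kf_lip 0 1; rewrite !in_itv /= => /(_ ltac:(lra) ltac:(lra)).
by rewrite sub0r normrN normr1 mulr1; apply: le_trans.
Qed.

Let integrand x : x \in I11 ->
  `|r (tau x) / `|kf (tau x)| * `|kg x| - r x| <=
  M / c * `|kf x - kg x| + M / c * L * (I / c) + `|r (tau x) - r x|.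
Proof.
move=> xI; have tI : tau x \in I11 by rewrite tau_itv.
have nf := signed_norm c0 kfc s1 (tau x); have ng := signed_norm d0 kgd s1 x.
have f0 : 0 < `|kf (tau x)| by rewrite nf (lt_le_trans c0).
have -> : r (tau x) / `|kf (tau x)| * `|kg x| - r x =
    r (tau x) / `|kf (tau x)| * (`|kg x| - `|kf (tau x)|) + (r (tau x) - r x).
  by field; rewrite gt_eqF.
rewrite (le_trans (ler_normD _ _))// lerD2r normrM.
apply: (@le_trans _ _ (M / c * (`|kf x - kg x| + L * (I / c)))); last first.
  by rewrite mulrDr mulrA.
apply: ler_pM => //.
  rewrite normrM normfV normr_id ler_pM ?invr_ge0 ?rM// lef_pV2 ?posrE// nf; exact: kfc.
rewrite (le_trans (ler_dist_dist _ _))// distrC.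
have -> : kf (tau x) - kg x = (kf x - kg x) + (kf (tau x) - kf x) by ring.
rewrite (le_trans (ler_normD _ _))// lerD2l (le_trans (kf_lip tI xI))//.
by rewrite ler_wpM2l// tau_close.
Qed.

(** Under y = hg x the second density becomes r, and the first becomes r (tau x) |kg x| / |kf (tau
    x)|. The three terms of the constant come from |kf - kg|, from the change of kf between x and
    tau x, and from the translation of r. *)
Lemma push_density_distance :
  (\int[mu]_y `|push_density kf phif r y - push_density kg phig r y|%:E <=
  ((M / c + 2 * (M / c * L / c) + 2 / c * \int[mu]_(x in [set` I11]) `|r1 x|) * I)%:E)%E.
Proof.
have kf0 := signed_neq0 c0 kfc; have kg0 := signed_neq0 d0 kgd.
have cphif := lipschitz_is_continuous phif_lip.
have mpf : measurable_fun setT (push_density kf phif r) by exact: measurable_push_density.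
have mpg : measurable_fun setT (push_density kg phig r) by exact: measurable_push_density.
rewrite covg; last by apply/measurable_EFinP; apply: measurableT_comp => //; exact: measurable_funB.
pose G x := M / c * `|kf x - kg x| + M / c * L * (I / c) + `|r (tau x) - r x|.
have mk : measurable_fun [set` I11] (fun x => M / c * `|kf x - kg x|).
  apply: measurable_funM => //; apply: measurableT_comp => //.
  by apply/measurable_EFinP; exact: measurable_int ikfg.
have mG : measurable_fun [set` I11] G.
  by apply: measurable_funD; [exact: measurable_funD|exact: measurableT_comp].
apply: (@le_trans _ _ (\int[mu]_(x in [set` I11]) (G x)%:E)%E).
  rewrite [leRHS]integral_mkcond; apply: ge0_le_integral => //.
  - apply: emeasurable_funM; last first.
      apply/measurable_EFinP; apply: measurableT_comp => //.
      exact: (continuous_measurable_fun ckg).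
    apply/measurable_EFinP; apply: measurableT_comp => //.
    have chg : continuous hg := is_derive_continuous dhg.
    apply: (@measurableT_comp _ _ _ _ _ _ (fun y => push_density kf phif r y - push_density kg phig r y) _ (hg : measurableTypeR R -> measurableTypeR R)).
      exact: measurable_funB.
    exact: (continuous_measurable_fun chg).
  - by apply: (measurable_restrictT _ (measurable_itv _)).1; exact/measurable_EFinP.
  move=> x _; rewrite -EFinM -[X in _ * X]normr_id -normrM mulrBl (push_density_comp r kg0 hgK).
  rewrite /push_density -/(tau x) !patchE !mem_setE tau_itv.
  case: ifPn => xI; last by rewrite !mul0r subrr normr0.
  by rewrite lee_fin integrand.
have Mc0 : 0 <= M / c by rewrite divr_ge0// (ltW c0).
rewrite /G; under eq_integral do rewrite EFinD.
have p1 x : 0 <= M / c * `|kf x - kg x| by rewrite mulr_ge0.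
have p2 : 0 <= M / c * L * (I / c) by apply: mulr_ge0 => //; exact: mulr_ge0.
rewrite ge0_integralD//; do ?[by move=> x _; rewrite lee_fin addr_ge0
  |by apply/measurable_EFinP; exact: measurable_funD
  |by apply/measurable_EFinP; exact: measurableT_comp].
under eq_integral do rewrite EFinD.
rewrite ge0_integralD//; do ?[by move=> x _; rewrite lee_fin|exact/measurable_EFinP].
have iI : mu.-integrable [set` I11] (fun x => `|kf x - kg x|%:E) by exact: integrable_norm.
have ir1n : mu.-integrable [set` I11] (fun x => `|r1 x|%:E) by exact: integrable_norm.
have IE : (I%:E = \int[mu]_(x in [set` I11]) `|kf x - kg x|%:E)%E.
  by rewrite /I /Rintegral fineK//; exact: integrable_fin_num.
have e1 : (\int[mu]_(x in [set` I11]) (M / c * `|kf x - kg x|)%:E = (M / c * I)%:E)%E.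
  under eq_integral do rewrite EFinM.
  by rewrite integralZl// -IE.
have e2 : (\int[mu]_(x in [set` I11]) (M / c * L * (I / c))%:E = (2 * (M / c * L * (I / c)))%:E)%E.
  rewrite integral_cst//= lebesgue_measure_itv/= lte_fin ifT; last by lra.
  by rewrite -EFinD -EFinM; congr _%:E; ring.
have e3 := primitive_translation ir1 rE delta0
  (fun x (xI : x \in I11) => etrans (tau_itv x) xI) tau_close mtau.
rewrite e1 e2 -EFinD; apply: (le_trans (leeD (lexx _) e3)).
have -> : (\int[mu]_(x in [set` I11]) `|r1 x|%:E = (\int[mu]_(x in [set` I11]) `|r1 x|)%:E)%E.
  by rewrite /Rintegral fineK//; exact: integrable_fin_num.
rewrite -EFinM -EFinD lee_fin le_eqVlt; apply/orP; left; apply/eqP.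
by field; rewrite gt_eqF.
Qed.

End PushDistance.

(** * Continuous representatives and positivity of the Sobolev norms *)

Section IntervalFunctions.
Context {R : realType}.
Local Notation mu := (@lebesgue_measure R).
Local Notation I11 := (`[(-1 : R), 1]).
Implicit Types (f u v w : R -> R).

Lemma C0_ge0 u : C0 u -> (forall x, x \in `](-1 : R), 1[ -> 0 <= u x) ->
  forall x, x \in I11 -> 0 <= u x.
Proof.
have lt11 : -1 < 1 :> R by lra.
move=> /(continuous_within_itvP _ lt11) [_ cl cr] u0 x.
rewrite in_itv /= => /andP[x1 x2].
have [->|nx1] := eqVneq x (-1).
  apply: (closed_cvg [set y : R | 0 <= y] _ _ _ cl); first exact: closed_ge.
  near=> y; apply: u0; rewrite in_itv /=; apply/andP; split; near: y.
    exact: nbhs_right_gt.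
  exact: nbhs_right_lt.
have [->|nx2] := eqVneq x 1.
  apply: (closed_cvg [set y : R | 0 <= y] _ _ _ cr); first exact: closed_ge.
  near=> y; apply: u0; rewrite in_itv /=; apply/andP; split; near: y.
    exact: nbhs_left_gt.
  exact: nbhs_left_lt.
by apply: u0; rewrite in_itv /= !lt_neqAle x1 x2 eq_sym nx1 nx2.
Unshelve. all: by end_near. Qed.

Lemma ae_neq (a : R) : {ae mu, forall x : R, x != a}.
Proof.
exists [set a]; split => //; first exact: lebesgue_measure_set1.
by move=> x /= /negP; rewrite negbK => /eqP.
Qed.

Lemma ae_itv_oc (P : R -> Prop) : {ae mu, forall x, `](-1 : R), 1[%classic x -> P x} ->
  {ae mu, forall x, [set` I11] x -> P x}.
Proof.
move=> h; apply: leb_aeS (leb_aeI h (leb_aeI (ae_neq (-1)) (ae_neq 1))) => x [hx [x1 x2]].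
rewrite /= in_itv /= => /andP[y1 y2]; apply: hx.
by rewrite /= in_itv /= !lt_neqAle y1 y2 eq_sym x1 x2.
Qed.

(** The primitive of u - v from -1 is zero; its derivative gives u = v inside, and continuity gives
    the endpoints. *)
Lemma C0_ae_eq u v : C0 u -> C0 v ->
  {ae mu, forall x, `](-1 : R), 1[%classic x -> u x = v x} ->
  forall x, x \in I11 -> u x = v x.
Proof.
move=> cu cv uv.
pose w x := u x + - v x.
have cw : C0 w by apply: C0D => //; exact: C0N.
have w0 x : x \in I11 -> \int[mu]_(t in `[-1, x]) w t = 0.
  rewrite in_itv /= => /andP[x1 x2].
  rewrite /Rintegral (ae_eq_integral (cst 0%E)) ?integral0//.
    apply: (measurable_funS (measurable_itv I11)); last by apply/measurable_EFinP; exact: subspace_continuous_measurable_fun.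
    by move=> y; rewrite /= !in_itv /= => /andP[-> /le_trans ->].
  apply: leb_aeS (ae_itv_oc uv) => y yE; rewrite /= in_itv /= => /andP[y1 yx].
  by rewrite /w yE ?subrr// /= in_itv /= y1 (le_trans yx).
have woo x : x \in `](-1 : R), 1[ -> w x = 0.
  move=> xI; have d : is_derive x 1 (fun=> 0 : R) (w x).
    apply: (prim_derive (u := fun=> 0) cw xI) => y yI.
    by rewrite w0// addr0.
  have [_ <-] := d; exact: derive_cst.
move=> x xI; apply/eqP; rewrite eq_le -subr_ge0 -[X in _ && X]subr_ge0; apply/andP; split.
  rewrite -opprB; apply: (C0_ge0 (u := fun x => - w x) _ _ xI); first exact: C0N.
  by move=> y /woo ->; rewrite oppr0.
by apply: (C0_ge0 cw _ xI) => y /woo ->.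
Qed.

Lemma C0_norm_ge v (c : R) : C0 v -> (forall x, x \in `](-1 : R), 1[ -> c <= `|v x|) ->
  forall x, x \in I11 -> c <= `|v x|.
Proof.
move=> cv vc x xI; rewrite -subr_ge0.
apply: (C0_ge0 (u := fun x => `|v x| + - c) _ _ xI).
  apply: C0D; last exact: C0_cst.
  by move=> y; apply: cvg_norm; exact: cv.
by move=> y /vc; rewrite subr_ge0.
Qed.

(** At an interior point the punctured neighbourhoods relative to [-1, 1] are the ordinary ones. *)
Lemma deriv_on_interior f (l x : R) : x \in `](-1 : R), 1[ -> is_derive x 1 f l ->
  deriv_on Omega f x = l.
Proof.
move=> xI [df fl].
have nO : nbhs x (Omega : set R).
  apply: filterS (near_in_itvoo xI) => y; rewrite /Omega /= !in_itv /= => /andP[/ltW -> /ltW ->].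
  by [].
rewrite /deriv_on.
have -> : within Omega (dnbhs x) = dnbhs x.
  have nO' : dnbhs x (Omega : set R) by exact: nbhs_dnbhs.
  apply/funext => P; apply/propext; split => H; last by apply: filterS H.
  have H' : dnbhs x [set y | Omega y -> P y] := H.
  by apply: filterS (filterI nO' H') => y [Oy]; apply.
apply: cvg_lim => //.
have hs : (fun y : R => y - x) @ dnbhs x --> dnbhs (0 : R).
  rewrite -[0](subrr x); apply: (@continuous_injective_withinNx _ _ (fun y : R => y - x)).
    by apply: cvgB; [exact: cvg_id|exact: cvg_cst].
  by move=> y /addIr.
have -> : (fun y => (f y - f x) / (y - x)) =
    (fun h => h^-1 *: ((f \o shift x) (h *: (1 : R)) - f x)) \o (fun y => y - x).
  by apply/funext => y; rewrite /= [(_ - _) *: _]mulr1 subrK mulrC.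
by rewrite -fl; apply: cvg_comp hs _; exact: df.
Qed.

Lemma has_density_ae (rho : set R -> \bar R) (r r' : R -> R) :
  has_density rho Omega r -> L1 r' ->
  {ae mu, forall x, `](-1 : R), 1[%classic x -> r x = r' x} -> has_density rho Omega r'.
Proof.
move=> [mr rE] ir' rr'; split; first by apply/measurable_EFinP; exact: measurable_int ir'.
move=> B mB; rewrite rE//.
have mO : measurable (Omega `&` B) by apply: measurableI => //; exact: measurable_itv.
apply: ae_eq_integral => //.
- by apply: (measurable_funS (measurable_itv I11)) => //; exact/measurable_EFinP.
- by apply: (measurable_funS (measurable_itv I11)) => //; exact: measurable_int ir'.
by apply: leb_aeS (ae_itv_oc rr') => x xE [xO _] /=; rewrite xE.
Qed.

(** The term of order 0 involves a chosen representative of u. If the norm is 0, this representative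
    vanishes almost everywhere, so u integrates to 0 against every test function. *)
Lemma sobolev_norm_gt0 (lo hi p : R) k u : 0 < p ->
  mu.-integrable `]lo, hi[ (EFin \o u) -> in_sobolev `]lo, hi[ k p u ->
  ~ {ae mu, forall x, `]lo, hi[%classic x -> u x = 0} ->
  (0 < sobolev_norm `]lo, hi[ k p u)%E.
Proof.
move=> p0 iu Hu nz; rewrite /sobolev_norm; apply: poweR_gt0.
have t0 (j : 'I_k.+1) : (0 <= Lp_norm `]lo, hi[ p (weak_deriv `]lo, hi[ j u) `^ p)%E.
  exact: poweR_ge0.
rewrite lt_neqAle sume_ge0// andbT; apply/eqP => /esym/eqP.
rewrite (bigD1 ord0)//= padde_eq0//; last exact: sume_ge0.
move=> /andP[/eqP N0 _]; apply: nz.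
have {}N0 := poweR_eq0_eq0 (Lnorm_ge0 _ _ _) N0.
have [v0 [wv0 _]] := Hu 0%N isT.
have [_ [mv _ _] wE] : is_weak_deriv `]lo, hi[ 0 u (weak_deriv `]lo, hi[ 0 u).
  by apply: xgetPex; exists v0.
set v := weak_deriv _ _ _ in N0 mv wE.
have mv' : measurable_fun setT (EFin \o (v \_ `]lo, hi[)).
  by apply/measurable_EFinP; apply: (measurable_restrictT _ (measurable_itv _)).1.
have v_ae : ae_eq mu setT (EFin \o (v \_ `]lo, hi[)) (cst 0%E).
  by apply: (Lnorm_eq0_eq0 (p := p%:E)) => //; rewrite lte_fin.
apply: (weak0_ae0 iu) => phi tphi.
have := wE phi tphi; rewrite /= expr0 mul1r => ->.
rewrite /Rintegral (ae_eq_integral (cst 0%E)) ?integral0//.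
  apply/measurable_EFinP; apply: measurable_funM => //.
  apply: measurable_funTS; apply: continuous_measurable_fun.
  apply: (is_derive_continuous (k := derive1n 1 phi)) => x.
  by apply: DeriveDef; [exact: (tphi.1 0%N)|rewrite [in RHS]derive1nS derive1E].
apply: leb_aeS v_ae => x vx xI; have := vx I.
  by rewrite /= patchE mem_set// => -[->]; rewrite mul0r.
exact: poweR_ge0.
Qed.

Lemma image_Omega h k (s c : R) : s = 1 \/ s = -1 -> 0 < c ->
  (forall x : R, is_derive x 1 h (k x)) -> (forall x, c <= s * k x) ->
  (exists phi, cancel phi h) ->
  interior (h @` Omega) = `]Num.min (h (-1)) (h 1), Num.max (h (-1)) (h 1)[%classic /\
  forall x, (h x \in `]Num.min (h (-1)) (h 1), Num.max (h (-1)) (h 1)[) = (x \in `](-1 : R), 1[).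
Proof.
move=> s1 c0 dh kc [phi phiK].
have mono := signed_mono c0 dh kc.
have le11 : -1 <= 1 :> R by lra.
have [E F] : (forall x, (h x \in `[Num.min (h (-1)) (h 1), Num.max (h (-1)) (h 1)]) = (x \in I11)) /\
    (forall x, (h x \in `]Num.min (h (-1)) (h 1), Num.max (h (-1)) (h 1)[) = (x \in `](-1 : R), 1[)).
  case: s1 mono => -> mono; split => x; rewrite !in_itv /=.
  - have m a b : (h a <= h b) = (a <= b) by rewrite -[RHS]mono !mul1r.
    by rewrite (min_idPl _) ?(max_idPr _) ?m.
  - have m a b : (h a <= h b) = (a <= b) by rewrite -[RHS]mono !mul1r.
    by rewrite (min_idPl _) ?(max_idPr _) ?m// !ltNge !m.
  - have m a b : (h b <= h a) = (a <= b) by rewrite -[RHS]mono !mulN1r lerN2.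
    by rewrite (min_idPr _) ?(max_idPl _) ?m// andbC.
  - have m a b : (h b <= h a) = (a <= b) by rewrite -[RHS]mono !mulN1r lerN2.
    by rewrite (min_idPr _) ?(max_idPl _) ?m// !ltNge !m andbC.
split => //; rewrite -(interior_itv_bnd _ _ true false); congr interior.
apply/seteqP; split => [_ [x xI <-]|y yI]; first by have := xI; rewrite /Omega /= -E.
by exists (phi y); rewrite ?phiK// /Omega /= -E phiK.
Qed.

End IntervalFunctions.

(** * Exponents, constants and the assembly of the estimate *)

Section Assembly.
Context {R : realType}.
Local Notation mu := (@lebesgue_measure R).
Local Notation I11 := (`[(-1 : R), 1]).

(** With sigma = k + 2, the comparison of exponents amounts to 23 m / 12 + 11/4 <= sigma, which 2 m
    + 4 <= sigma gives with room to spare. *)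
Lemma rate_exponent (m k n : nat) : (1 <= m)%N -> (2 * m + 4 <= k.+2)%N -> (0 < n)%N ->
  root4 n ^+ 3 / root4 n ^+ (4 * k) <=
  n%:R `^ (- (m%:R / m.+1%:R) * (k.+2%:R - 5 / 6)) :> R.
Proof.
move=> m1 mk n0; have w1 : 1 <= root4 n :> R by exact: root4_ge1.
have w0 : 0 < root4 n :> R by rewrite (lt_le_trans ltr01).
rewrite -root4K; move: (root4 n) w1 w0 => w w1 w0.
rewrite -!powR_mulrn ?(ltW w0)// -powRN -powRD; last by rewrite (lt0r_neq0 w0) implybT.
rewrite -powRrM ler_powR//.
have mk' : 2 * m%:R + 4 <= k.+2%:R :> R by rewrite -natrM -natrD ler_nat.
have kE : k.+2%:R = k%:R + 2 :> R by rewrite -addn2 natrD.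
have m0 : 0 < m.+1%:R :> R by rewrite ltr0n.
have mE : m.+1%:R = m%:R + 1 :> R by rewrite -natr1.
have m0' : 0 <= m%:R :> R by [].
have -> : 4 * (- (m%:R / m.+1%:R) * (k.+2%:R - 5 / 6)) =
    - (4 * (m%:R * (k.+2%:R - 5 / 6)) / m.+1%:R) :> R by field; rewrite gt_eqF.
rewrite lerNr opprB ler_pdivrMr// (natrM _ 4 k).
move: mk'; rewrite kE mE; move: (m%:R : R) (k%:R : R) m0' => x y x0 xy.
nra.
Qed.

(** As 4 k >= 12, the left side is at most C / w with w = n^(1/4), so w >= C / e suffices. *)
Lemma eventually_close (C e : R) (k : nat) : 0 < C -> 0 < e -> (4 <= k)%N ->
  exists n1 : nat, forall n, (n1 <= n)%N -> C * root4 n ^+ 11 / root4 n ^+ (4 * k) <= e.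
Proof.
move=> C0 e0 k4; exists (Num.truncn ((C / e) ^+ 4)).+1 => n nn.
have n0 : (0 < n)%N by exact: leq_ltn_trans nn.
have w1 : 1 <= root4 n :> R by exact: root4_ge1.
have w0 : 0 < root4 n :> R by rewrite (lt_le_trans ltr01).
have Ce0 : 0 < C / e by rewrite divr_gt0.
have wC : C / e <= root4 n.
  rewrite -(@ler_pXn2r _ 4)// ?nnegrE ?(ltW w0) ?(ltW Ce0)// root4K.
  have /andP[_ h] := truncn_itv (exprn_ge0 4 (ltW Ce0)).
  by rewrite (le_trans (ltW h))// ler_nat.
rewrite ler_pdivrMr ?exprn_gt0//.
apply: (@le_trans _ _ (e * root4 n ^+ 12)).
  rewrite [_ ^+ 12]exprS mulrA ler_wpM2r ?exprn_ge0 ?(ltW w0)//.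
  by rewrite mulrC -ler_pdivrMr.
by rewrite ler_pM2l// ler_weXn2l//; lia.
Qed.

Lemma pushforward_on_ext (rho : set R -> \bar R) (f h : R -> R) :
  (forall x, x \in I11 -> f x = h x) -> pushforward_on Omega rho f = pushforward_on Omega rho h.
Proof.
move=> fh; apply/funext => B; rewrite /pushforward_on; congr rho.
by apply/seteqP; split => x [xO xB]; split => //; move: xB; rewrite /= fh.
Qed.

Lemma signed_diffeo (u v : R -> R) (c : R) : 0 < c -> C0 v ->
  (forall x, x \in I11 -> u x = u (-1) + \int[mu]_(t in `[-1, x]) v t) ->
  (forall x, x \in I11 -> c <= `|v x|) ->
  exists h k phi s, [/\ continuous k, (forall x : R, is_derive x 1 h (k x)),
    (forall x, x \in I11 -> h x = u x /\ k x = v x),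
    s = 1 \/ s = -1 & (forall x, c <= s * k x)] /\
   [/\ cancel h phi, cancel phi h,
      (forall y z, `|phi y - phi z| <= c^-1 * `|y - z|) &
      (forall F : R -> \bar R, measurable_fun setT F ->
        (\int[mu]_y F y = \int[mu]_x (F (h x) * `|k x|%:E))%E)].
Proof.
move=> c0 cv uE vc; have [h [k [ck dh hu sgn]]] := C1_extension c0 cv uE vc.
have [phi P] := diffeo c0 dh ck sgn.
case: sgn => kc; [exists h, k, phi, 1|exists h, k, phi, (-1)]; split=> //; split => //.
- by left.
- by move=> x; rewrite mul1r.
- by right.
- by move=> x; rewrite mulN1r lerNr.
Qed.

(** A finite positive product is divided out; an infinite one exceeds every bound with C = 1. *)
Lemma absorb_constants (N1 N2 : \bar R) (t K : R) : (0 < N1)%E -> (0 < N2)%E ->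
  exists C, (K%:E <= C%:E * N1 `^ t * N2 `^ t)%E.
Proof.
move=> N10 N20; have q0 : (0 < N1 `^ t * N2 `^ t)%E by rewrite mule_gt0 ?poweR_gt0.
case E : (N1 `^ t * N2 `^ t)%E q0 => [q| |] // q0.
  exists (K / q); rewrite -muleA E -EFinM divfK// gt_eqF//.
by exists 1; rewrite mul1e E leey.
Qed.

Lemma Lp_norm1_sub (p1 p2 q1 q2 : R -> R) :
  measurable_fun setT p1 -> measurable_fun setT p2 ->
  measurable_fun setT q1 -> measurable_fun setT q2 ->
  {ae mu, forall x, q1 x = p1 x} -> {ae mu, forall x, q2 x = p2 x} ->
  Lp_norm setT 1 (p1 \- p2) = (\int[mu]_y `|q1 y - q2 y|%:E)%E.
Proof.
move=> mp1 mp2 mq1 mq2 e1 e2; rewrite /Lp_norm Lnorm1.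
have -> : (p1 \- p2) \_ setT = p1 \- p2 by apply/funext => x; rewrite patchE in_setT.
apply: ae_eq_integral => //.
- by do 2 apply: measurableT_comp => //; exact: measurable_funB.
- by apply/measurable_EFinP; apply: measurableT_comp => //; exact: measurable_funB.
by apply: leb_aeS (leb_aeI e1 e2) => x [-> ->] _.
Qed.

Lemma chainC_ext k (u v : R -> R) : (forall x, x \in I11 -> u x = v x) ->
  chain (@C0 R) k.+1 u -> chain (@C0 R) k.+1 v.
Proof.
move=> uv [w cw uE]; exists w => // x xI; rewrite -!uv//; first exact: uE.
by rewrite in_itv /=; lra.
Qed.

Lemma signed_same (kf kg : R -> R) (s t c : R) (x : R) : 0 < c ->
  s = 1 \/ s = -1 -> t = 1 \/ t = -1 -> c <= s * kf x -> c / 2 <= t * kg x ->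
  `|kf x - kg x| <= c / 2 -> s = t.
Proof.
move=> c0 [->|->] [->|->] //; rewrite ?mulN1r ?mul1r ler_norml => h1 h2 /andP[h3 h4]; lra.
Qed.

Lemma push_density_total (rho : probability (measurableTypeR R) R) (r p h : R -> R) :
  has_density rho Omega r -> has_density (pushforward_on Omega rho h) setT p ->
  (\int[mu]_y (p y)%:E = 1)%E.
Proof.
move=> [_ rE] [_ pE]; rewrite -(setTI setT) -pE// /pushforward_on preimage_setT setIT.
rewrite -(probability_setT rho) rE; last exact: measurable_itv.
by rewrite setIid rE// setIT.
Qed.

End Assembly.

Theorem theorem5 (R : realType) (m sigma : nat) (f : R -> R) (kappa_f : R)
    (rho : probability (measurableTypeR R) R) (r : R -> R)
    (m_ge1 : (1 <= m)%N) (sigma_ge : (2 * m + 4 <= sigma)%N)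
    (f_cont : {within Omega, continuous f})
    (f_sobolev : in_sobolev (interior Omega) sigma 2 f)
    (kappa_f_gt0 : 0 < kappa_f)
    (f_deriv : forall x, Omega x -> kappa_f <= `|deriv_on Omega f x|)
    (r_sobolev : in_sobolev (interior Omega) m 1 r)
    (rho_density : has_density rho Omega r) :
  let A := f @` Omega in
  let mu := pushforward_on Omega rho f in
  let nu n := pushforward_on Omega rho (fun x => (interpolant n f).[x]) in
  [/\ has_density mu setT (pdf mu),
      in_sobolev (interior A) m 1 (pdf mu) &
      exists (n0 : nat) (C : R), forall n, (n0 <= n)%N ->
        [/\ is_interpolant n f (interpolant n f),
            has_density (nu n) setT (pdf (nu n)) &
            (Lp_norm setT 1 (pdf mu \- pdf (nu n))%R <=
             C%:E
             * sobolev_norm (interior A) m 1 (pdf mu) `^ (m.+1%:R)^-1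
             * sobolev_norm (interior Omega) sigma 2 f `^ (m.+1%:R)^-1
             * (n%:R `^ (- (m%:R / m.+1%:R) * (sigma%:R - 5 / 6)))%:E)%E]].
Proof.
have sub : (`](-1 : R), 1[%classic : set R) `<=` [set` `[(-1 : R), 1]].
  by move=> x; rewrite /= !in_itv /= => /andP[/ltW -> /ltW ->].
move=> A mu nu; rewrite !interior_Omega in f_sobolev r_sobolev *.
have cf : C0 f := f_cont.
have if0 := C0_L1 cf.
have ifoo : lebesgue_measure.-integrable (`](-1 : R), 1[%classic : set R) (EFin \o f).
  exact: integrableS if0.
have ir0 := density_integrable rho_density.
have iroo : lebesgue_measure.-integrable (`](-1 : R), 1[%classic : set R) (EFin \o r).
  exact: integrableS ir0.
have [k sk] : exists k, sigma = k.+2 by exists (sigma - 2)%N; lia.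
have [m' mE] : exists m', m = m'.+1 by exists m.-1; lia.
have [w cw fw] := sobolev_chain (or_intror erefl) ifoo f_sobolev.
have [r' cr' rr'] := sobolev_chain (or_introl erefl) iroo r_sobolev.
(* With sigma = k + 2, f agrees with a (k + 2)-fold primitive of an integrable function; so it has k
   + 1 continuous derivatives, and its derivative f1 has k. *)
rewrite sk in cw; have cw' := chain_C0 cw.
have [f1 cf1 wE] := cw'.
have f_w := C0_ae_eq cf (chainC0 cw') fw.
have m1I : (-1 : R) \in `[(-1 : R), 1] by rewrite in_itv /=; lra.
have p1I : (1 : R) \in `[(-1 : R), 1] by rewrite in_itv /=; lra.
have fE x : x \in `[(-1 : R), 1] -> f x = f (-1) + \int[lebesgue_measure]_(t in `[-1, x]) f1 t.
  by move=> xI; rewrite !f_w// wE.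
have cf1' := chainC0 cf1.
(* Inside, [deriv_on] is the ordinary derivative f1; continuity carries the bound to the
   endpoints. *)
have f1_ge : forall x, x \in `[(-1 : R), 1] -> kappa_f <= `|f1 x|.
  apply: C0_norm_ge => // x xI.
  rewrite -(deriv_on_interior xI (prim_derive cf1' xI fE)); apply: f_deriv; exact: sub.
have [hf [kf [phif [s [[ckf dhf hkf s1 kfc] [hfK phifK phif_lip covf]]]]]] :=
  signed_diffeo kappa_f_gt0 cf1' fE f1_ge.
have kf0 := signed_neq0 kappa_f_gt0 kfc.
have kfs := signed_norm kappa_f_gt0 kfc s1.
have chf : continuous hf := is_derive_continuous dhf.
have cphif := lipschitz_is_continuous phif_lip.
have ir' : L1 r' := chain_L1 (fun _ h => h) cr'.
have dr' : has_density rho Omega r' by exact: has_density_ae rho_density ir' rr'.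
pose p := push_density kf phif r'.
have mu_h : mu = pushforward_on Omega rho hf.
  by apply: pushforward_on_ext => x /hkf[].
have dp : has_density mu setT p by rewrite mu_h; exact: push_density_has_density.
have dpdf := pdf_has_density dp.
have ip : lebesgue_measure.-integrable setT (EFin \o p).
  exact: push_density_integrable covf ir'.
have p_ae := density_unique ip dp dpdf.
have [iA hA] := image_Omega s1 kappa_f_gt0 dhf kfc (ex_intro _ phif phifK).
have AE : A = hf @` Omega.
  by apply/seteqP; split => _ [x xO <-]; exists x => //; have [] := hkf x xO.
rewrite AE iA; set a := Num.min _ _ in iA hA *; set b := Num.max _ _ in iA hA *.
(* The density is U o f^-1 with U = r / |f'|, the form to which [transport_sobolev] applies. *)
pose U x := r' x * (s * kf x)^-1.
have pU y : p y = transport phif U y.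
  rewrite /p /push_density /transport /U !patchE kfs; case: ifP => // _.
  by rewrite mul0r.
have ckf_m : chain (@C0 R) m kf.
  rewrite mE; apply: (chainC_ext (u := f1)); first by move=> x /hkf[].
  by rewrite -mE; apply: chain_le cf1 => //; [exact: C0_L1|clear -sigma_ge sk m_ge1; lia].
have cU : chain (@L1 R) m U.
  apply: chainLC_mul => //; apply: chainC_inv; last exact: chainC_scale.
  by move=> x _; rewrite -kfs normr_eq0.
have mpdf : measurable_fun setT (pdf mu) by case: dpdf.
have sob : in_sobolev `]a, b[ m 1 (pdf mu).
  apply: (transport_sobolev chf ckf dhf kf0 hfK cphif covf kfs hA cU ckf_m mpdf).
  by apply: leb_aeS p_ae => y <- _.
have ipdf : lebesgue_measure.-integrable (`]a, b[%classic : set R) (EFin \o pdf mu).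
  apply: (integrable_ae _ _ (integrableS _ _ _ ip)) => //; first exact: measurable_funTS.
  by apply: leb_aeS p_ae => y.
(* The density is carried by the image of f; if it vanished there, its total mass would be 0 and not
   1. *)
have N1 : (0 < sobolev_norm `]a, b[ m 1 (pdf mu))%E.
  apply: (sobolev_norm_gt0 ltr01 ipdf sob) => z.
  have [dp'] := (push_density_total dr' (h := f) dp, tt).
  suff p0 : (\int[lebesgue_measure]_y (p y)%:E = 0)%E.
    by move: dp'; rewrite p0 => -[] /esym/eqP; rewrite oner_eq0.
  rewrite (ae_eq_integral (cst 0%E)) ?integral0//.
    by apply/measurable_EFinP; case: dp.
  apply: leb_aeS (leb_aeI z (leb_aeI p_ae (leb_aeI (ae_neq (hf (-1))) (ae_neq (hf 1))))).
  move=> y [yab [py [y1 y2]]] _ /=; congr _%:E.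
  have [yI|yI] := boolP (phif y \in `](-1 : R), 1[).
    by rewrite py yab//= -(phifK y) hA.
  rewrite pU /transport patchE mem_setE; case: ifPn => // pI; exfalso.
  move: yI; rewrite in_itv /=; move: pI; rewrite in_itv /= => /andP[z1 z2] /negP; apply.
  rewrite !lt_neqAle z1 z2 !andbT; apply/andP; split.
    by apply: contraNneq y1 => ->; rewrite phifK.
  by apply: contraNneq y2 => <-; rewrite phifK.
(* f = 0 would contradict strict monotonicity between -1 and 1. *)
have N2 : (0 < sobolev_norm (`](-1)%R, 1%R[%classic : set R) sigma 2 f)%E.
  apply: (sobolev_norm_gt0 _ ifoo f_sobolev) => // z.
  have fz := C0_ae_eq cf (@C0_cst R 0) z.
  have := signed_mono kappa_f_gt0 dhf kfc 1 (-1).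
  by rewrite (hkf _ m1I).1 (hkf _ p1I).1 !fz// lexx => /esym; lra.
split => //.
have [n1 [C1 [C10 rate]]] := interpolation_rate cf1 fE.
have k4 : (4 <= k)%N by clear -sigma_ge sk m_ge1; lia.
have kf2 : 0 < kappa_f / 2 by rewrite divr_gt0.
have [n2 close] := eventually_close C10 kf2 k4.
(* Inputs of the distance estimate: m >= 1 provides the derivative r1 of r, and k >= 1 a bounded
   derivative f2 of f1, hence a Lipschitz constant. *)
have [r1 cr1 r'E] : chain (@L1 R) m'.+1 r' by rewrite -mE.
have ir1 := chain_L1 (fun _ h => h) cr1.
have cr'0 : C0 r' := prim_C0 ir1 r'E.
have [M [M0 r'M]] := C0_bounded cr'0.
have [k' kE] : exists k', k = k'.+1 by case: (k) k4 => // j _; exists j.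
have [f2 cf2 f1E] : chain (@C0 R) k'.+1 f1 by rewrite -kE.
have [L [L0 f2L]] := C0_bounded (chainC0 cf2).
have kf_lip x y : x \in `[(-1 : R), 1] -> y \in `[(-1 : R), 1] -> `|kf x - kf y| <= L * `|x - y|.
  move=> xI yI; rewrite (hkf _ xI).2 (hkf _ yI).2.
  exact: (primitive_lipschitz (C0_L1 (chainC0 cf2)) f1E f2L).
pose K := M / kappa_f + 2 * (M / kappa_f * L / kappa_f) +
  2 / kappa_f * \int[lebesgue_measure]_(x in [set` `[(-1 : R), 1]]) `|r1 x|.
have K0 : 0 <= K.
  have i0 : 0 <= \int[lebesgue_measure]_(x in [set` `[(-1 : R), 1]]) `|r1 x| by apply: Rintegral_ge0.
  by rewrite !addr_ge0 ?mulr_ge0 ?divr_ge0 ?invr_ge0 ?(ltW kappa_f_gt0) ?(ltW M0) ?(ltW L0).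
have [C HC] := absorb_constants (m.+1%:R^-1) (K * C1) N1 N2.
(* The successor ensures n > 0, so that the interpolant exists. *)
exists (maxn n1 n2.+1), C => n; rewrite geq_max => /andP[nn1 nn2].
have n0 : (0 < n)%N by exact: leq_ltn_trans nn2.
have ig := interpolantP f n0.
have [_ gf] := ig.
have [ha hb] := rate n nn1; set g := interpolant n f in ig gf ha hb *.
have cls := close n (ltnW nn2).
have dist x : x \in `[(-1 : R), 1] -> `|f1 x - g^`().[x]| <= kappa_f / 2.
  by move=> /hb /le_trans; apply.
(* g_n' stays within kappa_f / 2 of f', so half of the lower bound survives. *)
have g_ge x : x \in `[(-1 : R), 1] -> kappa_f / 2 <= `|g^`().[x]|.
  move=> xI; have := f1_ge x xI; have := dist x xI.
  by have := ler_normD (f1 x - g^`().[x]) (g^`().[x]); rewrite subrK; lra.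
have cg' : C0 (horner g^`()) by apply: continuous_subspaceT; exact: horner_continuous.
have [hg [kg [phig [t [[ckg dhg hkg t1 kgc] [hgK phigK phig_lip covg]]]]]] :=
  signed_diffeo kf2 cg' (@horner_primitive R g) g_ge.
have kg0 := signed_neq0 kf2 kgc.
have chg : continuous hg := is_derive_continuous dhg.
have cphig := lipschitz_is_continuous phig_lip.
pose q := push_density kg phig r'.
have nu_h : nu n = pushforward_on Omega rho hg.
  by apply: pushforward_on_ext => x /hkg[].
have dq : has_density (nu n) setT q by rewrite nu_h; exact: push_density_has_density.
have dpdfn := pdf_has_density dq.
have iq : lebesgue_measure.-integrable setT (EFin \o q).
  exact: push_density_integrable covg ir'.
have q_ae := density_unique iq dq dpdfn.
split => //.
(* The derivatives have constant signs, so comparing them at the point 0 is enough. *)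
have st : s = t.
  apply: (signed_same (kf := kf) (kg := kg) (x := 0) kappa_f_gt0) => //.
  have zI : (0 : R) \in `[(-1 : R), 1] by rewrite in_itv /=; lra.
  by rewrite (hkf _ zI).2 (hkg _ zI).2 dist.
have e1 : hf (-1) = hg (-1).
  by rewrite (hkf _ m1I).1 (hkg _ m1I).1 gf//; constructor 1.
have e2 : hf 1 = hg 1.
  by rewrite (hkf _ p1I).1 (hkg _ p1I).1 gf//; constructor 2.
rewrite -st in kgc.
have D := push_density_distance s1 kappa_f_gt0 kf2 dhf dhg ckf ckg kfc kgc hfK phifK phif_lip
  hgK cphig covg e1 e2 ir1 r'E r'M kf_lip.
have [mp _] := dp; have [mq _] := dq; have [mpn _] := dpdfn.
rewrite (Lp_norm1_sub mpdf mpn mp mq p_ae q_ae).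
apply: (le_trans D); rewrite -/K.
have -> : \int[lebesgue_measure]_(x in [set` `[(-1 : R), 1]]) `|kf x - kg x| =
    \int[lebesgue_measure]_(x in `[-1, 1]) `|f1 x - g^`().[x]|.
  by apply: eq_Rintegral => x; rewrite inE /= => xI; rewrite (hkf _ xI).2 (hkg _ xI).2.
rewrite sk in sigma_ge *.
have rho0 := powR_ge0 (n%:R : R) (- (m%:R / m.+1%:R) * (k.+2%:R - 5 / 6)).
apply: (@le_trans _ _ ((K * C1)%:E * (n%:R `^ (- (m%:R / m.+1%:R) * (k.+2%:R - 5 / 6)))%:E)%E).
  rewrite -EFinM lee_fin -mulrA ler_wpM2l// (le_trans ha)// -mulrA ler_wpM2l ?(ltW C10)//.
  exact: rate_exponent.
by rewrite lee_wpmul2r ?lee_fin// -sk.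
Qed.
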